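(* Let $\{G^N\}_{N\ge1}$ be a clustered proportionally sparse sequence of graphs satisfying Condition C. Then the sequence of random variables $\{\mathbf q^N(\infty)\}_{N\ge1}$ converges weakly to $\mathbf q^*$, the unique fixed point (in $\mathcal S$) of the system of ODEs (ODE) given in the context.
   Context: Parameters: integers $K,M\ge1$, $d\ge2$; $\mathcal K=\{1,\dots,K\}$, $\mathcal M=\{1,\dots,M\}$; constants $\lambda,\xi,u_m>0$; $w_k\in(0,1)$ with $\sum_kw_k=1$; $v_m\in(0,1)$ with $\sum_mv_m=1$; $\lambda\xi<\sum_mu_mv_m$. $\mathbb N_0=\mathbb N\cup\{0\}$. System: for each $N$, $G^N=(W^N,V^N,E^N)$ is a bipartite graph with dispatchers $W^N=\{1,\dots,W(N)\}$, servers $V^N=\{1,\dots,N\}$, edges $E^N\subseteq W^N\times V^N$, and $W(N)/N\to\xi$. $W^N$ is partitioned into types $W^N_k$ with $|W^N_k|/W(N)\to w_k$; $V^N$ is partitioned into types $V^N_m$ with $|V^N_m|/N\to v_m$. Let $\mathcal N^N_w(i)=\{j\in V^N:(i,j)\in E^N\}$, $\delta^N_i=|\mathcal N^N_w(i)|$, $\deg^N_w(i,m)=|\{j\in V^N_m:(i,j)\in E^N\}|$, $\deg^N_v(k,j)=|\{i\in W^N_k:(i,j)\in E^N\}|$. Dynamics (local JSQ($d$)): tasks arrive at each dispatcher according to independent Poisson processes of rate $\lambda$. A task arriving at dispatcher $i$ with $\delta^N_i\ge d$ is immediately assigned to the server with the shortest queue among $d$ servers selected uniformly at random from $\mathcal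 N^N_w(i)$ (ties broken uniformly at random); if $\delta^N_i<d$, it is assigned to a server chosen uniformly at random from $\mathcal N^N_w(i)$. Each server serves its own queue; service times at a type-$m$ server are independent exponential with mean $1/u_m$. $X^N_j(t)$ is the number of tasks (including in service) at server $j$ at time $t$. Occupancy: $q^N_{m,l}(t)=\frac1{|V^N_m|}\sum_{j\in V^N_m}\mathbf 1_{(X^N_j(t)\ge l)}$, $\mathbf q^N(t)=(q^N_{m,l}(t),m\in\mathcal M,l\in\mathbb N_0)\in\mathcal S$, where $\mathcal S=\{\mathbf q\in[0,1]^{M\times\mathbb N_0}:q_{m,0}=1,\ q_{m,l}\ge q_{m,l+1},\ \sum_{l}q_{m,l}<\infty\ \forall m,l\}$ has the $\ell_1$-topology. $\mathbf q^N(\infty)$ is the same functional applied to the stationary state of the Markov chain $(X^N_j(t))_{j\in V^N}$ (which is ergodic for all large $N$ in the subcritical regime). Clustered proportional sparsity: for any $\varepsilon>0$, $$\sup_{k\in\mathcal K}\sup_{U\subseteq V^N}\Big|\Big\{i\in W^N_k:\Big|\frac{|\mathcal N^N_w(i)\cap U|}{|\mathcal N^N_w(i)|}-\frac{|E^N_k(U)|}{|E^N_k(V^N)|}\Big|\ge\varepsilon\Big\}\Big|\Big/|W^N_k|\xrightarrow{N\to\infty}0,$$ where $E^N_k(U)=\{(i,j)\in W^N_k\times U:(i,j)\in E^N\}$. Condition C: (a) for each $k,m$, $\lim_N|\{(i,j)\in W^N_k\times V^N_m:(i,j)\in E^N\}|/(|W^N_k||V^N_m|)=p_{k,m}\in[0,1]$;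 (b) for each $k,m$, $\frac{\max_{i\in W^N_k}\deg^N_w(i,m)}{\min_{i\in W^N_k}\deg^N_w(i,m)}\to1$ and $\frac{\max_{j\in V^N_m}\deg^N_v(k,j)}{\min_{j\in V^N_m}\deg^N_v(k,j)}\to1$. Put $\delta_k=\sum_mp_{k,m}v_m>0$. Standing assumption (subcritical regime): $\rho^N\to\rho$ for some $\rho<1$, where $$\rho^N=\max_{\emptyset\ne U\subseteq V^N}\Big(\sum_{m\in\mathcal M}u_m|U\cap V^N_m|\Big)^{-1}\sum_{i\in W^N}\Big(\mathbf 1_{(\delta^N_i\ge d)}\lambda\frac{\binom{|U\cap\mathcal N^N_w(i)|}{d}}{\binom{\delta^N_i}{d}}+\mathbf 1_{(\delta^N_i<d)}\lambda\frac{|U\cap\mathcal N^N_w(i)|}{\delta^N_i}\Big).$$ (ODE): for all $m\in\mathcal M$, $q_{m,0}(t)=1$ and for all $l\in\mathbb N$, $$\frac{dq_{m,l}(t)}{dt}=-u_m\big(q_{m,l}(t)-q_{m,l+1}(t)\big)+\lambda\xi\big(q_{m,l-1}(t)-q_{m,l}(t)\big)\sum_{k\in\mathcal K}\frac{p_{k,m}w_k}{\delta_k}\,\frac{(\tilde q_{k,l-1}(t))^d-(\tilde q_{k,l}(t))^d}{\tilde q_{k,l-1}(t)-\tilde q_{k,l}(t)},$$ with $\tilde q_{k,l}=\sum_{m}\frac{v_mp_{k,m}}{\delta_k}q_{m,l}$; $\frac{a^d-b^d}{a-b}$ is read as $\sum_{r=0}^{d-1}a^rb^{d-1-r}$ (also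 when $a=b$). A fixed point is a $\mathbf q^*$ with $q^*_{m,0}=1$ at which all right-hand sides vanish. *)

(* Defs.v *)
From HB Require Import structures.
From mathcomp Require Import all_boot all_order all_algebra.
From mathcomp Require Import all_classical all_reals all_analysis.

Set Implicit Arguments.
Unset Strict Implicit.
Unset Printing Implicit Defensive.

Import Order.TTheory GRing.Theory Num.Theory.
Import numFieldNormedType.Exports.

Local Open Scope classical_set_scope.
Local Open Scope ring_scope.

(* The N-th system graph: dispatchers are 'I_(nW g), servers are 'I_N, and the
   maps wtype, vtype encode the partitions into types (a class may be empty). *)
Record bigraph (K M N : nat) := Bigraph {
  nW : nat;
  edge : 'I_nW -> 'I_N -> bool;
  wtype : 'I_nW -> 'I_K;
  vtype : 'I_N -> 'I_M }.

Section Graph.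
Context {R : realType} {K M N : nat} (g : bigraph K M N).

Definition Wcls (k : 'I_K) : {set 'I_(nW g)} := [set i | wtype i == k]%SET.
Definition Vcls (m : 'I_M) : {set 'I_N} := [set j | vtype g j == m]%SET.

Definition nbr (i : 'I_(nW g)) : {set 'I_N} := [set j | edge i j]%SET.
Definition delta (i : 'I_(nW g)) : nat := #|nbr i|.

Definition degw (i : 'I_(nW g)) (m : 'I_M) : nat :=
  #|[set j in Vcls m | edge i j]%SET|.
Definition degv (k : 'I_K) (j : 'I_N) : nat :=
  #|[set i in Wcls k | edge i j]%SET|.

Definition edges (k : 'I_K) (U : {set 'I_N}) : {set 'I_(nW g) * 'I_N} :=
  [set e | [&& e.1 \in Wcls k, e.2 \in U & edge e.1 e.2]]%SET.

Definition cps_bad (eps : R) (k : 'I_K) (U : {set 'I_N}) : {set 'I_(nW g)} :=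
  [set i in Wcls k |
    eps <= `| #|nbr i :&: U|%:R / #|nbr i|%:R
              - #|edges k U|%:R / #|edges k [set: 'I_N]%SET|%:R | ]%SET.

Definition cps_sup (eps : R) : R :=
  \big[Order.max/0]_(k < K) \big[Order.max/0]_(U : {set 'I_N})
    (#|cps_bad eps k U|%:R / #|Wcls k|%:R).

(* max / min, where 0 / 0 is read as 1, so that a pair of types without any
   edge between them is degree-regular; a / 0 is 0 for a > 0 and so stays away
   from 1, as the value +oo would. *)
Definition maxmin_ratio (a b : nat) : R :=
  if a == 0%N then 1 else a%:R / b%:R.

(* Degrees of dispatchers are at most N and degrees of servers are at most
   nW g, so that these units of minn do not affect the minima. *)
Definition degw_ratio (k : 'I_K) (m : 'I_M) : R :=
  maxmin_ratio (\max_(i in Wcls k) degw i m)%N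
               (\big[minn/N]_(i in Wcls k) degw i m).
Definition degv_ratio (k : 'I_K) (m : 'I_M) : R :=
  maxmin_ratio (\max_(j in Vcls m) degv k j)%N
               (\big[minn/nW g]_(j in Vcls m) degv k j).

Section Rho.
Variables (d : nat) (lam : R) (u : 'I_M -> R).

Definition rho_arr (U : {set 'I_N}) : R :=
  \sum_(i < nW g)
    if (d <= delta i)%N then
      lam * ('C(#|U :&: nbr i|, d)%:R / 'C(delta i, d)%:R)
    else lam * (#|U :&: nbr i|%:R / (delta i)%:R).

Definition rhoN : R :=
  \big[Order.max/0]_(U : {set 'I_N} | U != finset.set0)
    ((\sum_(m < M) u m * #|U :&: Vcls m|%:R)^-1 * rho_arr U).

End Rho.

End Graph.

(* Queue-length vectors, with the discrete sigma-algebra. *)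
Definition state (N : nat) : Type := {ffun 'I_N -> nat}.

HB.instance Definition _ (N : nat) := Choice.on (state N).
HB.instance Definition _ (N : nat) :=
  isPointed.Build (state N) ([ffun=> 0%N] : {ffun 'I_N -> nat}).
HB.instance Definition _ (N : nat) :=
  @isMeasurable.Build default_measure_display (state N)
    discrete_measurable discrete_measurable0
    discrete_measurableC discrete_measurableU.

Section Dynamics.
Context {R : realType} {K M N : nat} (g : bigraph K M N).
Variables (d : nat) (lam : R) (u : 'I_M -> R).

Definition incr (x : state N) (j : 'I_N) : state N :=
  [ffun j' => if j' == j then (x j').+1 else x j'].
Definition decr (x : state N) (j : 'I_N) : state N :=
  [ffun j' => if j' == j then (x j').-1 else x j'].

Definition shortest (x : state N) (A : {set 'I_N}) : {set 'I_N} :=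
  [set j in A | [forall j' in A, (x j <= x j')%N]]%SET.

(* Probability that a task arriving at dispatcher i is assigned to server j
   when the queue lengths are x: the average, over the d-subsets A of the
   neighbourhood, of the uniform law on the shortest queues of A. A dispatcher
   without neighbours discards its tasks. *)
Definition assign (x : state N) (i : 'I_(nW g)) (j : 'I_N) : R :=
  if (d <= delta i)%N then
    (\sum_(A : {set 'I_N} | (A \subset nbr i) && (#|A| == d))
        (j \in shortest x A)%:R / #|shortest x A|%:R) / 'C(delta i, d)%:R
  else (j \in nbr i)%:R / (delta i)%:R.

Definition arrival_rate (x : state N) (j : 'I_N) : R :=
  \sum_(i < nW g) lam * assign x i j.
Definition service_rate (x : state N) (j : 'I_N) : R :=
  if (0 < x j)%N then u (vtype g j) else 0.

(* The Q-matrix: superposition of the independent Poisson arrival streams and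
   of the exponential services. *)
Definition Qmatrix (x y : state N) : R :=
  \sum_(j < N) (arrival_rate x j * ((y == incr x j)%:R - (y == x)%:R)
              + service_rate x j * ((y == decr x j)%:R - (y == x)%:R)).

Definition occupancy (x : state N) (m : 'I_M) (l : nat) : R :=
  #|[set j in Vcls g m | (l <= x j)%N]%SET|%:R / #|Vcls g m|%:R.

End Dynamics.

(* P is the (standard, stochastic) transition function with Q-matrix Q. *)
Definition transition_function {R : realType} {N : nat}
    (P : R -> R.-pker (state N) ~> (state N)) (Q : state N -> state N -> R) :=
  [/\ forall x A, P 0 x A = \d_x A,
      forall s t, 0 <= s -> 0 <= t -> forall x A,
        P (s + t) x A = (\int[P s x]_y P t y A)%E
    & forall x y,
        (fine (P t x [set y]) - (x == y)%:R) / t @[t --> 0^'+] --> Q x y].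

(* The rates of Qmatrix are bounded, so that the transition function is
   determined by the Q-matrix. *)
Definition stationary {R : realType} {N : nat}
    (Q : state N -> state N -> R) (pi : probability (state N) R) :=
  exists2 P : R -> R.-pker (state N) ~> (state N),
    transition_function P Q
    & forall t, 0 <= t -> forall A, (\int[pi]_x P t x A)%E = pi A.

Section OccupancySpace.
Context {R : realType} {M : nat}.
Implicit Types q : 'I_M -> nat -> R.

Definition inS q : Prop :=
  [/\ forall m l, 0 <= q m l <= 1,
      forall m, q m 0%N = 1,
      forall m l, q m l.+1 <= q m l
    & forall m, cvgn (series (q m))].

Definition l1dist q q' : \bar R :=
  (\sum_(m < M) \sum_(0 <= l <oo) `|q m l - q' m l|%:E)%E.

Definition S_continuous (f : ('I_M -> nat -> R) -> R) : Prop :=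
  forall q, inS q -> forall eps, 0 < eps -> exists2 eta : R, 0 < eta &
    forall q', inS q' -> (l1dist q q' < eta%:E)%E -> `|f q - f q'| < eps.

Definition S_bounded (f : ('I_M -> nat -> R) -> R) : Prop :=
  exists B : R, forall q, inS q -> `|f q| <= B.

End OccupancySpace.

(* Weak convergence in S of occ N under pi N to the constant qs. The value of
   occ N may lie outside S for finitely many N (when a server type is empty). *)
Definition weak_cvg_S {R : realType} {M : nat}
    (pi : forall N, probability (state N) R)
    (occ : forall N, state N -> 'I_M -> nat -> R) (qs : 'I_M -> nat -> R) :=
  forall f : ('I_M -> nat -> R) -> R, S_continuous f -> S_bounded f ->
    ('E_(pi N)[fun x => f (occ N x)])%E @[N --> \oo] --> (f qs)%:E.

Section ODE.
Context {R : realType} {K M : nat}.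
Variables (d : nat) (lam xi : R) (u v : 'I_M -> R) (w : 'I_K -> R).
Variable p : 'I_K -> 'I_M -> R.

Definition dk (k : 'I_K) : R := \sum_(m < M) p k m * v m.

Definition qtilde (q : 'I_M -> nat -> R) (k : 'I_K) (l : nat) : R :=
  \sum_(m < M) v m * p k m / dk k * q m l.

(* (a ^ d - b ^ d) / (a - b), also for a = b *)
Definition divdiff (a b : R) : R := \sum_(r < d) a ^+ r * b ^+ (d.-1 - r).

Definition ode_rhs (q : 'I_M -> nat -> R) (m : 'I_M) (l : nat) : R :=
  - u m * (q m l - q m l.+1)
  + lam * xi * (q m l.-1 - q m l)
    * \sum_(k < K) p k m * w k / dk k * divdiff (qtilde q k l.-1) (qtilde q k l).

Definition fixed_point (q : 'I_M -> nat -> R) : Prop :=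
  (forall m, q m 0%N = 1) /\
  forall m l, (0 < l)%N -> ode_rhs q m l = 0.

End ODE.

Section Conditions.
Context {R : realType} {K M : nat} (G : forall N, bigraph K M N).

Definition clustered_prop_sparse : Prop :=
  forall eps : R, 0 < eps -> cps_sup (G N) eps @[N --> \oo] --> (0 : R).

Definition conditionC (p : 'I_K -> 'I_M -> R) : Prop :=
  [/\ forall k m,
        #|edges (G N) k (Vcls (G N) m)|%:R
          / (#|Wcls (G N) k|%:R * #|Vcls (G N) m|%:R) @[N --> \oo] --> p k m,
      forall k m, (degw_ratio (G N) k m : R) @[N --> \oo] --> (1 : R)
    & forall k m, (degv_ratio (G N) k m : R) @[N --> \oo] --> (1 : R)].

End Conditions.

(* Main.v *)
Require Import Defs.
From mathcomp Require Import all_boot all_order all_algebra.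
From mathcomp Require Import perm.
From mathcomp Require Import all_classical all_reals all_analysis.
From mathcomp Require Import ring lra zify.

Set Implicit Arguments.
Unset Strict Implicit.
Unset Printing Implicit Defensive.

Import Order.TTheory GRing.Theory Num.Theory.
Import numFieldNormedType.Exports.

Local Open Scope classical_set_scope.
Local Open Scope ring_scope.

(** The stationary law is studied through the identity that the generator has
    mean zero under it, tested against a few functions of the occupancy.

    The fixed point. For a small step h the Euler map q + h * rhs q is monotone
    on [0, 1]-valued families that are nonincreasing in the level
    ([euler_mono]). Its iterates from the empty system increase to a fixed
    point [eqm], which lies below every other one ([fixed_ge_eqm]). Evaluating
    the maximum that defines rho^N at sets of servers with a prescribed
    proportion of each type, and letting N grow, yields a mean-field form of
    subcriticality ([subcritical_limit]). Combined with the balance of mass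
    above a level ([mass_balance]), it makes [eqm] decay like rho ^ l, so that
    [eqm] is in S. Within S the sum of all equations says that the departure
    rate, a weighted sum of the first levels, equals the arrival rate lam * xi
    ([fixed_throughput]). A fixed point above [eqm] therefore has the same first
    level, and the equation at each level determines the next one
    ([fixed_unique]).

    The drift. Neighbours with equal queues are equally likely to receive a
    task ([assign_sym]), and the shortest of the sampled queues reaches l when
    all of them do. Hence the probability that a task of a dispatcher joins a
    queue of length l in class m is a function of the shares that four sets of
    servers have in its neighbourhood ([assign_class_dist]). Clustered
    proportional sparsity and the degree conditions replace these shares by
    deterministic averages, uniformly over all sets and for most dispatchers
    ([share_unull]), while the degrees tend to infinity ([deg_large]), so that
    sampling without replacement becomes sampling with replacement
    ([bin_ratio]). The generator applied to an occupancy is thus close to the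
    vector field, uniformly over all states ([drift_unull]).

    Stationarity. A stationary law gives mean zero to the generator of every
    function with finitely many values ([stationary_gen]). This is used in four
    ways. The flow into a level equals the flow out of it ([level_flow]); this
    fixes the throughput of level 1, and the definition of rho^N makes the mean
    occupancies decay geometrically ([Eload_decay]). The squared deficit of the
    occupancy below the Euler iterates, tested iterate by iterate, shows that
    the occupancy is asymptotically at least [eqm] ([EX_below_eqm]). At level 1
    the occupancy is thus asymptotically above [eqm] with the same weighted
    mean, hence converges to it in L1 ([err1_cvg]). Finally the drift of level
    l + 1 is affine in level l + 2, and its mean vanishes, so that L1
    convergence passes from levels l and l + 1 to level l + 2 ([err_cvg]). The
    uniform geometric tails upgrade this to convergence of the mean l1 distance
    ([EX_l1dist_le]), which implies weak convergence to a constant. *)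

(** * Limits and divided differences *)

Section LimitRules.
Context {R : realType} {T : Type} (F : set_system T) {FF : Filter F}.

Lemma cvg_sumr (I : Type) (r : seq I) (P : pred I) (f : I -> T -> R) (a : I -> R) :
  (forall i, P i -> f i x @[x --> F] --> a i) ->
  \sum_(i <- r | P i) f i x @[x --> F] --> \sum_(i <- r | P i) a i.
Proof. by move=> h; apply: cvg_big => //; exact: add_continuous. Qed.

Lemma cvg_powr (f : T -> R) (a : R) n : f x @[x --> F] --> a -> f x ^+ n @[x --> F] --> a ^+ n.
Proof.
move=> h; elim: n => [|n IH]; first by rewrite expr0; exact: cvg_cst.
by under eq_cvg do rewrite exprS; rewrite exprS; exact: cvgM.
Qed.

End LimitRules.

Lemma cvgn_le_cst {R : realType} (f : nat -> R) (a b : R) :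
  f n @[n --> \oo] --> a -> (forall n, f n <= b) -> a <= b.
Proof. by move=> fa fb; apply: (cvgr_to_le fa); exact: nearW. Qed.

Section DivDiff.
Context {R : realType}.
Implicit Types (a b : R) (d : nat).

Lemma divdiffE d a b : (a - b) * divdiff d a b = a ^+ d - b ^+ d.
Proof.
rewrite subrXX /divdiff; congr (_ * _).
rewrite (reindex_inj rev_ord_inj) /=; apply: eq_bigr => i _.
have hi := ltn_ord i.
by congr (_ ^+ _ * _ ^+ _); case: d i hi => [|d] i hi /=; lia.
Qed.

Lemma expr_lip n a b : 0 <= a <= 1 -> 0 <= b <= 1 ->
  `|a ^+ n - b ^+ n| <= n%:R * `|a - b|.
Proof.
move=> /andP[a0 a1] /andP[b0 b1]; rewrite subrXX normrM mulrC ler_wpM2r //.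
apply: le_trans (ler_norm_sum _ _ _) _; rewrite -[leRHS]mulr1 mulr_natl.
rewrite -[n in leRHS]card_ord -sumr_const ler_sum // => i _.
by rewrite ger0_norm ?mulr_ge0 ?exprn_ge0 // mulr_ile1 ?exprn_ge0 ?exprn_ile1.
Qed.

Lemma divdiff_ge0 d a b : 0 <= a -> 0 <= b -> 0 <= divdiff d a b.
Proof. by move=> a0 b0; apply: sumr_ge0 => i _; rewrite mulr_ge0 ?exprn_ge0. Qed.

Lemma divdiff_le d a b : 0 <= a <= 1 -> 0 <= b <= 1 -> divdiff d a b <= d%:R.
Proof.
move=> /andP[a0 a1] /andP[b0 b1]; rewrite -[leRHS]mulr1 mulr_natl.
rewrite -[d in leRHS]card_ord -sumr_const ler_sum // => i _.
by rewrite mulr_ile1 ?exprn_ge0 ?exprn_ile1.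
Qed.

Lemma divdiff_mono d a b a' b' : 0 <= a <= a' -> 0 <= b <= b' ->
  divdiff d a b <= divdiff d a' b'.
Proof.
move=> /andP[a0 aa'] /andP[b0 bb']; apply: ler_sum => i _.
have [a'0 b'0] := (le_trans a0 aa', le_trans b0 bb').
by rewrite ler_pM ?exprn_ge0 // lerXn2r ?nnegrE.
Qed.

Lemma divdiff_lip d a b a' b' :
  0 <= a <= 1 -> 0 <= b <= 1 -> 0 <= a' <= 1 -> 0 <= b' <= 1 ->
  `|divdiff d a b - divdiff d a' b'| <= d%:R ^+ 2 * (`|a - a'| + `|b - b'|).
Proof.
move=> ha hb ha' hb'; rewrite /divdiff -sumrB.
apply: le_trans (ler_norm_sum _ _ _) _.
rewrite expr2 -mulrA mulr_natl -[d in leRHS]card_ord -sumr_const.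
rewrite ler_sum // card_ord => i _.
have -> : a ^+ i * b ^+ (d.-1 - i) - a' ^+ i * b' ^+ (d.-1 - i) =
  (a ^+ i - a' ^+ i) * b ^+ (d.-1 - i) +
  a' ^+ i * (b ^+ (d.-1 - i) - b' ^+ (d.-1 - i)) by ring.
have bd n (c c' : R) : (n <= d)%N -> 0 <= c <= 1 -> 0 <= c' <= 1 ->
    `|c ^+ n - c' ^+ n| <= d%:R * `|c - c'|.
  move=> nd hc hc'; apply: le_trans (expr_lip _ hc hc') _.
  by rewrite ler_wpM2r // ler_nat.
apply: le_trans (ler_normD _ _) _; rewrite [leRHS]mulrDr lerD // normrM.
- rewrite -[leRHS]mulr1 ler_pM // ?bd // ?(ltnW (ltn_ord i)) //.
  by case/andP: hb => b0 b1; rewrite ger0_norm ?exprn_ge0 ?exprn_ile1.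
- rewrite -[leRHS]mul1r ler_pM // ?bd //; last by have := ltn_ord i; lia.
  by case/andP: ha' => b0 b1; rewrite ger0_norm ?exprn_ge0 ?exprn_ile1.
Qed.

End DivDiff.

(** * The vector field *)

Section Ode.
Context {R : realType} {K M : nat}.
Variables (d : nat) (lam xi : R) (u v : 'I_M -> R) (w : 'I_K -> R).
Variable p : 'I_K -> 'I_M -> R.
Hypothesis hd : (0 < d)%N.
Hypotheses (hlam : 0 < lam) (hxi : 0 < xi) (hu : forall m, 0 < u m).
Hypothesis hw : forall k, 0 < w k.
Hypothesis hv : forall m, 0 < v m.
Hypothesis hp : forall k m, 0 <= p k m <= 1.
Hypothesis hdk : forall k, 0 < dk v p k.

Implicit Types q : 'I_M -> nat -> R.
Local Notation rhs := (ode_rhs d lam xi u v w p).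
Local Notation qt := (qtilde v p).

Definition unit_valued q := forall m l, 0 <= q m l <= 1.
Definition nonincr q := forall m l, q m l.+1 <= q m l.

Lemma share_ge0 k m : 0 <= v m * p k m / dk v p k.
Proof.
by rewrite divr_ge0 ?mulr_ge0 ?(ltW (hdk _)) ?(ltW (hv _)) //; case/andP: (hp k m).
Qed.

Lemma sum_share k : \sum_(m < M) v m * p k m / dk v p k = 1.
Proof.
rewrite -mulr_suml; under eq_bigr do rewrite mulrC.
by rewrite divff // gt_eqF // hdk.
Qed.

Lemma share_le1 k m : v m * p k m / dk v p k <= 1.
Proof.
rewrite -(sum_share k) (bigD1 m) //= lerDl sumr_ge0 // => i _.
exact: share_ge0.
Qed.

Lemma qt_unit q : unit_valued q -> forall k l, 0 <= qt q k l <= 1.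
Proof.
move=> hq k l; apply/andP; split.
  by apply: sumr_ge0 => m _; rewrite mulr_ge0 ?share_ge0 //; case/andP: (hq m l).
rewrite -(sum_share k) ler_sum // => m _; rewrite -[leRHS]mulr1 ler_wpM2l //.
  exact: share_ge0.
by case/andP: (hq m l).
Qed.

Lemma qt_mono q q' k l : (forall m, q m l <= q' m l) -> qt q k l <= qt q' k l.
Proof. by move=> h; apply: ler_sum => m _; rewrite ler_wpM2l // share_ge0. Qed.

Definition dist_at q q' l : R := \sum_(m < M) `|q m l - q' m l|.

Lemma dist_at_ge0 q q' l : 0 <= dist_at q q' l.
Proof. exact: sumr_ge0. Qed.

Lemma le_dist_at q q' m l : `|q m l - q' m l| <= dist_at q q' l.
Proof. by rewrite /dist_at (bigD1 m) //= lerDl sumr_ge0. Qed.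

Lemma qt_lip q q' k l : `|qt q k l - qt q' k l| <= dist_at q q' l.
Proof.
rewrite /qtilde -sumrB; apply: le_trans (ler_norm_sum _ _ _) _.
apply: ler_sum => m _; rewrite -mulrBr normrM -[leRHS]mul1r ler_wpM2r //.
by rewrite ger0_norm ?share_ge0 ?share_le1.
Qed.

(** The rate of arrivals at one type-m server whose queue has length l - 1, in
    units of lam * xi. *)
Definition intake q m l : R :=
  \sum_(k < K) p k m * w k / dk v p k * divdiff d (qt q k l.-1) (qt q k l).
Definition intake_wt m : R := \sum_(k < K) p k m * w k / dk v p k.

Lemma rhsE q m l : rhs q m l =
  - u m * (q m l - q m l.+1) + lam * xi * (q m l.-1 - q m l) * intake q m l.
Proof. by []. Qed.

Lemma wt_ge0 k m : 0 <= p k m * w k / dk v p k.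
Proof.
by rewrite divr_ge0 ?mulr_ge0 ?(ltW (hdk _)) ?(ltW (hw _)) //; case/andP: (hp k m).
Qed.

Lemma intake_wt_ge0 m : 0 <= intake_wt m.
Proof. by apply: sumr_ge0 => k _; exact: wt_ge0. Qed.

Lemma intake_ge0 q m l : unit_valued q -> 0 <= intake q m l.
Proof.
move=> hq; apply: sumr_ge0 => k _; rewrite mulr_ge0 ?wt_ge0 // divdiff_ge0 //.
  by case/andP: (qt_unit hq k l.-1).
by case/andP: (qt_unit hq k l).
Qed.

Lemma intake_le q m l : unit_valued q -> intake q m l <= d%:R * intake_wt m.
Proof.
move=> hq; rewrite /intake_wt mulr_sumr; apply: ler_sum => k _.
by rewrite mulrC ler_wpM2r ?wt_ge0 // divdiff_le // qt_unit.
Qed.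

Lemma intake_mono q q' m l : unit_valued q ->
  (forall m l, q m l <= q' m l) -> intake q m l <= intake q' m l.
Proof.
move=> hq hqq'; apply: ler_sum => k _; rewrite ler_wpM2l ?wt_ge0 //.
have /andP[? _] := qt_unit hq k l.-1; have /andP[? _] := qt_unit hq k l.
by apply: divdiff_mono; apply/andP; split=> //; exact: qt_mono.
Qed.

Lemma intake_lip q q' m l : unit_valued q -> unit_valued q' ->
  `|intake q m l - intake q' m l| <=
  intake_wt m * d%:R ^+ 2 * (dist_at q q' l.-1 + dist_at q q' l).
Proof.
move=> hq hq'; rewrite /intake -sumrB; apply: le_trans (ler_norm_sum _ _ _) _.
rewrite /intake_wt -mulrA mulr_suml; apply: ler_sum => k _.
rewrite -mulrBr normrM ger0_norm ?wt_ge0 // ler_wpM2l ?wt_ge0 //.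
apply: le_trans (divdiff_lip _ _ _ _ _) _; rewrite ?qt_unit //.
by rewrite ler_wpM2l ?exprn_ge0 // lerD ?qt_lip.
Qed.

Definition rhs_const m : R :=
  u m + lam * xi * intake_wt m * (d%:R + d%:R ^+ 2).

Lemma rhs_const_ge0 m : 0 <= rhs_const m.
Proof.
by rewrite addr_ge0 ?(ltW (hu _)) // !mulr_ge0 ?(ltW hlam) ?(ltW hxi)
  ?intake_wt_ge0 // addr_ge0 // exprn_ge0.
Qed.

(** Level l + 1 enters the equation at level l only through the linear term u
    m * q m (l + 1). This term is split off, so that a bound on the drift of level
    l can be solved for level l + 1. *)
Lemma rhs_lip q q' m l : unit_valued q -> unit_valued q' ->
  `|rhs q m l - rhs q' m l - u m * (q m l.+1 - q' m l.+1)| <=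
  rhs_const m * (dist_at q q' l.-1 + dist_at q q' l).
Proof.
move=> hq hq'; rewrite !rhsE.
set S := dist_at _ _ _ + _.
have -> : - u m * (q m l - q m l.+1) +
  lam * xi * (q m l.-1 - q m l) * intake q m l -
  (- u m * (q' m l - q' m l.+1) +
   lam * xi * (q' m l.-1 - q' m l) * intake q' m l) -
  u m * (q m l.+1 - q' m l.+1) =
  - (u m * (q m l - q' m l)) + lam * xi *
   (((q m l.-1 - q' m l.-1) - (q m l - q' m l)) * intake q m l
    + (q' m l.-1 - q' m l) * (intake q m l - intake q' m l)) by ring.
have S0 : 0 <= S by rewrite addr_ge0 ?dist_at_ge0.
have lx : 0 <= lam * xi by rewrite mulr_ge0 ?(ltW hlam) ?(ltW hxi).
have h1 : `|q m l - q' m l| <= S.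
  by rewrite (le_trans (le_dist_at _ _ _ _)) // lerDr dist_at_ge0.
have h2 : `|(q m l.-1 - q' m l.-1) - (q m l - q' m l)| <= S.
  by rewrite (le_trans (ler_normB _ _)) // lerD ?le_dist_at.
have h3 : `|q' m l.-1 - q' m l| <= 1.
  have /andP[? ?] := hq' m l.-1; have /andP[? ?] := hq' m l.
  by rewrite ler_norml; lra.
apply: le_trans (ler_normD _ _) _; rewrite [leRHS]mulrDl lerD //.
  by rewrite normrN normrM (gtr0_norm (hu _)) ler_wpM2l ?(ltW (hu _)).
rewrite normrM ger0_norm // -!mulrA.
rewrite (mulrA lam) (mulrA lam xi) ler_wpM2l //.
apply: le_trans (ler_normD _ _) _; rewrite [in leRHS]mulrDl [leRHS]mulrDr lerD // normrM.
  rewrite mulrA mulrC ler_pM // ger0_norm ?intake_ge0 //.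
  by rewrite mulrC intake_le.
by rewrite -[leRHS]mul1r ler_pM // mulrA intake_lip.
Qed.

(** * The monotone Euler step *)

(** Small enough for [euler_mono]: the sum over the types is a convenient
    upper bound for the largest rate at which mass can leave a level. *)
Definition euler_step : R := (1 + \sum_(m < M) (u m + lam * xi * (d%:R * intake_wt m)))^-1.

Lemma euler_den_gt0 : 0 < 1 + \sum_(m < M) (u m + lam * xi * (d%:R * intake_wt m)).
Proof.
rewrite ltr_pwDl // sumr_ge0 // => m _.
by rewrite addr_ge0 ?(ltW (hu _)) // !mulr_ge0 ?(ltW hlam) ?(ltW hxi) ?intake_wt_ge0.
Qed.

Lemma euler_step_gt0 : 0 < euler_step.
Proof. by rewrite invr_gt0 euler_den_gt0. Qed.

Lemma euler_step_small m :
  euler_step * (u m + lam * xi * (d%:R * intake_wt m)) <= 1.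
Proof.
rewrite /euler_step mulrC ler_pdivrMr ?euler_den_gt0 // mul1r.
rewrite (bigD1 m) //= addrCA lerDl addr_ge0 // sumr_ge0 // => i _.
by rewrite addr_ge0 ?(ltW (hu _)) // !mulr_ge0 ?(ltW hlam) ?(ltW hxi) ?intake_wt_ge0.
Qed.

Definition euler q : 'I_M -> nat -> R := fun m l =>
  if l is 0%N then 1 else q m l + euler_step * rhs q m l.

Lemma eulerS q m l : euler q m l.+1 = q m l.+1 + euler_step * rhs q m l.+1.
Proof. by []. Qed.

(** The difference of the images is a combination, with nonnegative
    coefficients, of the differences at levels l - 1, l, l + 1 and of the
    difference of the intakes. At level l this uses the smallness of the step; the
    intake is increasing and acts on q m (l - 1) - q m l, which is nonnegative. *)
Lemma euler_mono q q' : unit_valued q -> unit_valued q' -> nonincr q' ->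
  (forall m l, q m l <= q' m l) -> forall m l, euler q m l <= euler q' m l.
Proof.
move=> hq hq' dq' le_qq' m [|l] //; rewrite !eulerS !rhsE /=.
set h := euler_step; set I := intake q m l.+1; set I' := intake q' m l.+1.
have h0 : 0 < h := euler_step_gt0.
have hs : h * (u m + lam * xi * (d%:R * intake_wt m)) <= 1 := euler_step_small m.
have II' : I <= I' := intake_mono _ _ hq le_qq'.
have I0 : 0 <= I := intake_ge0 _ _ hq.
have Ib : I <= d%:R * intake_wt m := intake_le _ _ hq.
have lx : 0 < lam * xi by rewrite mulr_gt0.
have um := hu m.
have hI : h * (u m + lam * xi * I) <= 1.
  by rewrite (le_trans _ hs) // ler_wpM2l ?(ltW h0) // lerD2l ler_wpM2l ?(ltW lx).
rewrite -subr_ge0.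
have -> : q' m l.+1 + h * (- u m * (q' m l.+1 - q' m l.+2) +
    lam * xi * (q' m l - q' m l.+1) * I') -
  (q m l.+1 + h * (- u m * (q m l.+1 - q m l.+2) +
    lam * xi * (q m l - q m l.+1) * I)) =
  (1 - h * (u m + lam * xi * I)) * (q' m l.+1 - q m l.+1)
  + h * u m * (q' m l.+2 - q m l.+2)
  + h * (lam * xi) * ((q' m l - q' m l.+1) * (I' - I) + (q' m l - q m l) * I)
  by ring.
have sub0 x : 0 <= q' m x - q m x by rewrite subr_ge0.
have sub1 : 0 <= q' m l - q' m l.+1 by rewrite subr_ge0.
have h1 : 0 <= 1 - h * (u m + lam * xi * I) by rewrite subr_ge0.
have dI : 0 <= I' - I by rewrite subr_ge0.
have h0' := ltW h0; have lx' := ltW lx; have um' := ltW um.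
apply: addr_ge0; first apply: addr_ge0.
- exact: mulr_ge0.
- by apply: mulr_ge0 => //; exact: mulr_ge0.
- by apply: mulr_ge0; [exact: mulr_ge0|apply: addr_ge0; exact: mulr_ge0].
Qed.

(** The constants 0 and 1 are kept by the Euler map above level 0, and
    monotonicity encloses everything between them. *)
Lemma euler_unit q : unit_valued q -> nonincr q -> unit_valued (euler q).
Proof.
move=> hq dq m [|l]; first by rewrite /= ler01 lexx.
have cst (c : R) : 0 <= c <= 1 -> unit_valued (fun _ _ => c) by move=> hc ? ?.
have fixc (c : R) : euler (fun _ _ => c) m l.+1 = c.
  by rewrite eulerS rhsE !subrr !(mulr0, mul0r, addr0).
apply/andP; split.
  rewrite -(fixc 0); apply: euler_mono => // [|m' l'].
  - by apply: cst; rewrite lexx ler01.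
  - by case/andP: (hq m' l').
rewrite -(fixc 1); apply: euler_mono => // [|m' l'].
- by apply: cst; rewrite lexx ler01.
- by case/andP: (hq m' l').
Qed.

(** The Euler map commutes with the shift by one level, and the shifted family
    lies below the original one. *)
Lemma euler_nonincr q : unit_valued q -> nonincr q -> nonincr (euler q).
Proof.
move=> hq dq m [|l].
  by case/andP: (euler_unit hq dq m 1).
pose q1 : 'I_M -> nat -> R := fun m l => q m l.+1.
have -> : euler q m l.+2 = euler q1 m l.+1 by [].
apply: euler_mono => //; first by move=> m' l'; exact: hq.
Qed.

(** A quantitative form of monotonicity: if q is nearly above q', it is driven
    towards the Euler image of q'. The minimum of q and q' is compared with q by
    monotonicity, and with q' by the Lipschitz bound. *)
Lemma euler_rhs_ge q q' m l : unit_valued q -> nonincr q ->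
  unit_valued q' -> nonincr q' ->
  rhs q m l.+1 >= euler_step^-1 * (euler q' m l.+1 - q m l.+1)
    - (rhs_const m + u m + euler_step^-1) *
    \sum_(m' < M) (Order.max 0 (q' m' l - q m' l)
      + Order.max 0 (q' m' l.+1 - q m' l.+1)
      + Order.max 0 (q' m' l.+2 - q m' l.+2)).
Proof.
move=> hq dq hq' dq'.
pose r : 'I_M -> nat -> R := fun m l => Order.min (q m l) (q' m l).
have hr : unit_valued r.
  by move=> m' l'; rewrite /r minEle; case: ifP => _; [exact: hq|exact: hq'].
have dr : nonincr r.
  by move=> m' l'; rewrite /r le_min !ge_min dq dq' /= orbT.
have le_rq m' l' : r m' l' <= q m' l' by rewrite /r ge_min lexx.
have h0 : 0 < euler_step := euler_step_gt0.
have e1 : euler r m l.+1 <= euler q m l.+1 by exact: euler_mono.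
have dE m' l' : `|q' m' l' - r m' l'| = Order.max 0 (q' m' l' - q m' l').
  rewrite /r; case: (leP (q m' l') (q' m' l')) => h.
    by rewrite max_r ?ger0_norm ?subr_ge0.
  by rewrite subrr normr0 max_l // subr_le0 ltW.
set X := \sum_(m' < M) _.
have XE : X = dist_at q' r l + dist_at q' r l.+1 + dist_at q' r l.+2.
  by rewrite /dist_at -!big_split /=; apply: eq_bigr => m' _; rewrite !dE.
have e2 : `|rhs q' m l.+1 - rhs r m l.+1| <= (rhs_const m + u m) * X.
  have h1 := rhs_lip m l.+1 hq' hr; rewrite /= in h1.
  have h2 : `|u m * (q' m l.+2 - r m l.+2)| <= u m * X.
    rewrite normrM (gtr0_norm (hu _)) ler_wpM2l ?(ltW (hu _)) //.
    by rewrite (le_trans (le_dist_at _ _ _ _)) // XE lerDr addr_ge0 ?dist_at_ge0.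
  have h3 : rhs_const m * (dist_at q' r l + dist_at q' r l.+1) <= rhs_const m * X.
    by rewrite ler_wpM2l ?rhs_const_ge0 // XE lerDl dist_at_ge0.
  rewrite mulrDl -(subrK (u m * (q' m l.+2 - r m l.+2)) (_ - _)).
  by rewrite (le_trans (ler_normD _ _)) // lerD // (le_trans h1).
have e3 : `|q' m l.+1 - r m l.+1| <= X.
  by rewrite (le_trans (le_dist_at _ _ _ _)) // XE addrAC lerDr addr_ge0 ?dist_at_ge0.
have e4 : euler q m l.+1 - q m l.+1 = euler_step * rhs q m l.+1.
  by rewrite eulerS; ring.
have -> : rhs q m l.+1 = euler_step^-1 * (euler q m l.+1 - q m l.+1).
  by rewrite e4 mulKf ?gt_eqF.
rewrite lerBlDr mulrDl [_ * X + _]addrC addrA -mulrDr.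
have -> : euler q' m l.+1 - q m l.+1 = euler r m l.+1 - q m l.+1
   + (q' m l.+1 - r m l.+1) + euler_step * (rhs q' m l.+1 - rhs r m l.+1).
  by rewrite !eulerS; ring.
rewrite [leLHS]mulrDr mulKf ?gt_eqF // lerD //.
  apply: ler_wpM2l; first by rewrite invr_ge0 ltW.
  apply: lerD; first by rewrite lerB.
  by rewrite (le_trans (ler_norm _)).
by rewrite (le_trans (ler_norm _)).
Qed.

(** * Mass balance *)

(** The weighted differences of the levels add up to the difference of the
    averages qt, which is the denominator of the divided difference. *)
Lemma mass_balance_level q l : \sum_(m < M) v m * rhs q m l =
  lam * xi * (\sum_(k < K) w k * (qt q k l.-1 ^+ d - qt q k l ^+ d))
  - \sum_(m < M) u m * v m * (q m l - q m l.+1).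
Proof.
transitivity (lam * xi * (\sum_(m < M) \sum_(k < K) w k * divdiff d (qt q k l.-1) (qt q k l)
    * (v m * p k m / dk v p k * (q m l.-1 - q m l)))
  - \sum_(m < M) u m * v m * (q m l - q m l.+1)).
  rewrite mulr_sumr -sumrB; apply: eq_bigr => m _; rewrite rhsE /intake.
  rewrite mulrDr addrC; congr (_ + _); last by ring.
  rewrite !mulr_sumr; apply: eq_bigr => k _; ring.
congr (_ * _ - _); rewrite exchange_big; apply: eq_bigr => k _.
rewrite -mulr_sumr -divdiffE -mulrA; congr (_ * _).
rewrite [RHS]mulrC; congr (_ * _); rewrite /qtilde -sumrB.
by apply: eq_bigr => m _; rewrite mulrBr.
Qed.

Lemma mass_balance q a n : \sum_(a <= l < a + n) \sum_(m < M) v m * rhs q m l.+1 =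
  lam * xi * (\sum_(k < K) w k * (qt q k a ^+ d - qt q k (a + n)%N ^+ d))
  - \sum_(m < M) u m * v m * (q m a.+1 - q m (a + n)%N.+1).
Proof.
elim: n => [|n IH].
  rewrite addn0 big_geq // !big1 ?mulr0 ?subrr // => i _; by rewrite subrr mulr0.
rewrite addnS big_nat_recr ?leq_addr //= IH mass_balance_level /=.
rewrite addrACA -mulrDr -opprD -!big_split /=.
by congr (_ * _ - _); apply: eq_bigr => i _; ring.
Qed.

(** * The fixed point *)

(** The iteration starts from the system with empty queues. *)
Fixpoint euler_iter n : 'I_M -> nat -> R :=
  if n is n'.+1 then euler (euler_iter n') else fun _ l => (l == 0%N)%:R.

Lemma euler_iter_spec n : [/\ unit_valued (euler_iter n),
  nonincr (euler_iter n), forall m, euler_iter n m 0%N = 1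
  & forall m l, (n < l)%N -> euler_iter n m l = 0].
Proof.
elim: n => [|n [h1 h2 h3 h4]].
  split=> [m [|l]|m [|l]|m|m [|l]] //=; rewrite ?ler01 ?lexx //.
split=> //; [exact: euler_unit|exact: euler_nonincr|].
move=> m [|l] //; rewrite ltnS => nl.
have -> : euler_iter n.+1 m l.+1 =
  euler_iter n m l.+1 + euler_step * rhs (euler_iter n) m l.+1 by [].
have qt0 k l' : (n < l')%N -> qt (euler_iter n) k l' = 0.
  by move=> ?; rewrite /qtilde big1 // => i _; rewrite h4 ?mulr0.
have [z0 z1 z2] : [/\ euler_iter n m l = 0, euler_iter n m l.+1 = 0
    & euler_iter n m l.+2 = 0].
  by split; apply: h4 => //; apply: (leq_trans nl) => //; exact: leqW.
by rewrite rhsE /= z0 z1 z2 !subrr !(mulr0, mul0r, addr0).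
Qed.

Lemma euler_iter_leS n m l : euler_iter n m l <= euler_iter n.+1 m l.
Proof.
elim: n m l => [|n IH] m l.
  have [h1 _ h3 _] := euler_iter_spec 1.
  case: l => [|l]; first by rewrite h3.
  by case/andP: (h1 m l.+1).
have [h1 _ _ _] := euler_iter_spec n; have [h1' h2' _ _] := euler_iter_spec n.+1.
exact: euler_mono.
Qed.

Lemma euler_iter_nd m l : nondecreasing_seq (fun n => euler_iter n m l).
Proof. by apply/nondecreasing_seqP => n; exact: euler_iter_leS. Qed.

(** The least fixed point above the empty system. *)
Definition eqm m l : R := limn (fun n => euler_iter n m l).

Lemma euler_iter_cvg m l : euler_iter n m l @[n --> \oo] --> eqm m l.
Proof.
apply: nondecreasing_is_cvgn; first exact: euler_iter_nd.
by exists 1 => _ [n _ <-]; have [h _ _ _] := euler_iter_spec n; case/andP: (h m l).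
Qed.

Lemma euler_iter_le_eqm n m l : euler_iter n m l <= eqm m l.
Proof.
apply: (@nondecreasing_cvgn_le _ (fun n => euler_iter n m l)); first exact: euler_iter_nd.
by apply/cvg_ex; exists (eqm m l); exact: euler_iter_cvg.
Qed.

Lemma eqm_unit : unit_valued eqm.
Proof.
move=> m l; apply/andP; split.
  by apply: le_trans (euler_iter_le_eqm 0 m l); rewrite ler0n.
apply: limr_le; first by apply/cvg_ex; exists (eqm m l); exact: euler_iter_cvg.
by apply: nearW => n; have [h _ _ _] := euler_iter_spec n; case/andP: (h m l).
Qed.

Lemma eqm0 m : eqm m 0%N = 1.
Proof.
apply/eqP; rewrite eq_le; case/andP: (eqm_unit m 0) => _ -> /=.
by rewrite -[leLHS](_ : euler_iter 0 m 0 = 1) // euler_iter_le_eqm.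
Qed.

Lemma eqm_nonincr : nonincr eqm.
Proof.
move=> m l; apply: ler_lim.
- by apply/cvg_ex; exists (eqm m l.+1); exact: euler_iter_cvg.
- by apply/cvg_ex; exists (eqm m l); exact: euler_iter_cvg.
- by apply: nearW => n; have [_ h _ _] := euler_iter_spec n; exact: h.
Qed.

Lemma qt_cvg (qn : nat -> 'I_M -> nat -> R) q k l :
  (forall m, qn n m l @[n --> \oo] --> q m l) -> (qt (qn n) k l) @[n --> \oo] --> qt q k l.
Proof.
move=> h; rewrite /qtilde.
by apply: cvg_sumr => m _; apply: cvgM; [exact: cvg_cst|exact: h].
Qed.

Lemma rhs_cvg (qn : nat -> 'I_M -> nat -> R) q m l :
  (forall m l, qn n m l @[n --> \oo] --> q m l) ->
  (rhs (qn n) m l) @[n --> \oo] --> rhs q m l.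
Proof.
move=> h; rewrite /ode_rhs; apply: cvgD.
  by apply: cvgM; [exact: cvg_cst|apply: cvgB; exact: h].
apply: cvgM.
  by apply: cvgM; [exact: cvg_cst|apply: cvgB; exact: h].
apply: cvg_sumr => k _; apply: cvgM; first exact: cvg_cst.
apply: cvg_sumr => i _; apply: cvgM; apply: cvg_powr; exact: qt_cvg.
Qed.

Lemma eqm_rhs m l : rhs eqm m l.+1 = 0.
Proof.
have h0 := euler_step_gt0.
have h1 := @rhs_cvg _ _ m l.+1 euler_iter_cvg.
apply: (cvg_unique _ h1); rewrite //=.
have -> : (fun n => rhs (euler_iter n) m l.+1) =
   (fun n => euler_step^-1 * (euler_iter n.+1 m l.+1 - euler_iter n m l.+1)).
  by apply/funext => n /=; rewrite addrAC subrr add0r mulKf ?gt_eqF.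
rewrite -(mulr0 euler_step^-1) -(subrr (eqm m l.+1)).
apply: cvgM; first exact: cvg_cst.
apply: cvgB; last exact: euler_iter_cvg.
have := @euler_iter_cvg m l.+1; rewrite -(cvg_shiftS ((fun n => euler_iter n m l.+1))); exact.
Qed.

Hypothesis hw1 : \sum_(k < K) w k = 1.
Variable rho : R.
Hypothesis hrho1 : rho < 1.
(* Mean-field subcriticality. Relative to the number of servers, the left side
   is the rate of the tasks whose sampled servers all lie in a set with
   proportion a m of the servers of type m, and the sum on the right side is the
   service capacity of that set. *)
Hypothesis hsub : forall a : 'I_M -> R, (forall m, 0 <= a m <= 1) ->
  lam * xi * (\sum_(k < K) w k * (\sum_(m < M) v m * p k m / dk v p k * a m) ^+ d)
  <= rho * \sum_(m < M) u m * v m * a m.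
Hypothesis hM : (0 < M)%N.

Definition capacity : R := \sum_(m < M) u m * v m.

Lemma capacity_ge0 : 0 <= capacity.
Proof. by apply: sumr_ge0 => m _; rewrite mulr_ge0 ?(ltW (hu m)) ?(ltW (hv m)). Qed.

Lemma capacity_gt0 : 0 < capacity.
Proof.
rewrite /capacity (bigD1 (Ordinal hM)) //= ltr_pwDl ?mulr_gt0 // sumr_ge0 // => m _.
by rewrite mulr_ge0 ?(ltW (hu m)) ?(ltW (hv m)).
Qed.

Lemma rho_gt0 : 0 < rho.
Proof.
have := @hsub (fun _ => 1).
under eq_bigr do [under eq_bigr do rewrite mulr1; rewrite sum_share expr1n mulr1].
under [in X in _ -> (_ <= _ * X)]eq_bigr do rewrite mulr1.
rewrite hw1 mulr1 -/capacity => /(_ _).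
have /[swap] /[apply] h : 'I_M -> 0 <= (1 : R) <= 1 by rewrite ler01 lexx.
have lx : 0 < lam * xi by rewrite mulr_gt0.
by have := lt_le_trans lx h; rewrite pmulr_lgt0 // capacity_gt0.
Qed.

(** The iterates increase, so their drift is nonnegative. Mass balance above
    level l then bounds the outflow of level l + 1 by the inflow, which is at most
    rho times the outflow of level l. *)
Lemma euler_iter_decay n l :
  \sum_(m < M) u m * v m * euler_iter n m l <= rho ^+ l * capacity.
Proof.
have [h1 h2 h3 h4] := euler_iter_spec n.
elim: l => [|l IH].
  by rewrite mul1r /capacity; under eq_bigr do rewrite h3 mulr1.
move: IH; rewrite -(ler_pM2l rho_gt0) mulrA -exprS; apply: le_trans.
apply: le_trans (hsub _); last by move=> m; exact: h1.
have h0 := euler_step_gt0.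
(* The n-th iterate vanishes above level n, so that there is no boundary term
   at level l + n + 1. *)
have := mass_balance (euler_iter n) l n.+1.
have z k : qt (euler_iter n) k (l + n.+1) = 0.
  by rewrite /qtilde big1 // => m _; rewrite h4 ?mulr0 // leq_addl.
under [in RHS]eq_bigr do rewrite z expr0n -[d == 0%N]negbK -lt0n hd subr0.
under [X in _ = _ - X]eq_bigr do rewrite (h4 _ (l + n.+1).+1) ?subr0 ?leqW ?leq_addl //.
move=> e; rewrite -subr_ge0 -e; apply: sumr_ge0 => j _; apply: sumr_ge0 => m _.
rewrite mulr_ge0 ?(ltW (hv m)) //.
have := euler_iter_leS n m j.+1.
by rewrite [X in _ <= X](_ : _ = euler_iter n m j.+1 + euler_step * rhs (euler_iter n) m j.+1) // lerDl pmulr_rge0.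
Qed.

Lemma eqm_decay l : \sum_(m < M) u m * v m * eqm m l <= rho ^+ l * capacity.
Proof.
apply: (@cvgn_le_cst _ (fun n => \sum_(m < M) u m * v m * euler_iter n m l)).
  by apply: cvg_sumr => m _; apply: cvgM; [exact: cvg_cst|exact: euler_iter_cvg].
by move=> n; exact: euler_iter_decay.
Qed.

Lemma eqm_geo m l : eqm m l <= capacity / (u m * v m) * rho ^+ l.
Proof.
have uv0 : 0 < u m * v m by rewrite mulr_gt0.
rewrite mulrAC ler_pdivlMr // mulrC [leRHS]mulrC.
apply: le_trans (eqm_decay l); rewrite (bigD1 m) //= lerDl sumr_ge0 // => i _.
by case/andP: (eqm_unit i l) => h _; rewrite !mulr_ge0 ?(ltW (hu i)) ?(ltW (hv i)).
Qed.

Lemma eqm_inS : inS eqm.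
Proof.
split; [exact: eqm_unit|exact: eqm0|exact: eqm_nonincr|move=> m].
have rho1 : `|rho| < 1 by rewrite gtr0_norm ?rho_gt0.
apply: (@series_le_cvg _ _ (geometric (capacity / (u m * v m)) rho)).
- by move=> n; case/andP: (eqm_unit m n).
- by move=> n /=; rewrite !mulr_ge0 ?capacity_ge0 ?invr_ge0 ?exprn_ge0 ?(ltW rho_gt0)
    ?mulr_ge0 ?(ltW (hu m)) ?(ltW (hv m)).
- by move=> n; exact: eqm_geo.
- exact: is_cvg_geometric_series.
Qed.

Lemma eqm_fixed : fixed_point d lam xi u v w p eqm.
Proof. by split=> [m|m [|l] //]; [exact: eqm0|rewrite eqm_rhs]. Qed.

(** All equations are added up; summability of the levels sends the boundary
    term of the partial sums to 0. *)
Lemma fixed_throughput q : inS q -> fixed_point d lam xi u v w p q ->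
  \sum_(m < M) u m * v m * q m 1%N = lam * xi.
Proof.
move=> [q1 q0 qd qs] [_ fq].
have q_cvg m : q m n @[n --> \oo] --> (0 : R) by exact: cvg_series_cvg_0.
have qt0 k : qt q k 0 = 1.
  by rewrite -(sum_share k); apply: eq_bigr => m _; rewrite q0 mulr1.
pose g n := lam * xi * (\sum_(k < K) w k * (1 - qt q k n ^+ d))
   - \sum_(m < M) u m * v m * (q m 1%N - q m n.+1).
have g0 n : g n = 0.
  have := mass_balance q 0 n; rewrite add0n big1 => [|l _]; last first.
    by apply: big1 => m _; rewrite fq ?mulr0.
  move=> e; rewrite /g [RHS]e; congr (_ * _ - _).
  by apply: eq_bigr => k _; rewrite qt0 expr1n.
have g_cvg : g n @[n --> \oo] --> lam * xi * (\sum_(k < K) w k * (1 - 0 ^+ d))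
   - \sum_(m < M) u m * v m * (q m 1%N - 0).
  apply: cvgB.
    apply: cvgM; first exact: cvg_cst.
    apply: cvg_sumr => k _; apply: cvgM; first exact: cvg_cst.
    apply: cvgB; first exact: cvg_cst.
    apply: cvg_powr; rewrite -[X in _ --> X](_ : qt (fun _ _ => 0) k 0 = 0).
      by apply: cvg_sumr => m _; apply: cvgM; [exact: cvg_cst|exact: q_cvg].
    by rewrite /qtilde big1 // => m _; rewrite mulr0.
  apply: cvg_sumr => m _; apply: cvgM; first exact: cvg_cst.
  apply: cvgB; first exact: cvg_cst.
  by have := q_cvg m; rewrite -(cvg_shiftS (q m)).
have : lam * xi * (\sum_(k < K) w k * (1 - 0 ^+ d))
   - \sum_(m < M) u m * v m * (q m 1%N - 0) = 0.
  apply: (cvg_unique _ g_cvg) => //.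
  by rewrite (_ : g = fun=> 0); [exact: cvg_cst|apply/funext].
rewrite expr0n -[d == 0%N]negbK -lt0n hd subr0.
under eq_bigr do rewrite mulr1; rewrite hw1 mulr1.
under eq_bigr do rewrite subr0.
by move/eqP; rewrite subr_eq0 => /eqP.
Qed.

(** A fixed point is invariant under the Euler map and lies above the empty
    system, hence above all iterates. *)
Lemma fixed_ge_eqm q : inS q -> fixed_point d lam xi u v w p q ->
  forall m l, eqm m l <= q m l.
Proof.
move=> [q1 q0 qd qs] [_ fq] m l.
suff h n : forall m l, euler_iter n m l <= q m l.
  by apply: (cvgn_le_cst (@euler_iter_cvg m l)) => n; exact: h.
elim: n => [|n IH] m' l'.
  by case: l' => [|l'] /=; [rewrite q0|case/andP: (q1 m' l'.+1)].
have -> : q m' l' = euler q m' l'.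
  by case: l' => [|l'] /=; [rewrite q0|rewrite fq // mulr0 addr0].
by have [h1 _ _ _] := euler_iter_spec n; exact: euler_mono.
Qed.

(** Since q lies above [eqm] and has the same throughput, the first levels agree.
    The equation at level l then determines level l + 1 from levels l - 1 and
    l. *)
Lemma fixed_unique q : inS q -> fixed_point d lam xi u v w p q -> q = eqm.
Proof.
move=> qS fq; have [q1 q0 _ _] := qS; have [_ rq] := fq.
have ge := fixed_ge_eqm qS fq.
have lvl1 m : q m 1%N = eqm m 1%N.
  have : \sum_(m < M) u m * v m * (q m 1%N - eqm m 1%N) = 0.
    under eq_bigr do rewrite mulrBr.
    by rewrite sumrB (fixed_throughput qS fq) (fixed_throughput eqm_inS eqm_fixed) subrr.
  have ge0 (i : 'I_M) : true -> 0 <= u i * v i * (q i 1%N - eqm i 1%N).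
    by move=> _; rewrite !mulr_ge0 ?(ltW (hu i)) ?(ltW (hv i)) ?subr_ge0 ?ge.
  move=> /eqP; rewrite psumr_eq0 // => /allP /(_ m (mem_index_enum _)) /=.
  by rewrite mulf_eq0 gt_eqF ?mulr_gt0 //= subr_eq0 => /eqP.
suff h l : forall m, q m l = eqm m l /\ q m l.+1 = eqm m l.+1.
  by apply/funext => m; apply/funext => l; have [] := h l m.
elim: l => [m|l IH m]; first by rewrite q0 eqm0 lvl1.
split; first by have [] := IH m.
have := rhs_lip m l.+1 q1 eqm_unit.
have z j : (forall i, q i j = eqm i j) -> dist_at q eqm j = 0.
  by move=> e; rewrite /dist_at big1 // => i _; rewrite e subrr normr0.
rewrite rq // eqm_rhs /= !z => [|i|i]; try by have [] := IH i.
rewrite addr0 mulr0 subrr sub0r normrN normr_le0 mulf_eq0 gt_eqF //=.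
by rewrite subr_eq0 => /eqP.
Qed.

End Ode.

(** * Assignment of a single task *)

Section Assign.
Context {R : realType} {K M N : nat} (g : bigraph K M N).
Variables (d : nat) (lam : R) (u : 'I_M -> R).
Hypothesis hd : (0 < d)%N.
Implicit Types (x : state N) (i : 'I_(nW g)).

Definition lev x l : {set 'I_N} := [set j | (l <= x j)%N]%SET.

(** The probability that the d servers sampled by dispatcher i all lie in
    U. *)
Definition all_in i (U : {set 'I_N}) : R := 'C(#|U :&: nbr i|, d)%:R / 'C(delta i, d)%:R.

(** The shortest queues of A have length at least l when all queues of A do,
    and otherwise none of them has. *)
Lemma lev_shortest x l (A : {set 'I_N}) : (0 < #|A|)%N ->
  \sum_(j in lev x l) (j \in shortest x A)%:R / #|shortest x A|%:R
  = (A \subset lev x l)%:R :> R.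
Proof.
move=> /card_gt0P[j0 j0A]; have [sAl|nsAl] := boolP (A \subset lev x l).
  rewrite -mulr_suml -natr_sum.
  have -> : (\sum_(j in lev x l) (j \in shortest x A) = #|shortest x A|)%N.
    rewrite -sum1_card big_mkcond [RHS]big_mkcond; apply: eq_bigr => j _.
    case: (boolP (j \in shortest x A)) => [|]; last by case: ifP.
    by rewrite inE => /andP[/(fintype.subsetP sAl) ->].
  rewrite divff // pnatr_eq0 -lt0n; apply/card_gt0P.
  case: (arg_minnP (fun j => x j) j0A) => j jA jmin.
  by exists j; rewrite inE; apply/andP; split => //; apply/forall_inP => j' /jmin.
apply: big1 => j; rewrite inE => lj.
suff -> : j \in shortest x A = false by rewrite mul0r.
apply/negP; rewrite inE => /andP[_ /forall_inP hj].
case/subsetPn: nsAl => j' j'A; rewrite inE -ltnNge => j'l.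
by have := leq_trans lj (hj j' j'A); rewrite leqNgt j'l.
Qed.

Lemma sum_assign_lev x i l : (d <= delta i)%N ->
  \sum_(j in lev x l) assign d x i j = all_in i (lev x l) :> R.
Proof.
move=> hi; rewrite /assign hi -mulr_suml /all_in exchange_big /=; congr (_ / _).
transitivity (\sum_(A : {set 'I_N} | (A \subset nbr i) && (#|A| == d))
    (A \subset lev x l)%:R : R).
  by apply: eq_bigr => A /andP[_ /eqP cA]; rewrite lev_shortest // cA.
rewrite -natr_sum -cards_draws -sum1dep_card big_mkcond [in RHS]big_mkcond.
congr _%:R; apply: eq_bigr => A _; rewrite finset.subsetI.
by case: (A \subset nbr i) (A \subset lev x l) (#|A| == d) => [] [] [].
Qed.

Lemma assign_out x i j : j \notin nbr i -> assign d x i j = 0 :> R.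
Proof.
move=> jn; rewrite /assign; case: ifP => _; last by rewrite (negbTE jn) mul0r.
rewrite big1 ?mul0r // => A /andP[sA _].
suff -> : j \in shortest x A = false by rewrite mul0r.
by apply/negP; rewrite inE => /andP[/(fintype.subsetP sA)]; rewrite (negbTE jn).
Qed.

(** Exchanging two neighbours with equal queues permutes the sampled sets. *)
Lemma assign_sym x i j j' : j \in nbr i -> j' \in nbr i -> x j = x j' ->
  assign d x i j = assign d x i j' :> R.
Proof.
move=> jn j'n xjj'; rewrite /assign; case: ifP => _; last by rewrite jn j'n.
congr (_ / _); pose t : {perm 'I_N} := tperm j j'.
have tK : involutive t by move=> y; rewrite /t tpermK.
have xt y : x (t y) = x y by rewrite /t; case: tpermP => // ->.
have nt y : (t y \in nbr i) = (y \in nbr i).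
  by rewrite /t; case: tpermP => // ->; rewrite jn j'n.
pose h (A : {set 'I_N}) : {set 'I_N} := (t @^-1: A)%SET.
have hK : involutive h by move=> A; apply/setP => y; rewrite !inE tK.
have ch A : #|h A| = #|A| by rewrite on_card_preimset //; apply: onW_bij; exists t.
have sh A : shortest x (h A) = h (shortest x A).
  apply/setP => y; rewrite !inE; congr andb; apply/forall_inP/forall_inP => H z zA.
    by rewrite xt -(tK z) (xt (t z)); apply: H; rewrite inE tK.
  by have := H (t z); rewrite !xt inE in zA *; apply.
rewrite (reindex_inj (inv_inj hK)) /=; apply: eq_big => [A|A _].
  rewrite ch; congr andb; apply/fintype.subsetP/fintype.subsetP => H y yA.
    by rewrite -nt; apply: H; rewrite inE tK.
  by rewrite -nt; apply: H; rewrite inE in yA.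
by rewrite sh ch inE /t tpermL.
Qed.

Lemma sum_proportional (I : finType) (A B : {set I}) (f : I -> R) :
  (forall a b, a \in A -> b \in B -> f a = f b) ->
  (\sum_(a in A) f a) * #|B|%:R = #|A|%:R * \sum_(b in B) f b.
Proof.
move=> h; transitivity (\sum_(a in A) \sum_(b in B) f b).
  rewrite mulr_suml; apply: eq_bigr => a aA.
  by rewrite mulr_natr -sumr_const; apply: eq_bigr => b bB; exact: h.
by rewrite sumr_const mulr_natl.
Qed.

Definition assign_class x i m l : R := \sum_(j in Vcls g m | x j == l) assign d x i j.

Lemma assign_ge0 x i j : 0 <= assign d x i j :> R.
Proof.
rewrite /assign; case: ifP => _; apply: divr_ge0; rewrite ?ler0n //.
by apply: sumr_ge0 => A _; rewrite divr_ge0 ?ler0n.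
Qed.

Lemma sum_assign_le1 x i : (d <= delta i)%N -> \sum_j assign d x i j <= 1 :> R.
Proof.
move=> hi; have := sum_assign_lev x 0 hi; rewrite /all_in.
have -> : lev x 0 = [set: 'I_N]%SET by apply/setP => j; rewrite !inE.
rewrite finset.setTI divff ?pnatr_eq0 -?lt0n ?bin_gt0 // => <-.
by rewrite le_eqVlt; apply/orP; left; apply/eqP/eq_bigl => j; rewrite inE.
Qed.

Definition nlev x i l : nat := #|lev x l :&: nbr i|.
Definition nlevm x i m l : nat := #|lev x l :&: Vcls g m :&: nbr i|.

Lemma lev_step (D : {set 'I_N}) x l :
  #|[set j in D | x j == l]|%:R = #|lev x l :&: D|%:R - #|lev x l.+1 :&: D|%:R :> R.
Proof.
apply/eqP; rewrite eq_sym subr_eq -natrD eqr_nat; apply/eqP.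
rewrite -cardsUI.
rewrite [X in (_ + #|pred_of_set X|)%N](_ : _ = finset.set0) ?cards0 ?addn0.
  apply: eq_card => j; rewrite !inE; case: (j \in D); rewrite ?andbF //= !andbT.
  by rewrite leq_eqVlt eq_sym.
apply/setP => j; rewrite !inE; apply/negbTE/negP => /andP[/andP[_ /eqP ->]].
by rewrite ltnn.
Qed.

(** Tasks that join a queue of length l have their sample in level l but not
    in level l + 1. By symmetry they are spread evenly over the neighbours with
    queue length l, so that class m receives its proportion of them. The identity
    is multiplied out because there may be no such neighbour. *)
Lemma assign_classE x i m l : (d <= delta i)%N ->
  assign_class x i m l * ((nlev x i l)%:R - (nlev x i l.+1)%:R) =
  ((nlevm x i m l)%:R - (nlevm x i m l.+1)%:R)
  * (all_in i (lev x l) - all_in i (lev x l.+1)).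
Proof.
move=> hi; rewrite /nlev /nlevm -(lev_step (nbr i)) -!finset.setIA -(lev_step (Vcls g m :&: nbr i)).
have -> : all_in i (lev x l) - all_in i (lev x l.+1) =
    \sum_(j in [set j in nbr i | x j == l]%SET) assign d x i j.
  rewrite -!(sum_assign_lev x _ hi) (bigID (mem (lev x l.+1))) /=.
  rewrite [X in X + _ - _](_ : _ = \sum_(j in lev x l.+1) assign d x i j); last first.
    by apply: eq_bigl => j; rewrite !inE andbC; case: ltnP => //= /ltnW ->.
  rewrite addrAC subrr add0r big_mkcond [RHS]big_mkcond; apply: eq_bigr => j _.
  rewrite !inE -leqNgt -eqn_leq eq_sym; case: eqP => _; rewrite ?andbF ?andbT //.
  by case: ifPn => // jn; rewrite assign_out // inE.
rewrite -sum_proportional => [|a b].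
  congr (_ * _); rewrite /assign_class big_mkcond [RHS]big_mkcond.
  apply: eq_bigr => j _; rewrite !inE; case: (vtype g j == m) => //=.
  case: (x j == l); rewrite ?andbF ?andbT //.
  by case: ifPn => // jn; rewrite assign_out // inE.
rewrite !inE => /andP[/andP[_ an] /eqP xa] /andP[bn /eqP xb].
by apply: assign_sym; rewrite ?inE // xa xb.
Qed.

End Assign.

(** * Sampling with and without replacement *)

Section BinomialRatio.
Context {R : realType}.

Lemma prod_lip (I : Type) (r : seq I) (a b : I -> R) :
  (forall i, 0 <= a i <= 1) -> (forall i, 0 <= b i <= 1) ->
  `|\prod_(i <- r) a i - \prod_(i <- r) b i| <= \sum_(i <- r) `|a i - b i|.
Proof.
move=> ha hb; elim: r => [|i r IH]; first by rewrite !big_nil subrr normr0.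
rewrite !big_cons.
have -> : a i * \prod_(j <- r) a j - b i * \prod_(j <- r) b j =
  (a i - b i) * \prod_(j <- r) a j + b i * (\prod_(j <- r) a j - \prod_(j <- r) b j).
  by ring.
apply: le_trans (ler_normD _ _) _; rewrite !normrM lerD //.
  rewrite -[leRHS]mulr1 ler_wpM2l // ger0_norm.
    by apply: prodr_ile1.
  by apply: prodr_ge0 => j _; case/andP: (ha j).
rewrite -[leRHS]mul1r ler_pM //.
by case/andP: (hb i) => b0 b1; rewrite ger0_norm.
Qed.

(** The quotient is the product of the d factors (n - i) / (D - i), each of which
    is close to n / D. *)
Lemma bin_ratio (d n D : nat) : (n <= D)%N -> (d <= D)%N -> (0 < d)%N ->
  `|'C(n, d)%:R / 'C(D, d)%:R - (n%:R / D%:R) ^+ d| <= d%:R ^+ 2 / (D - d.-1)%:R :> R.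
Proof.
move=> nD dD d0.
have D0 : (0 < D)%N by apply: leq_trans dD.
have -> : 'C(n, d)%:R / 'C(D, d)%:R = \prod_(i < d) ((n - i)%:R / (D - i)%:R) :> R.
  rewrite prodf_div -!natr_prod -!ffact_prod -!bin_ffact !natrM.
  by rewrite -mulf_div divff ?mulr1 // pnatr_eq0 -lt0n fact_gt0.
rewrite -[X in _ - _ ^+ X]card_ord -prodr_const.
have pos (i : 'I_d) : (0 < D - i)%N.
  by rewrite subn_gt0 (leq_trans (ltn_ord i)).
apply: le_trans (prod_lip _ _ _) _ => [i|i|].
- rewrite divr_ge0 //= ler_pdivrMr ?ltr0n // mul1r ler_nat; exact: leq_sub2r.
- by rewrite divr_ge0 //= ler_pdivrMr ?ltr0n // mul1r ler_nat.
apply: (@le_trans _ _ (\sum_(i < d) d%:R / (D - d.-1)%:R)); last first.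
  by rewrite sumr_const card_ord -(mulr_natl (_ / _)) mulrA -expr2.
apply: ler_sum => i _.
have Di := pos i; have id := ltn_ord i.
apply: (@le_trans _ _ (i%:R / (D - i)%:R)); last first.
  rewrite ler_pM // ?ler_nat ?invr_ge0 //; first exact: ltnW.
  by rewrite lef_pV2 ?posrE ?ltr0n ?ler_nat //; lia.
have [ni|ni] := ltnP n i.
  have -> : (n - i)%N = 0%N by apply/eqP; rewrite subn_eq0 ltnW.
  rewrite mul0r sub0r normrN ger0_norm ?divr_ge0 //.
  rewrite ler_pM // ?ler_nat ?invr_ge0 //; first exact: ltnW.
  by rewrite lef_pV2 ?posrE ?ltr0n ?ler_nat //; lia.
have -> : (n - i)%:R / (D - i)%:R - n%:R / D%:R = - ((i%:R / (D - i)%:R) * ((D - n)%:R / D%:R)) :> R.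
  rewrite !natrB //; last by rewrite (leq_trans ni).
  field; rewrite -natrB ?(leq_trans ni) // !pnatr_eq0; lia.
rewrite normrN ger0_norm ?mulr_ge0 ?divr_ge0 // -[leRHS]mulr1 ler_wpM2l ?divr_ge0 //.
by rewrite ler_pdivrMr ?ltr0n // mul1r ler_nat leq_subr.
Qed.

End BinomialRatio.

(** * Expectations of bounded functions of the state *)

Section BoundedExpectation.
Context {R : realType} {N : nat} (pi : probability (state N) R).
Implicit Types (f h : state N -> R).

Lemma measurable_state (A : set (state N)) : measurable A.
Proof. by []. Qed.

Lemma measurable_fun_state d (T : measurableType d) (f : state N -> T) :
  measurable_fun setT f.
Proof. by move=> _ B _; exact: measurable_state. Qed.

Definition bounded f := exists C : R, forall x, `|f x| <= C.

Lemma bounded_cst c : bounded (fun=> c).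
Proof. by exists `|c|. Qed.

Lemma boundedD f h : bounded f -> bounded h -> bounded (fun x => f x + h x).
Proof.
by move=> [A hA] [B hB]; exists (A + B) => x; rewrite (le_trans (ler_normD _ _)) ?lerD.
Qed.

Lemma boundedM f h : bounded f -> bounded h -> bounded (fun x => f x * h x).
Proof. by move=> [A hA] [B hB]; exists (A * B) => x; rewrite normrM ler_pM. Qed.

Lemma boundedN f : bounded f -> bounded (fun x => - f x).
Proof. by move=> [A hA]; exists A => x; rewrite normrN. Qed.

Lemma boundedB f h : bounded f -> bounded h -> bounded (fun x => f x - h x).
Proof. by move=> hf hh; apply: boundedD => //; exact: boundedN. Qed.

Lemma boundedZ c f : bounded f -> bounded (fun x => c * f x).
Proof. by apply: boundedM; exact: bounded_cst. Qed.

Lemma bounded_norm f : bounded f -> bounded (fun x => `|f x|).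
Proof. by move=> [A hA]; exists A => x; rewrite normr_id. Qed.

Lemma bounded_sum (I : Type) (r : seq I) (P : pred I) (f : I -> state N -> R) :
  (forall i, P i -> bounded (f i)) -> bounded (fun x => \sum_(i <- r | P i) f i x).
Proof.
move=> hf; elim: r => [|i r [A hA]]; first by exists 0 => x; rewrite big_nil normr0.
have [Pi|nPi] := boolP (P i); last first.
  by exists A => x; rewrite big_cons (negbTE nPi).
have [B hB] := hf i Pi; exists (B + A) => x.
by rewrite big_cons Pi (le_trans (ler_normD _ _)) ?lerD.
Qed.

Lemma bounded_integrable f : bounded f -> pi.-integrable setT (EFin \o f).
Proof.
move=> [A hA]; apply: measurable_bounded_integrable => //.
- by apply: le_lt_trans (ltry 1); rewrite le_eqVlt; apply/orP; left; apply/eqP; exact: probability_setT.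
- exists A; split; first exact: num_real.
  by move=> B AB x _; exact: le_trans (hA x) (ltW AB).
Qed.

Definition Ex f : R := \int[pi]_x f x.

Lemma ExD f h : bounded f -> bounded h -> Ex (fun x => f x + h x) = Ex f + Ex h.
Proof. by move=> hf hh; rewrite /Ex RintegralD //; exact: bounded_integrable. Qed.

Lemma ExB f h : bounded f -> bounded h -> Ex (fun x => f x - h x) = Ex f - Ex h.
Proof. by move=> hf hh; rewrite /Ex RintegralB //; exact: bounded_integrable. Qed.

Lemma ExZ c f : bounded f -> Ex (fun x => c * f x) = c * Ex f.
Proof. by move=> hf; rewrite /Ex RintegralZl //; exact: bounded_integrable. Qed.

Lemma Ex_cst c : Ex (fun=> c) = c.
Proof.
rewrite /Ex Rintegral_cst //; set mass := (X in fine X).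
by have -> : mass = 1%E by [exact: probability_setT]; rewrite mulr1.
Qed.

Lemma le_Ex f h : bounded f -> bounded h -> (forall x, f x <= h x) -> Ex f <= Ex h.
Proof. by move=> hf hh le; apply: le_Rintegral => //; exact: bounded_integrable. Qed.

Lemma Ex_ge0 f : (forall x, 0 <= f x) -> 0 <= Ex f.
Proof. by move=> hf; apply: Rintegral_ge0. Qed.

Lemma Ex_sum (I : Type) (r : seq I) (P : pred I) (f : I -> state N -> R) :
  (forall i, P i -> bounded (f i)) ->
  Ex (fun x => \sum_(i <- r | P i) f i x) = \sum_(i <- r | P i) Ex (f i).
Proof.
move=> hf; elim: r => [|i r IH].
  by rewrite big_nil -[RHS](Ex_cst 0); congr Ex; apply/funext => x; rewrite big_nil.
rewrite big_cons -IH; have [Pi|nPi] := boolP (P i); last first.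
  by congr Ex; apply/funext => x; rewrite big_cons (negbTE nPi).
rewrite -ExD; [|exact: hf|exact: bounded_sum].
by congr Ex; apply/funext => x; rewrite big_cons Pi.
Qed.

Lemma Ex_bounds f a b : (forall x, a <= f x <= b) -> a <= Ex f <= b.
Proof.
move=> h; have hb : bounded f.
  exists (`|a| + `|b|) => x; have /andP[h1 h2] := h x; rewrite ler_norml.
  have := ler_norm b; have := ler_norm (- a); rewrite normrN.
  have := normr_ge0 a; have := normr_ge0 b; lra.
by apply/andP; split; [rewrite -(Ex_cst a)|rewrite -(Ex_cst b)]; apply: le_Ex => //;
  try exact: bounded_cst; move=> x; case/andP: (h x).
Qed.

Lemma Ex_dominated (F : nat -> state N -> R) f C : (forall n x, `|F n x| <= C) ->
  (forall x, F n x @[n --> \oo] --> f x) -> Ex (F n) @[n --> \oo] --> Ex f.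
Proof.
move=> FC Ff; have fC x : `|f x| <= C.
  by apply: (cvgn_le_cst (cvg_norm (Ff x))) => n.
have fin h : bounded h -> (\int[pi]_x (h x)%:E)%E \is a fin_num.
  by move=> hh; apply: integrable_fin_num => //; exact: bounded_integrable.
have cv : (\int[pi]_x (F n x)%:E)%E @[n --> \oo] --> (\int[pi]_x (f x)%:E)%E.
  apply: (@dominated_cvg _ _ _ pi setT _ (fun n x => (F n x)%:E) _ (fun=> C%:E)) => //.
  - by move=> x _; apply: cvg_EFin; [exact: nearW|exact: Ff].
  - by apply: (bounded_integrable (f := fun=> C)); exact: bounded_cst.
  - by move=> n x _; rewrite lee_fin.
rewrite -(fineK (fin f _)) in cv; last by exists C.
exact: fine_cvg cv.
Qed.

End BoundedExpectation.

(** * Stationary laws and the generator *)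

Section UnitMass.
Context {R : realType} {N : nat} (mu : {measure set (state N) -> \bar R}).
Hypothesis muT : mu setT = 1%E.

Lemma unit_mass_fin A : mu A \is a fin_num.
Proof.
rewrite ge0_fin_numE // (@le_lt_trans _ _ 1%E) ?ltry // -muT.
by apply: le_measure; rewrite ?inE.
Qed.

Lemma unit_massC A : fine (mu (~` A)) = 1 - fine (mu A).
Proof.
have e : (mu setT = mu A + mu (~` A))%E by rewrite -measureU ?setvU ?setICr // setUC setvU.
by rewrite -[1]/(fine 1%E) -muT e fineD ?unit_mass_fin // addrAC subrr add0r.
Qed.

Lemma le_sum_singletons (s : seq (state N)) (A : set (state N)) :
  uniq s -> \sum_(y <- s | y \in A) fine (mu [set y]) <= fine (mu A).
Proof.
elim: s A => [|z s IH] A /=.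
  by rewrite big_nil => _; rewrite fine_ge0.
move=> /andP[zs us]; rewrite big_cons; case: ifP => zA; last exact: IH.
have -> : fine (mu A) = fine (mu [set z]) + fine (mu (A `\ z)).
  rewrite -fineD ?unit_mass_fin // -measureU //.
    by rewrite setD1K //; exact: set_mem.
  by rewrite setDE setICA setICr setI0.
rewrite lerD2l; apply: le_trans (IH _ us); rewrite le_eqVlt; apply/orP; left.
rewrite big_seq_cond [X in _ == X]big_seq_cond; apply/eqP; apply: eq_bigl => y.
case: (boolP (y \in s)) => //= ys; have yz : y <> z by move=> yz; rewrite -yz ys in zs.
by apply/idP/idP; rewrite !inE // => -[].
Qed.

End UnitMass.

Section Stationarity.
Context {R : realType} {K M N : nat} (g : bigraph K M N).
Variables (d : nat) (lam : R) (u : 'I_M -> R).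
Implicit Types (x y : state N) (f : state N -> R).
Local Notation Q := (Qmatrix g d lam u).
Local Notation arr := (arrival_rate g d lam).
Local Notation srv := (service_rate g u).

(** The generator as a sum over the jumps of single servers, which is finite,
    in place of a sum over states. *)
Definition gen f x : R :=
  \sum_(j < N) (arr x j * (f (incr x j) - f x) + srv x j * (f (decr x j) - f x)).

(** The states in which row x of the Q-matrix may be nonzero. *)
Definition reach x : seq (state N) :=
  undup (x :: [seq incr x j | j : 'I_N] ++ [seq decr x j | j : 'I_N]).

Definition ind (A : set (state N)) x : R := (x \in A)%:R.

Lemma sum_reach x (A : set (state N)) : \sum_(y <- reach x | y \in A) Q x y = gen (ind A) x.
Proof.
have sum1 z : z \in reach x -> \sum_(y <- reach x | y \in A) (y == z)%:R = ind A z :> R.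
  move=> zr; rewrite big_mkcond (bigD1_seq z) ?undup_uniq //= eqxx big1 ?addr0.
    by rewrite /ind; case: ifP.
  by move=> y /negbTE ->; case: ifP.
have xr : x \in reach x by rewrite mem_undup inE eqxx.
have ir j : incr x j \in reach x.
  by rewrite mem_undup inE mem_cat map_f ?orbT ?mem_enum.
have dr j : decr x j \in reach x.
  by rewrite mem_undup inE mem_cat (map_f (decr x)) ?orbT ?mem_enum.
rewrite /Qmatrix exchange_big /gen; apply: eq_bigr => j _.
rewrite -!sum1 // -!sumrB !mulr_sumr -big_split /=.
by apply: eq_bigr => y _.
Qed.

Hypotheses (lam0 : 0 <= lam) (u0 : forall m, 0 <= u m).
Hypothesis hd : (0 < d)%N.
Hypothesis hdeg : forall i : 'I_(nW g), (d <= delta i)%N.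

Definition rate_bound : R := lam * (nW g)%:R + N%:R * \sum_(m < M) u m.

Lemma arr_ge0 x j : 0 <= arr x j.
Proof. by apply: sumr_ge0 => i _; rewrite mulr_ge0 ?assign_ge0. Qed.

Lemma srv_ge0 x j : 0 <= srv x j.
Proof. by rewrite /service_rate; case: ifP. Qed.

Lemma sum_arr x : \sum_j arr x j <= lam * (nW g)%:R.
Proof.
rewrite /arrival_rate exchange_big /=.
apply: (@le_trans _ _ (\sum_(i < nW g) lam)); last by rewrite sumr_const card_ord mulr_natr.
apply: ler_sum => i _; rewrite -mulr_sumr -[leRHS]mulr1 ler_wpM2l //.
exact: sum_assign_le1.
Qed.

Lemma sum_rates x : \sum_j (arr x j + srv x j) <= rate_bound.
Proof.
rewrite big_split lerD ?sum_arr //=.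
apply: (@le_trans _ _ (\sum_(j < N) \sum_(m < M) u m)); last first.
  by rewrite sumr_const card_ord mulr_natl.
apply: ler_sum => j _; rewrite /service_rate (bigD1 (vtype g j)) //=.
have s0 : 0 <= \sum_(i < M | i != vtype g j) u i by rewrite sumr_ge0.
by case: ifP => _; rewrite ?addr_ge0 // lerDl.
Qed.

Lemma gen_bound f C x : (forall y, `|f y - f x| <= C) -> `|gen f x| <= rate_bound * C.
Proof.
move=> hC; have C0 : 0 <= C := le_trans (normr_ge0 _) (hC x).
apply: (@le_trans _ _ (\sum_j (arr x j + srv x j) * C)); last first.
  by rewrite -mulr_suml ler_wpM2r // sum_rates.
apply: le_trans (ler_norm_sum _ _ _) _; apply: ler_sum => j _.
rewrite (le_trans (ler_normD _ _)) // mulrDl lerD // normrM.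
  by rewrite (ger0_norm (arr_ge0 _ _)) ler_wpM2l ?arr_ge0.
by rewrite (ger0_norm (srv_ge0 _ _)) ler_wpM2l ?srv_ge0.
Qed.

Lemma gen_bounded f : bounded f -> bounded (gen f).
Proof.
move=> [C hC]; exists (rate_bound * (C + C)) => x; apply: gen_bound => y.
by rewrite (le_trans (ler_normB _ _)) ?lerD.
Qed.

Lemma gen_sum (I : Type) (r : seq I) (c : I -> R) (f : I -> state N -> R) x :
  gen (fun x => \sum_(i <- r) c i * f i x) x = \sum_(i <- r) c i * gen (f i) x.
Proof.
rewrite /gen; under [RHS]eq_bigr do rewrite mulr_sumr.
rewrite exchange_big /=; apply: eq_bigr => j _.
rewrite -!sumrB !mulr_sumr -big_split /=; apply: eq_bigr => i _; ring.
Qed.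

Lemma reach_uniq x : uniq (reach x). Proof. exact: undup_uniq. Qed.

Lemma invS_at_right (h : R -> R) (a : R) : h t @[t --> 0^'+] --> a ->
  h n.+1%:R^-1 @[n --> \oo] --> a.
Proof.
move=> /cvg_at_rightP; apply; split; first by move=> n; rewrite invr_gt0 ltr0n.
exact: cvg_harmonic.
Qed.

Section Semigroup.
Variable P : R -> R.-pker (state N) ~> (state N).
Hypothesis hP : transition_function P Q.

Definition pr t x A : R := fine (P t x A).

Let PT t x : P t x setT = 1%E. Proof. exact: prob_kernel. Qed.

Lemma prE t x A : P t x A = (pr t x A)%:E.
Proof. by rewrite fineK // (unit_mass_fin (PT t x)). Qed.

Lemma pr_ge0 t x A : 0 <= pr t x A.
Proof. by rewrite /pr fine_ge0. Qed.

Lemma prC t x A : pr t x (~` A) = 1 - pr t x A.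
Proof. exact: (unit_massC (PT t x)). Qed.

Lemma pr_le1 t x A : pr t x A <= 1.
Proof. by rewrite -subr_ge0 -prC pr_ge0. Qed.

Lemma pr_mono t x A B : A `<=` B -> pr t x A <= pr t x B.
Proof.
move=> AB; rewrite /pr fine_le ?(unit_mass_fin (PT t x)) //.
by apply: le_measure => //; rewrite inE.
Qed.

Lemma pr0 x A : pr 0 x A = ind A x.
Proof. by case: hP => h _ _; rewrite /pr h diracE. Qed.

Lemma pr_deriv x y : (pr t x [set y] - (x == y)%:R) / t @[t --> 0^'+] --> Q x y.
Proof. by case: hP => _ _ h; exact: h. Qed.

Lemma pr_supermul s t x : 0 <= s -> 0 <= t ->
  pr s x [set x] * pr t x [set x] <= pr (s + t) x [set x].
Proof.
move=> s0 t0; case: hP => _ h _.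
rewrite -lee_fin -(prE (s + t)) h // mulrC EFinM.
have -> : ((pr t x [set x])%:E * (pr s x [set x])%:E = \int[P s x]_(y in [set x]) P t y [set x])%E.
  rewrite -(prE s) -(integral_cst (P s x)) //.
  by apply: eq_integral => y; rewrite inE => ->; rewrite -prE.
by apply: ge0_subset_integral => //; exact: measurable_fun_state.
Qed.

Lemma pr_stay_iter s x n : 0 <= s -> pr s x [set x] ^+ n <= pr (n%:R * s) x [set x].
Proof.
move=> s0; elim: n => [|n IH]; first by rewrite mul0r pr0 /ind mem_set.
rewrite exprS mulrSr mulrDl mul1r addrC; apply: le_trans (pr_supermul _ _ _); rewrite ?mulr_ge0 //.
by rewrite ler_wpM2l ?pr_ge0.
Qed.

Lemma bernoulli_ineq (a : R) n : 0 <= a <= 1 -> 1 - n%:R * a <= (1 - a) ^+ n.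
Proof.
move=> /andP[a0 a1]; elim: n => [|n IH]; first by rewrite mul0r subr0.
rewrite exprS; apply: le_trans (_ : _ <= (1 - a) * (1 - n%:R * a)) _.
  rewrite mulrSr; have : 0 <= n%:R * a * a by rewrite !mulr_ge0.
  by lra.
by rewrite ler_wpM2l // subr_ge0.
Qed.

Lemma Qdiag_ge x : - rate_bound <= Q x x.
Proof.
rewrite /Qmatrix lerNl -sumrN; apply: le_trans (sum_rates x); apply: ler_sum => j _.
rewrite eqxx opprD -!mulrN; apply: lerD; rewrite -[leRHS]mulr1.
  by rewrite ler_wpM2l ?arr_ge0 //; case: (x == _) => /=; rewrite ?mulr1n ?mulr0n; lra.
by rewrite ler_wpM2l ?srv_ge0 //; case: (x == _) => /=; rewrite ?mulr1n ?mulr0n; lra.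
Qed.

(** A bound that is uniform in x and t comes from short times, where the
    derivative at 0 gives it, by the semigroup property: staying at x through
    all of n + 1 short intervals is one way to be at x at the end. *)
Lemma pr_stay t x : 0 <= t -> 1 - pr t x [set x] <= (rate_bound + 1) * t.
Proof.
rewrite le_eqVlt => /predU1P[<-|t0]; first by rewrite pr0 /ind mem_set //= subrr mulr0.
set L := rate_bound + 1.
have L0 : 0 <= L.
  by rewrite addr_ge0 // (le_trans _ (sum_rates x)) // sumr_ge0 // => j _; rewrite addr_ge0 ?arr_ge0 ?srv_ge0.
have tn : t / n.+1%:R @[n --> \oo] --> (0 : R).
  by rewrite -(mulr0 t); apply: cvgM; [exact: cvg_cst|exact: cvg_harmonic].
have /cvg_at_rightP/(_ (fun n => t / n.+1%:R)) hd1 := @pr_deriv x x.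
have {}hd1 : (pr (t / n.+1%:R) x [set x] - (x == x)%:R) / (t / n.+1%:R) @[n --> \oo] --> Q x x.
  by apply: hd1; split=> // n; rewrite divr_gt0.
have Q1 : - L < Q x x by apply: lt_le_trans (Qdiag_ge x); rewrite ltrN2 ltrDl.
have Lt : (L * (t / n.+1%:R)) @[n --> \oo] --> (0 : R).
  by rewrite -(mulr0 L); apply: cvgM => //; exact: cvg_cst.
have [n [h1 h2]] : exists n, - L <= (pr (t / n.+1%:R) x [set x] - (x == x)%:R) / (t / n.+1%:R) /\
    L * (t / n.+1%:R) <= 1.
  apply: (@filter_ex _ \oo).
  apply: filterI; first exact: (cvgr_ge _ hd1).
  exact: (cvgr_le _ Lt).
move: h1; have s0 : 0 < t / n.+1%:R by rewrite divr_gt0.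
set s := t / n.+1%:R in s0 h2 *.
have ts : t = n.+1%:R * s by rewrite /s mulrC divfK ?pnatr_eq0.
rewrite eqxx ler_pdivlMr //= => h1.
have h3 : 1 - L * s <= pr s x [set x] by rewrite mulNr in h1; lra.
rewrite lerBlDr -lerBlDl ts; apply: le_trans (pr_stay_iter _ _ (ltW s0)).
apply: le_trans (_ : _ <= (1 - L * s) ^+ n.+1) _.
  rewrite mulrCA; apply: bernoulli_ineq; rewrite h2 andbT mulr_ge0 //; exact: ltW.
by rewrite lerXn2r // nnegrE ?pr_ge0 // subr_ge0.
Qed.

Lemma pr_bound t x A : 0 <= t -> `|pr t x A - ind A x| <= (rate_bound + 1) * t.
Proof.
move=> t0; apply: le_trans (pr_stay x t0); rewrite /ind.
have [xA|xA] := boolP (x \in A).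
  rewrite ler0_norm ?subr_le0 ?pr_le1 // opprB lerB // pr_mono // => y ->; exact: set_mem.
rewrite subr0 ger0_norm ?pr_ge0 // -prC pr_mono // => y yA /= yx.
by move: xA; rewrite -yx mem_set.
Qed.

Lemma ind_C A x : ind (~` A) x = 1 - ind A x.
Proof. by rewrite /ind in_setC; case: (x \in A); rewrite ?subrr ?subr0. Qed.

Lemma gen_indC A x : gen (ind (~` A)) x = - gen (ind A) x.
Proof.
rewrite /gen -sumrN; apply: eq_bigr => j _; rewrite !ind_C; ring.
Qed.

(** The derivatives at single states give, by finite sums, a lower bound for
    the derivative at any set. The lower bound for the complement is an upper
    bound for the set, and both agree because the rows of the Q-matrix have sum
    zero. *)
Lemma pr_cvg x A : (pr n.+1%:R^-1 x A - ind A x) / n.+1%:R^-1 @[n --> \oo] --> gen (ind A) x.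
Proof.
pose lowr (B : set (state N)) n := \sum_(y <- reach x | y \in B) (pr n.+1%:R^-1 x [set y] - (x == y)%:R) / n.+1%:R^-1.
have low_cvg (B : set (state N)) : lowr B n @[n --> \oo] --> gen (ind B) x.
  rewrite -sum_reach; apply: cvg_sumr => y _.
  exact: (invS_at_right (@pr_deriv x y)).
have low_le (B : set (state N)) n : lowr B n <= (pr n.+1%:R^-1 x B - ind B x) / n.+1%:R^-1.
  rewrite /lowr -mulr_suml ler_wpM2r // sumrB lerB //.
    exact: (le_sum_singletons (PT _ x) _ (reach_uniq x)).
  have xr : x \in reach x by rewrite mem_undup inE eqxx.
  rewrite big_mkcond (bigD1_seq x) ?reach_uniq //= eqxx big1 ?addr0.
    by rewrite /ind; case: ifP.
  by move=> y; rewrite eq_sym => /negbTE ->; case: ifP.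
have high_cvg : - lowr (~` A) n @[n --> \oo] --> gen (ind A) x.
  by rewrite -[gen _ _]opprK -gen_indC; apply: cvgN; exact: low_cvg.
apply: squeeze_cvgr (low_cvg A) high_cvg; apply: nearW => n.
rewrite low_le /= lerNr -mulNr.
have -> : - (pr n.+1%:R^-1 x A - ind A x) =
    (1 - pr n.+1%:R^-1 x A) - (1 - ind A x) by ring.
by rewrite -prC -ind_C; exact: low_le.
Qed.

End Semigroup.

Variable pi : probability (state N) R.
Hypothesis hpi : stationary Q pi.

(** Under a stationary law the difference quotients of the transition function
    have mean zero. They converge to the generator, and [pr_bound] dominates
    them. *)
Lemma stationary_ind A : Ex pi (gen (ind A)) = 0.
Proof.
case: hpi => P hP stat.
set h := fun n x => (pr P n.+1%:R^-1 x A - ind A x) / n.+1%:R^-1.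
have hb n x : `|h n x| <= rate_bound + 1.
  rewrite /h normrM [`|_^-1^-1|]ger0_norm // ler_pdivrMr ?invr_gt0 //.
  exact: pr_bound.
have bi : bounded (ind A).
  by exists 1 => x; rewrite /ind; case: (x \in A); rewrite ?normr1 ?normr0.
have bp t : bounded (fun x => pr P t x A).
  by exists 1 => x; rewrite ger0_norm ?pr_ge0 ?pr_le1.
have Exh n : Ex pi (h n) = 0.
  rewrite /h; under eq_fun do rewrite mulrC.
  rewrite ExZ ?ExB //; last exact: boundedB.
  suff -> : Ex pi (fun x => pr P n.+1%:R^-1 x A) = Ex pi (ind A) by rewrite subrr mulr0.
  have e (f : state N -> R) : Ex pi f = fine (\int[pi]_x (f x)%:E) by [].
  rewrite !e; congr fine; transitivity (pi A).
    rewrite -(stat n.+1%:R^-1) //; apply: eq_integral => x _; by rewrite prE.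
  transitivity (\int[pi]_(x in setT) (\1_A x)%:E)%E.
    by rewrite integral_indic ?setIT.
  apply: eq_integral => x _; by rewrite /ind indicE.
have cv : Ex pi (h n) @[n --> \oo] --> Ex pi (gen (ind A)).
  by apply: Ex_dominated hb _ => x; exact: pr_cvg.
have cv0 : Ex pi (h n) @[n --> \oo] --> (0 : R).
  by under eq_cvg do rewrite Exh; exact: cvg_cst.
exact: (cvg_unique _ cv cv0).
Qed.

(** A function with finitely many values is a finite combination of
    indicators. *)
Lemma stationary_gen (T : finType) (h : state N -> T) (F : T -> R) :
  Ex pi (gen (F \o h)) = 0.
Proof.
have -> : F \o h = fun x => \sum_(t : T) F t * ind [set y | h y = t] x.
  apply/funext => x /=; rewrite (bigD1 (h x)) //= big1 ?addr0.
    by rewrite /ind mem_set ?mulr1.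
  move=> t; rewrite eq_sym => ht; rewrite /ind memNset ?mulr0 //= => e.
  by rewrite e eqxx in ht.
have bi (A : set (state N)) : bounded (ind A).
  by exists 1 => x; rewrite /ind; case: (x \in A); rewrite ?normr1 ?normr0.
have -> : gen (fun x => \sum_t F t * ind [set y | h y = t] x) =
    fun x => \sum_t F t * gen (ind [set y | h y = t]) x.
  by apply/funext => x; rewrite gen_sum.
rewrite Ex_sum => [|t _]; last by apply: boundedZ; exact: gen_bounded.
apply: big1 => t _; rewrite ExZ ?stationary_ind ?mulr0 //; exact: gen_bounded.
Qed.

End Stationarity.

(** * Uniform limits *)

Section UniformlyNull.
Context {R : realType}.

(** Uniformity over an index type that varies with N, such as the states of the
    N-th system or its sets of servers. *)
Definition unull (I : nat -> Type) (f : forall N, I N -> R) : Prop :=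
  forall e : R, 0 < e -> \forall N \near \oo, forall i : I N, `|f N i| <= e.
Definition ubdd (I : nat -> Type) (f : forall N, I N -> R) : Prop :=
  exists C : R, \forall N \near \oo, forall i : I N, `|f N i| <= C.

Lemma unull_dom I (f h : forall N : nat, I N -> R) :
  (\forall N \near \oo, forall i, `|f N i| <= h N i) -> unull h -> unull f.
Proof.
move=> fh hn e e0; apply: filterS2 fh (hn e e0) => N h1 h2 i.
by apply: (le_trans (h1 i)); apply: (le_trans (ler_norm _)).
Qed.

Lemma unull_eq I (f h : forall N : nat, I N -> R) :
  (\forall N \near \oo, forall i, f N i = h N i) -> unull h -> unull f.
Proof.
by move=> fh hn e e0; apply: filterS2 fh (hn e e0) => N h1 h2 i; rewrite h1.
Qed.

Lemma unullD I (f h : forall N : nat, I N -> R) :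
  unull f -> unull h -> unull (fun N i => f N i + h N i).
Proof.
move=> fn hn e e0; have e2 : 0 < e / 2 by rewrite divr_gt0.
apply: filterS2 (fn _ e2) (hn _ e2) => N h1 h2 i.
by rewrite (splitr e) (le_trans (ler_normD _ _)) ?lerD.
Qed.

Lemma unullN I (f : forall N : nat, I N -> R) : unull f -> unull (fun N i => - f N i).
Proof. by move=> fn e e0; apply: filterS (fn e e0) => N h1 i; rewrite normrN. Qed.

Lemma unullB I (f h : forall N : nat, I N -> R) :
  unull f -> unull h -> unull (fun N i => f N i - h N i).
Proof. by move=> fn hn; apply: unullD => //; exact: unullN. Qed.

Lemma unull0 I : unull (fun (N : nat) (_ : I N) => 0).
Proof. by move=> e e0; apply: nearW => N i; rewrite normr0 ltW. Qed.

Lemma unull_sum I (J : Type) (r : seq J) (P : pred J) (f : J -> forall N : nat, I N -> R) :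
  (forall j, P j -> unull (f j)) -> unull (fun N i => \sum_(j <- r | P j) f j N i).
Proof.
move=> fn; elim: r => [|j r IH].
  by apply: unull_eq (@unull0 I); apply: nearW => N i; rewrite big_nil.
have [Pj|nPj] := boolP (P j).
  apply: unull_eq (unullD (fn j Pj) IH); apply: nearW => N i.
  by rewrite big_cons Pj.
by apply: unull_eq IH; apply: nearW => N i; rewrite big_cons (negbTE nPj).
Qed.

Lemma unull_bddM I (h f : forall N : nat, I N -> R) :
  ubdd h -> unull f -> unull (fun N i => h N i * f N i).
Proof.
move=> [C hC] fn e e0; have C0 : 0 < `|C| + 1 by rewrite ltr_pwDr.
apply: filterS2 hC (fn _ (divr_gt0 e0 C0)) => N h1 h2 i.
have C1 : `|C| + 1 != 0 by rewrite gt_eqF.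
rewrite normrM -[e](divfK C1) mulrC ler_pM //.
by rewrite (le_trans (h1 i)) // (le_trans (ler_norm C)) // lerDl.
Qed.

Lemma ubdd_le I (f : forall N : nat, I N -> R) C :
  (forall N i, `|f N i| <= C) -> ubdd f.
Proof. by move=> h; exists C; apply: nearW. Qed.

Lemma ubdd_cvg I (a : nat -> R) (b : R) : a N @[N --> \oo] --> b ->
  ubdd (fun N (_ : I N) => a N).
Proof.
move=> ab; exists (`|b| + 1); have b1 : `|b| < `|b| + 1 by rewrite ltrDl.
by apply: filterS (cvgr_le _ (cvg_norm ab) _ b1) => N h _.
Qed.

Lemma unullZ I c (f : forall N : nat, I N -> R) : unull f -> unull (fun N i => c * f N i).
Proof. by apply: unull_bddM; exact: ubdd_le. Qed.

Lemma unull_cvg I (a : nat -> R) (b : R) : a N @[N --> \oo] --> b ->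
  unull (fun N (_ : I N) => a N - b).
Proof.
move=> /cvgrPdist_le ab e e0; apply: filterS (ab e e0) => N h _.
by rewrite distrC.
Qed.

(** The difference is h * (f - F) + F * (h - H), so that only h and F have to be
    bounded. *)
Lemma unull_mul I (f F h H : forall N : nat, I N -> R) : ubdd h -> ubdd F ->
  unull (fun N i => f N i - F N i) -> unull (fun N i => h N i - H N i) ->
  unull (fun N i => f N i * h N i - F N i * H N i).
Proof.
move=> hb Fb fn hn; apply: unull_eq (unullD (unull_bddM hb fn) (unull_bddM Fb hn)).
by apply: nearW => N i; ring.
Qed.

Lemma unull_reindex I J (f : forall N : nat, I N -> R) (phi : forall N, J N -> I N) :
  unull f -> unull (fun N j => f N (phi N j)).
Proof. by move=> fn e e0; apply: filterS (fn e e0) => N h j. Qed.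

Lemma cvg_unull I (f : forall N : nat, I N -> R) (phi : forall N, I N) :
  unull f -> f N (phi N) @[N --> \oo] --> (0 : R).
Proof.
move=> fn; apply/cvgrPdist_le => e e0; apply: filterS (fn e e0) => N h.
by rewrite sub0r normrN.
Qed.

End UniformlyNull.

(** * Counting edges by type *)

Lemma bigminn_le_cond (I : finType) (A : pred I) (f : I -> nat) x j :
  A j -> (\big[minn/x]_(i | A i) f i <= f j)%N.
Proof.
move=> Aj; have := mem_index_enum j; elim: (index_enum I) => //= i r IH.
rewrite inE big_cons => /predU1P[<-|jr]; first by rewrite Aj geq_minl.
by case: ifP => _; rewrite ?geq_min IH ?orbT.
Qed.

Section GraphCounts.
Context {R : realType} {K M N : nat} (g : bigraph K M N).
Implicit Types (U : {set 'I_N}) (k : 'I_K) (m : 'I_M).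

Lemma card_edges_w k U : #|edges g k U| = (\sum_(i in Wcls g k) #|nbr i :&: U|)%N.
Proof.
rewrite /edges -sum1dep_card.
rewrite (eq_bigl (fun e : 'I_(nW g) * 'I_N => (e.1 \in Wcls g k) && ((e.2 \in U) && edge e.1 e.2))) //.
rewrite -(pair_big_dep (fun i => i \in Wcls g k) (fun i j => (j \in U) && edge i j) (fun _ _ => 1%N)) /=.
apply: eq_bigr => i _; rewrite sum1dep_card; apply: eq_card => j.
by rewrite !inE andbC.
Qed.

Lemma card_edges_v k U : #|edges g k U| = (\sum_(j in U) degv g k j)%N.
Proof.
rewrite card_edges_w /degv; transitivity (\sum_(i in Wcls g k) \sum_(j in U) (edge i j : nat))%N.
  apply: eq_bigr => i _; rewrite -sum1_card big_mkcond [RHS]big_mkcond.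
  by apply: eq_bigr => j _; rewrite !inE andbC; case: (j \in U); case: edge.
rewrite exchange_big; apply: eq_bigr => j _; rewrite -sum1_card big_mkcond [RHS]big_mkcond.
by apply: eq_bigr => i _; rewrite !inE; case: (_ == k); case: edge.
Qed.

Lemma sum_by_vtype (f : 'I_N -> R) U :
  \sum_(j in U) f j = \sum_(m < M) \sum_(j in U :&: Vcls g m) f j.
Proof.
rewrite (partition_big (vtype g) predT) //=; apply: eq_bigr => m _.
by apply: eq_bigl => j; rewrite !inE.
Qed.

Lemma sum_by_wtype (f : 'I_(nW g) -> R) :
  \sum_i f i = \sum_(k < K) \sum_(i in Wcls g k) f i.
Proof.
rewrite (partition_big (@wtype _ _ _ g) predT) //=; apply: eq_bigr => m _.
by apply: eq_bigl => j; rewrite !inE.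
Qed.

Lemma edges_by_vtype k U :
  #|edges g k U|%:R = \sum_(m < M) #|edges g k (U :&: Vcls g m)|%:R :> R.
Proof.
rewrite card_edges_v natr_sum sum_by_vtype; apply: eq_bigr => m _.
by rewrite card_edges_v natr_sum.
Qed.

Definition prof U m : R := #|U :&: Vcls g m|%:R / #|Vcls g m|%:R.
Definition share (i : 'I_(nW g)) U : R := #|nbr i :&: U|%:R / #|nbr i|%:R.

Lemma ratio_unit (a b : nat) : (a <= b)%N -> 0 <= (a%:R / b%:R : R) <= 1.
Proof.
move=> ab; rewrite divr_ge0 //=; case: b ab => [|b] ab; first by rewrite invr0 mulr0.
by rewrite ler_pdivrMr ?ltr0n // mul1r ler_nat.
Qed.

Lemma prof_unit U m : 0 <= prof U m <= 1.
Proof. by apply: ratio_unit; rewrite subset_leq_card // finset.subsetIr. Qed.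

Lemma share_unit i U : 0 <= share i U <= 1.
Proof. by apply: ratio_unit; rewrite subset_leq_card // finset.subsetIl. Qed.

Lemma prof_setT m : (0 < #|Vcls g m|)%N -> prof [set: 'I_N]%SET m = 1.
Proof. by move=> h; rewrite /prof finset.setTI divff // pnatr_eq0 -lt0n. Qed.

Lemma card_prof U m : #|U :&: Vcls g m|%:R = prof U m * #|Vcls g m|%:R.
Proof.
rewrite /prof; have [v0|v0] := posnP #|Vcls g m|; last first.
  by rewrite divfK // pnatr_eq0 -lt0n.
rewrite v0 mulr0; apply/eqP; rewrite pnatr_eq0 -leqn0 -v0.
by rewrite subset_leq_card // finset.subsetIr.
Qed.

(** When the degrees into W_k vary little over V_m, the edges into a part of V_m
    are nearly proportional to its size. *)
Lemma edges_prof_dist k m U :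
  `|#|edges g k (U :&: Vcls g m)|%:R - prof U m * #|edges g k (Vcls g m)|%:R| <=
  ((\max_(j in Vcls g m) degv g k j)%N%:R
   - (\big[minn/nW g]_(j in Vcls g m) degv g k j)%:R) * #|Vcls g m|%:R :> R.
Proof.
set a := (\max_(j in _) _)%N; set b := \big[minn/_]_(j in _) _.
have da j : j \in Vcls g m -> (degv g k j <= a)%N by move=> jV; exact: leq_bigmax_cond.
have db j : j \in Vcls g m -> (b <= degv g k j)%N by move=> jV; exact: bigminn_le_cond.
have bnd (D : {set 'I_N}) : D \subset Vcls g m ->
    b%:R * #|D|%:R <= (#|edges g k D|%:R : R) <= a%:R * #|D|%:R.
  move=> /fintype.subsetP sD; rewrite -!natrM !ler_nat card_edges_v ![(_ * #|D|)%N]mulnC -!sum_nat_const.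
  by apply/andP; split; apply: leq_sum => j /sD jV; [exact: db|exact: da].
have /andP[h1 h2] := bnd _ (finset.subsetIr U (Vcls g m)).
have /andP[h3 h4] := bnd _ (subxx (Vcls g m)).
have /andP[q0 q1] := prof_unit U m.
rewrite card_prof in h1 h2.
have h3' := ler_wpM2l q0 h3; have h4' := ler_wpM2l q0 h4.
have [v0|v0] := posnP #|Vcls g m|.
  by rewrite v0 !mulr0 in h1 h2 h3' h4' *; rewrite ler_norml; lra.
have ab : b%:R <= a%:R :> R.
  case/card_gt0P: v0 => j jV; rewrite ler_nat; exact: leq_trans (db j jV) (da j jV).
apply: (@le_trans _ _ ((a%:R - b%:R) * (prof U m * #|Vcls g m|%:R))).
  rewrite ler_norml; lra.
by rewrite ler_wpM2l ?subr_ge0 // -[leRHS]mul1r ler_wpM2r.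
Qed.

End GraphCounts.

(** * The sequence of systems *)

Section Asymptotics.
Context {R : realType} {K M : nat}.
Variables (d : nat) (lam xi : R) (u v : 'I_M -> R) (w : 'I_K -> R).
Variable p : 'I_K -> 'I_M -> R.
Hypothesis hd : (0 < d)%N.
Hypotheses (hlam : 0 < lam) (hxi : 0 < xi) (hu : forall m, 0 < u m).
Hypothesis hw : forall k, 0 < w k.
Hypothesis hv : forall m, 0 < v m.
Hypothesis hp : forall k m, 0 <= p k m <= 1.
Hypothesis hdk : forall k, 0 < dk v p k.
Variable G : forall N, bigraph K M N.
Hypothesis hW : (nW (G N))%:R / N%:R @[N --> \oo] --> xi.
Hypothesis hWk : forall k, #|Wcls (G N) k|%:R / (nW (G N))%:R @[N --> \oo] --> w k.
Hypothesis hVm : forall m, #|Vcls (G N) m|%:R / N%:R @[N --> \oo] --> v m.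
Hypothesis hcps : @clustered_prop_sparse R K M G.
Hypothesis hC : conditionC G p.

Local Notation WN N := ((nW (G N))%:R : R).
Local Notation WkN k N := (#|Wcls (G N) k|%:R : R).
Local Notation VmN m N := (#|Vcls (G N) m|%:R : R).
Local Notation qt := (qtilde v p).

(** * Sizes of the type classes *)

Lemma inv_nat_cvg : (N%:R^-1 : R) @[N --> \oo] --> (0 : R).
Proof. by rewrite -(cvg_shiftS (fun N => N%:R^-1 : R)); exact: cvg_harmonic. Qed.

Lemma Wk_cvg k : WkN k N / N%:R @[N --> \oo] --> w k * xi.
Proof.
have -> : (fun N => WkN k N / N%:R) = (fun N => (WkN k N / WN N) * (WN N / N%:R)).
  apply/funext => N; have [W0|W0] := posnP (nW (G N)); last first.
    by rewrite mulrA divfK // pnatr_eq0 -lt0n.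
  have -> : #|Wcls (G N) k| = 0%N.
    by apply/eqP; rewrite -leqn0 -W0 -[leqRHS](card_ord (nW (G N))) max_card.
  by rewrite !mul0r.
by apply: cvgM.
Qed.

Lemma linear_growth (f : nat -> nat) (a : R) : 0 < a ->
  (f N)%:R / N%:R @[N --> \oo] --> a ->
  \forall N \near \oo, (0 < N)%N /\ a / 2 * N%:R <= (f N)%:R.
Proof.
move=> a0 fa; have a2 : a / 2 < a by rewrite ltr_pdivrMr // ltr_pMr // ltr1n.
apply: filterS2 (cvgr_ge _ fa _ a2) (nbhs_infty_gt 0) => N h N0.
by split=> //; rewrite -ler_pdivlMr ?ltr0n.
Qed.

Lemma near_Vm_gt0 m : \forall N \near \oo, (0 < #|Vcls (G N) m|)%N.
Proof.
apply: filterS (linear_growth (hv m) (@hVm m)) => N [N0 h].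
by rewrite -(ltr0n R) (lt_le_trans _ h) // mulr_gt0 ?divr_gt0 ?ltr0n.
Qed.

Lemma near_Wk_gt0 k : \forall N \near \oo, (0 < #|Wcls (G N) k|)%N.
Proof.
have wx : 0 < w k * xi by rewrite mulr_gt0.
apply: filterS (linear_growth wx (@Wk_cvg k)) => N [N0 h].
by rewrite -(ltr0n R) (lt_le_trans _ h) // mulr_gt0 ?divr_gt0 ?ltr0n.
Qed.

Lemma NVm_cvg m : N%:R / VmN m N @[N --> \oo] --> (v m)^-1.
Proof.
under eq_cvg do rewrite -invf_div.
by apply: cvgV => //; rewrite gt_eqF.
Qed.

(** * Edge counts are determined by the type profile *)

(** The condition e < 1 excludes a vanishing minimum with a positive maximum,
    for which the ratio is 0. *)
Lemma maxmin_close (a b : nat) (e : R) : e < 1 ->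
  `|maxmin_ratio a b - 1| <= e -> a%:R - b%:R <= e * a%:R.
Proof.
rewrite /maxmin_ratio => e1; case: eqP => [-> _|/eqP a0].
  by rewrite mulr0 sub0r oppr_le0.
have [->|b0] := posnP b; first by rewrite invr0 mulr0 sub0r normrN normr1 leNgt e1.
have B0 : 0 < b%:R :> R by rewrite ltr0n.
have A0 : 0 < a%:R :> R by rewrite ltr0n lt0n.
rewrite ler_norml => /andP[_]; rewrite lerBlDr ler_pdivrMr // => h.
have e0 : 0 <= e \/ e < 0 by case: (ltP e 0); [right|left].
case: e0 => [e0|e0]; last by nra.
have : e * b%:R <= e * a%:R \/ a%:R < b%:R :> R.
  by case: (leP (b%:R : R) a%:R) => ab; [left; rewrite ler_wpM2l|right].
by case; nra.
Qed.

(** The asymptotic share of U in the neighbourhood of a dispatcher of type k.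
    At the set of servers with queue length at least l it is qt of the occupancy
    ([qt_occ]). *)
Definition mean_share N k (U : {set 'I_N}) : R :=
  \sum_(m < M) v m * p k m / dk v p k * prof (G N) U m.

Lemma mean_share_unit N k U : 0 <= @mean_share N k U <= 1.
Proof. by apply: (qt_unit hv hp hdk (q := fun m _ => prof (G N) U m)) 0%N => m _; exact: prof_unit. Qed.

Lemma edges_part_unull k m : unull (fun N (U : {set 'I_N}) =>
  #|edges (G N) k (U :&: Vcls (G N) m)|%:R / (WkN k N * VmN m N)
  - prof (G N) U m * p k m).
Proof.
have [e_cvg _ dv_cvg] := hC.
have h1 : unull (fun N (U : {set 'I_N}) => prof (G N) U m *
    (#|edges (G N) k (Vcls (G N) m)|%:R / (WkN k N * VmN m N) - p k m)).
  apply: unull_bddM; last by apply: unull_cvg; exact: e_cvg.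
  by apply: (@ubdd_le _ _ _ 1) => N U; have /andP[? ?] := @prof_unit R _ _ _ (G N) U m; rewrite ger0_norm.
have h2 : unull (fun N (U : {set 'I_N}) =>
    #|edges (G N) k (U :&: Vcls (G N) m)|%:R / (WkN k N * VmN m N) -
    prof (G N) U m * (#|edges (G N) k (Vcls (G N) m)|%:R / (WkN k N * VmN m N))).
  (* The bound of the ratios of the degrees is used below 1, as [maxmin_close]
     requires. *)
  move=> e e0; pose e' : R := Order.min e (1 / 2).
  have e'0 : 0 < e' by rewrite lt_min e0 divr_gt0.
  have e'1 : e' < 1 by rewrite gt_min ltr_pdivrMr // mul1r ltr1n orbT.
  have /cvgrPdist_le/(_ e' e'0) := dv_cvg k m.
  apply: filter_app; apply: filterS2 (near_Vm_gt0 m) (near_Wk_gt0 k) => N V0 W0 dv U.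
  rewrite distrC in dv; have {}dv := maxmin_close e'1 dv.
  rewrite mulrA -mulrBl normrM [X in _ * X]ger0_norm ?invr_ge0 ?mulr_ge0 //.
  have V0' : 0 < VmN m N by rewrite ltr0n.
  have W0' : 0 < WkN k N by rewrite ltr0n.
  rewrite ler_pdivrMr ?mulr_gt0 //; apply: le_trans (edges_prof_dist _ _ _ _) _.
  rewrite mulrA ler_wpM2r //; apply: le_trans dv _; apply: ler_pM => //; first exact: ltW.
    by rewrite ge_min lexx.
  rewrite ler_nat; apply/bigmax_leqP => j _; rewrite subset_leq_card //.
  by apply/fintype.subsetP => i; rewrite inE => /andP[].
apply: unull_eq (unullD h2 h1); apply: nearW => N U; ring.
Qed.

Definition edens N k (U : {set 'I_N}) : R := #|edges (G N) k U|%:R / (WkN k N * N%:R).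

Lemma edens_unull k : unull (fun N (U : {set 'I_N}) =>
  edens k U - \sum_(m < M) p k m * v m * prof (G N) U m).
Proof.
have h m : unull (fun N (U : {set 'I_N}) =>
   #|edges (G N) k (U :&: Vcls (G N) m)|%:R / (WkN k N * VmN m N) * (VmN m N / N%:R)
   - prof (G N) U m * p k m * v m).
  apply: unull_mul.
  - exact: ubdd_cvg (@hVm m).
  - apply: (@ubdd_le _ _ _ 1) => N U; have /andP[? ?] := @prof_unit R _ _ _ (G N) U m.
    by have /andP[? ?] := hp k m; rewrite ger0_norm ?mulr_ge0 // mulr_ile1.
  - exact: edges_part_unull.
  - exact: unull_cvg (@hVm m).
have := unull_sum (index_enum 'I_M) (P := predT) (fun m _ => h m); apply: unull_eq.
have V0 : \forall N \near \oo, forall m, (0 < #|Vcls (G N) m|)%N.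
  exact: (filter_forall _ near_Vm_gt0).
apply: filterS V0 => N V0 U; rewrite sumrB; congr (_ - _); last first.
  by apply: eq_bigr => m _; ring.
rewrite /edens edges_by_vtype mulr_suml; apply: eq_bigr => m _.
rewrite -!mulrA; congr (_ * _); rewrite !invfM -mulrA mulKf //.
by rewrite pnatr_eq0 -lt0n.
Qed.

Definition eratio N k (U : {set 'I_N}) : R :=
  #|edges (G N) k U|%:R / #|edges (G N) k [set: 'I_N]%SET|%:R.

Lemma edges_le N k (U : {set 'I_N}) : (#|edges (G N) k U| <= #|edges (G N) k [set: 'I_N]%SET|)%N.
Proof.
rewrite subset_leq_card //; apply/fintype.subsetP => e; rewrite !inE.
by case/and3P => -> _ ->.
Qed.

Lemma eratio_unit N k (U : {set 'I_N}) : 0 <= eratio k U <= 1.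
Proof. by apply: ratio_unit; exact: edges_le. Qed.

Lemma eratio_unull k : unull (fun N (U : {set 'I_N}) => eratio k U - mean_share k U).
Proof.
pose T N : {set 'I_N} := [set: 'I_N]%SET.
have hT : unull (fun N (U : {set 'I_N}) => edens k (T N) - dk v p k).
  have := unull_reindex (fun N (_ : {set 'I_N}) => T N) (edens_unull k); apply: unull_eq.
  have V0 : \forall N \near \oo, forall m, (0 < #|Vcls (G N) m|)%N.
    exact: (filter_forall _ near_Vm_gt0).
  apply: filterS V0 => N V0 U; congr (_ - _); apply: eq_bigr => m _.
  by rewrite prof_setT ?mulr1.
have h1 := unullZ (dk v p k)^-1 (edens_unull k).
have h2 : unull (fun N (U : {set 'I_N}) => eratio k U * (edens k (T N) - dk v p k)).
  apply: unull_bddM hT; apply: (@ubdd_le _ _ _ 1) => N U.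
  by have /andP[? ?] := eratio_unit k U; rewrite ger0_norm.
apply: unull_eq (unullB h1 (unullZ (dk v p k)^-1 h2)); apply: nearW => N U.
have -> : edens k U = eratio k U * edens k (T N).
  rewrite /edens /eratio mulrA; congr (_ / _).
  have [T0|T0] := posnP #|edges (G N) k (T N)|; last by rewrite divfK // pnatr_eq0 -lt0n.
  have -> : #|edges (G N) k U| = 0%N by apply/eqP; rewrite -leqn0 -T0 edges_le.
  by rewrite !mul0r.
have d0 : dk v p k != 0 by rewrite gt_eqF.
have -> : mean_share k U = (\sum_(m < M) p k m * v m * prof (G N) U m) / dk v p k.
  by rewrite /mean_share mulr_suml; apply: eq_bigr => m _; ring.
by field.
Qed.

(** * Clustered proportional sparsity on average *)

Definition avg N k (f : 'I_(nW (G N)) -> R) : R :=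
  (WkN k N)^-1 * \sum_(i in Wcls (G N) k) f i.

Lemma le_avg N k (f h : 'I_(nW (G N)) -> R) :
  (forall i, i \in Wcls (G N) k -> f i <= h i) -> avg k f <= avg k h.
Proof. by move=> fh; rewrite ler_wpM2l ?invr_ge0 // ler_sum. Qed.

Lemma avgD N k (f h : 'I_(nW (G N)) -> R) : avg k (fun i => f i + h i) = avg k f + avg k h.
Proof. by rewrite /avg big_split mulrDr. Qed.

Lemma avgZ N k c (f : 'I_(nW (G N)) -> R) : avg k (fun i => c * f i) = c * avg k f.
Proof. by rewrite /avg -mulr_sumr mulrCA. Qed.

Lemma avg_sum N k (J : Type) (r : seq J) (f : J -> 'I_(nW (G N)) -> R) :
  avg k (fun i => \sum_(j <- r) f j i) = \sum_(j <- r) avg k (f j).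
Proof. by rewrite /avg exchange_big mulr_sumr. Qed.

Lemma avg_cst_le N k (c : R) : 0 <= c -> avg k (fun _ : 'I_(nW (G N)) => c) <= c.
Proof.
move=> c0; rewrite /avg sumr_const -[c *+ _]mulr_natl mulrA.
have [->|W0] := posnP #|Wcls (G N) k|; first by rewrite mulr0 mul0r.
by rewrite mulVf ?mul1r // pnatr_eq0 -lt0n.
Qed.

Lemma avg_ge0 N k (f : 'I_(nW (G N)) -> R) : (forall i, 0 <= f i) -> 0 <= avg k f.
Proof. by move=> f0; rewrite mulr_ge0 ?invr_ge0 ?sumr_ge0. Qed.

(** The exceptional dispatchers of clustered proportional sparsity are few and
    contribute at most 1 each; the others contribute at most e / 2. *)
Lemma share_eratio_unull k : unull (fun N (U : {set 'I_N}) =>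
  avg k (fun i : 'I_(nW (G N)) => `|share i U - eratio k U|)).
Proof.
move=> e e0; have e2 : 0 < e / 2 by rewrite divr_gt0.
have /cvgrPdist_le/(_ _ e2) := hcps e2; apply: filterS => N.
rewrite sub0r normrN => hN U; rewrite ger0_norm ?avg_ge0 //.
have bad_le : #|cps_bad (G N) (e / 2) k U|%:R / WkN k N <= e / 2.
  apply: le_trans hN; apply: le_trans (ler_norm _); rewrite /cps_sup.
  apply: le_trans (le_bigmax _ (fun k => \big[Order.max/0]_(U : {set 'I_N}) (#|cps_bad (G N) (e / 2) k U|%:R / WkN k N)) k).
  exact: (le_bigmax _ (fun U : {set 'I_N} => #|cps_bad (G N) (e / 2) k U|%:R / WkN k N) U).
apply: (@le_trans _ _ (avg k (fun i : 'I_(nW (G N)) => e / 2 + (i \in cps_bad (G N) (e / 2) k U)%:R))).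
  apply: le_avg => i iW; have [ib|] := boolP (i \in cps_bad (G N) (e / 2) k U).
    have /andP[? ?] := @share_unit R _ _ _ (G N) i U; have /andP[? ?] := eratio_unit k U.
    by rewrite ler_norml /= mulr1n; lra.
  by rewrite addr0 inE iW /= -ltNge => /ltW.
rewrite avgD [leRHS]splitr lerD //; first by apply: avg_cst_le; exact: ltW.
apply: le_trans bad_le; rewrite /avg mulrC ler_wpM2r ?invr_ge0 //.
rewrite -natr_sum ler_nat -sum1_card big_mkcond [leqRHS]big_mkcond leq_sum // => i _.
by case: (i \in Wcls _ _); case: (i \in cps_bad _ _ _ _).
Qed.

Lemma share_unull k : unull (fun N (U : {set 'I_N}) =>
  avg k (fun i : 'I_(nW (G N)) => `|share i U - mean_share k U|)).
Proof.
have h : unull (fun N (U : {set 'I_N}) => `|eratio k U - mean_share k U|).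
  by move=> e e0; apply: filterS (eratio_unull k e0) => N hN U; rewrite normr_id.
apply: unull_dom (unullD (share_eratio_unull k) h); apply: nearW => N U.
rewrite ger0_norm ?avg_ge0 //.
apply: (le_trans _ (lerD (lexx _) (@avg_cst_le N k _ (normr_ge0 (eratio k U - mean_share k U))))).
rewrite -avgD; apply: le_avg => i _.
rewrite (_ : share i U - mean_share k U = (share i U - eratio k U) + (eratio k U - mean_share k U)) ?ler_normD //; by ring.
Qed.

(** * All degrees tend to infinity *)

(** Some type m has p k m > 0. The mean degree from W_k into V_m, hence the
    maximal one, grows linearly, and the degree condition passes this on to the
    minimal one. *)
Lemma deg_large_class k (B : nat) :
  \forall N \near \oo, forall i, i \in Wcls (G N) k -> (B <= delta (i : 'I_(nW (G N))))%N.
Proof.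
have [m pkm] : exists m, 0 < p k m.
  apply: contrapT => /forallNP hn; have := hdk k; rewrite /dk big1 ?ltxx // => m _.
  have /andP[p0 _] := hp k m; have /negP := hn m; rewrite -leNgt => p0'.
  by have -> : p k m = 0; [apply/eqP; rewrite eq_le p0 p0'|rewrite mul0r].
have [e_cvg dw_cvg _] := hC.
have p2 : p k m / 2 < p k m by rewrite ltr_pdivrMr // ltr_pMr // ltr1n.
have c0 : 0 < p k m / 2 * (v m / 2) / 2 by rewrite !(divr_gt0, mulr_gt0).
(* The maximal degree is at least (p k m / 2) * (v m / 2) * N, and the minimal
   degree at least half of it. *)
have [N0 hN0] : exists N0 : nat, B%:R <= p k m / 2 * (v m / 2) / 2 * N0%:R.
  exists (Num.bound ((p k m / 2 * (v m / 2) / 2)^-1 * B%:R)).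
  by rewrite -ler_pdivrMl //; apply/ltW/archi_boundP; rewrite mulr_ge0 ?invr_ge0 // ltW.
have /cvgrPdist_le/(_ (1 / 2)) := dw_cvg k m.
rewrite divr_gt0 // => /(_ isT); apply: filter_app.
apply: filter_app (cvgr_ge _ (e_cvg k m) _ p2).
apply: filter_app (linear_growth (hv m) (@hVm m)).
apply: filterS2 (near_Wk_gt0 k) (nbhs_infty_ge N0) => N W0 NN0 [Npos hV] he hr i iW.
have V0 : 0 <= VmN m N by [].
have W0' : 0 < WkN k N by rewrite ltr0n.
have h12 : (1 / 2 : R) < 1 by rewrite ltr_pdivrMr // mul1r ltr1n.
rewrite distrC in hr; have {}hr := maxmin_close h12 hr.
set a := (\max_(i in _) _)%N in hr; set b := (\big[minn/_]_(i in _) _)%N in hr.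
have db : (b <= degw i m)%N by exact: bigminn_le_cond.
have dd : (degw i m <= delta i)%N.
  by rewrite subset_leq_card //; apply/fintype.subsetP => j; rewrite !inE => /andP[].
have hE : #|edges (G N) k (Vcls (G N) m)|%:R <= a%:R * WkN k N.
  rewrite -natrM ler_nat card_edges_w mulnC -sum_nat_const leq_sum // => i' i'W.
  apply: (@leq_trans (degw i' m)); last exact: leq_bigmax_cond.
  by rewrite subset_leq_card //; apply/fintype.subsetP => j; rewrite !inE andbC.
have hV0 : 0 < VmN m N.
  by apply: lt_le_trans hV; rewrite mulr_gt0 ?divr_gt0 // ltr0n.
have ha : p k m / 2 * VmN m N <= a%:R.
  rewrite ler_pdivlMr ?mulr_gt0 // in he.
  by rewrite -(ler_pM2r W0'); apply: le_trans hE; rewrite (mulrC (WkN k N)) mulrA in he.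
have : (B%:R : R) <= (delta i)%:R; last by rewrite ler_nat.
apply: (@le_trans _ _ b%:R); last by rewrite ler_nat (leq_trans db).
apply: (le_trans hN0); have NN0' : (N0%:R : R) <= N%:R by rewrite ler_nat.
have h1 : p k m / 2 * (v m / 2 * N%:R) <= p k m / 2 * VmN m N by rewrite ler_wpM2l // divr_ge0 // ltW.
have h2 : p k m / 2 * (v m / 2) / 2 * N0%:R <= p k m / 2 * (v m / 2) / 2 * N%:R.
  by rewrite ler_wpM2l // ltW.
lra.
Qed.

Lemma deg_large (B : nat) : \forall N \near \oo, forall i : 'I_(nW (G N)), (B <= delta i)%N.
Proof.
have : \forall N \near \oo, forall k i, i \in Wcls (G N) k -> (B <= delta i)%N.
  by apply: filter_forall => k; exact: deg_large_class.
apply: filterS => N h i.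
by apply: (h (wtype i)); rewrite inE.
Qed.

(** * Averages over dispatchers *)

Definition sampling_err N (i : 'I_(nW (G N))) : R := d%:R ^+ 2 / (delta i - d.-1)%:R.

Lemma near_deg : \forall N \near \oo, forall i : 'I_(nW (G N)), (d <= delta i)%N.
Proof. exact: deg_large. Qed.

Lemma sampling_err_unull : unull (fun N (i : 'I_(nW (G N))) => sampling_err i).
Proof.
move=> e e0; pose B := Num.bound (d%:R ^+ 2 / e : R).
apply: filterS (deg_large (B + d)) => N h i.
have de : 0 <= d%:R ^+ 2 / e :> R by rewrite divr_ge0 ?exprn_ge0 // ltW.
have hB : d%:R ^+ 2 / e < B%:R :> R by apply: archi_boundP.
have hi := h i; rewrite ger0_norm ?divr_ge0 ?exprn_ge0 //.
have B1 : B%:R <= (delta i - d.-1)%:R :> R by rewrite ler_nat; lia.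
have D0 : 0 < (delta i - d.-1)%:R :> R by rewrite ltr0n; lia.
rewrite ler_pdivrMr // mulrC -ler_pdivrMr //.
by apply: (le_trans (ltW hB)).
Qed.

(** Quantities that depend in a Lipschitz way on finitely many shares inherit
    the average estimate of [share_unull]. *)
Lemma avg_unull (I : nat -> Type) k (f : forall N, I N -> 'I_(nW (G N)) -> R)
    (h : forall N, 'I_(nW (G N)) -> R) (J : Type) (s : seq J) (C : R)
    (Us : J -> forall N, I N -> {set 'I_N}) : 0 <= C ->
  (\forall N \near \oo, forall (a : I N) i, `|f N a i| <=
     `|h N i| + C * \sum_(j <- s) `|share i (Us j N a) - mean_share k (Us j N a)|) ->
  unull h -> unull (fun N a => avg k (fun i => `|f N a i|)).
Proof.
move=> C0 fh hn.
have h1 : unull (fun N (a : I N) => \sum_(j <- s)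
    avg k (fun i : 'I_(nW (G N)) => `|share i (Us j N a) - mean_share k (Us j N a)|)).
  by apply: unull_sum => j _; exact: (unull_reindex (Us j) (share_unull k)).
have h2 : unull (fun N (a : I N) => avg k (fun i : 'I_(nW (G N)) => `|h N i|)).
  move=> e e0; apply: filterS (hn e e0) => N hN a.
  rewrite ger0_norm ?avg_ge0 //; apply: le_trans (@avg_cst_le N k _ (ltW e0)).
  by apply: le_avg => i _.
apply: unull_dom (unullD h2 (unullZ C h1)); apply: filterS fh => N fh a.
rewrite ger0_norm ?avg_ge0 // -avg_sum -avgZ -avgD; apply: le_avg => i _; exact: fh.
Qed.

(** Type k contributes a proportion w k * xi of N dispatchers. *)
Lemma class_average (I : nat -> Type) (f : forall N, I N -> 'I_(nW (G N)) -> R)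
    (t : forall N, I N -> 'I_K -> R) (C : R) :
  (forall N a k, `|t N a k| <= C) ->
  (forall k, unull (fun N a => avg k (fun i => `|f N a i - t N a k|))) ->
  unull (fun N a => N%:R^-1 * (\sum_i f N a i) - \sum_(k < K) w k * xi * t N a k).
Proof.
move=> tC fn.
have h k : unull (fun N (a : I N) =>
    WkN k N / N%:R * avg k (fun i => f N a i) - w k * xi * t N a k).
  have h1 : unull (fun N (a : I N) => avg k (fun i => f N a i) - t N a k).
    apply: unull_dom (fn k); apply: filterS (near_Wk_gt0 k) => N W0 a.
    have W1 : WkN k N != 0 by rewrite pnatr_eq0 -lt0n.
    have -> : avg k (fun i => f N a i) - t N a k = avg k (fun i => f N a i - t N a k).
      by rewrite /avg sumrB sumr_const mulrBr -[t N a k *+ _]mulr_natl mulKf.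
    rewrite /avg normrM ger0_norm ?invr_ge0 // ler_wpM2l ?invr_ge0 //.
    exact: ler_norm_sum.
  have h2 := unull_bddM (ubdd_cvg I (@Wk_cvg k)) h1.
  have h3 : unull (fun N (a : I N) => t N a k * (WkN k N / N%:R - w k * xi)).
    by apply: unull_bddM; [exact: (@ubdd_le _ _ _ C)|exact: unull_cvg (@Wk_cvg k)].
  by apply: unull_eq (unullD h2 h3); apply: nearW => N a; ring.
have := unull_sum (index_enum 'I_K) (P := predT) (fun k _ => h k); apply: unull_eq.
have W0 : \forall N \near \oo, forall k, (0 < #|Wcls (G N) k|)%N.
  by apply: filter_forall => k; exact: near_Wk_gt0.
apply: filterS W0 => N W0 a; rewrite sumrB; congr (_ - _).
rewrite sum_by_wtype mulr_sumr; apply: eq_bigr => k _.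
by rewrite /avg mulrA [_ / N%:R * _]mulrAC divff ?mul1r // pnatr_eq0 -lt0n.
Qed.

Lemma all_in_dist N (i : 'I_(nW (G N))) (U : {set 'I_N}) : (d <= delta i)%N ->
  `|all_in d i U - share i U ^+ d| <= sampling_err i :> R.
Proof.
move=> hi; rewrite /all_in /share finset.setIC; apply: bin_ratio => //.
by rewrite subset_leq_card // finset.subsetIl.
Qed.

Lemma rho_arr_unull : unull (fun N (U : {set 'I_N}) =>
  N%:R^-1 * rho_arr (G N) d lam U - lam * xi * (\sum_(k < K) w k * mean_share k U ^+ d)).
Proof.
have h : unull (fun N (U : {set 'I_N}) => N%:R^-1 * (\sum_(i < nW (G N)) all_in d i U)
   - \sum_(k < K) w k * xi * mean_share k U ^+ d).
  apply: (class_average (C := 1) (t := fun N U k => mean_share k U ^+ d)) => [N U k|k].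
    have /andP[a0 a1] := mean_share_unit k U.
    by rewrite ger0_norm ?exprn_ge0 // exprn_ile1.
  apply: (@avg_unull _ k _ (@sampling_err) unit [:: tt] d%:R (fun _ N U => U)) => //.
    apply: filterS near_deg => N hN U i; rewrite big_seq1.
    have := all_in_dist U (hN i); have := expr_lip d (@share_unit R _ _ _ _ i U) (mean_share_unit k U).
    have := ler_norm (sampling_err i).
    have := ler_normD (all_in d i U - share i U ^+ d) (share i U ^+ d - mean_share k U ^+ d).
    by rewrite addrA subrK; lra.
  exact: sampling_err_unull.
apply: unull_eq (unullZ lam h); apply: filterS near_deg => N hN U.
rewrite mulrBr; congr (_ - _).
  rewrite mulrCA; congr (_ * _); rewrite mulr_sumr; apply: eq_bigr => i _.
  by rewrite hN.
by rewrite !mulr_sumr; apply: eq_bigr => k _; ring.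
Qed.

Definition occ N (x : state N) : 'I_M -> nat -> R := occupancy (G N) x.

Lemma occE N (x : state N) m l : occ x m l = prof (G N) (lev x l) m.
Proof.
rewrite /occ /occupancy /prof; congr (_%:R / _).
by apply: eq_card => j; rewrite !inE andbC.
Qed.

Lemma qt_occ N (x : state N) k l : qt (occ x) k l = mean_share k (lev x l).
Proof. by apply: eq_bigr => m _; rewrite occE. Qed.

Lemma occ_unit N (x : state N) : unit_valued (occ x).
Proof. by move=> m l; rewrite occE; exact: prof_unit. Qed.

Lemma occ_nonincr N (x : state N) : nonincr (occ x).
Proof.
move=> m l; rewrite /occ /occupancy ler_wpM2r ?invr_ge0 // ler_nat subset_leq_card //.
by apply/fintype.subsetP => j; rewrite !inE => /andP[-> /ltnW].
Qed.

(** The limit of [assign_class]: the proportion of class m among the servers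
    with queue length l near a dispatcher of type k, times the probability that
    the shortest sampled queue has length l; the divided difference absorbs the
    denominator of the proportion. *)
Definition hit N (x : state N) k m l : R :=
  v m * p k m / dk v p k * (occ x m l - occ x m l.+1)
  * divdiff d (qt (occ x) k l) (qt (occ x) k l.+1).

Lemma mean_share_part N k (U : {set 'I_N}) m :
  mean_share k (U :&: Vcls (G N) m) = v m * p k m / dk v p k * prof (G N) U m.
Proof.
rewrite /mean_share (bigD1 m) //= big1 ?addr0 => [|m' mm'].
  by rewrite /prof -finset.setIA finset.setIid.
rewrite /prof (_ : U :&: _ :&: _ = finset.set0)%SET ?cards0 ?mul0r ?mulr0 //.
apply/setP => j; rewrite !inE; apply/negbTE/negP => /andP[/andP[_ /eqP e] /eqP e'].
by rewrite -e -e' eqxx in mm'.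
Qed.

(** By [assign_classE] the assignment probability depends on the neighbourhood
    only through the shares of four sets: two levels and their parts in class
    m. The same expression in the asymptotic shares is [hit], and the
    expression is Lipschitz in the shares. *)
Lemma assign_class_dist N (x : state N) (i : 'I_(nW (G N))) k m l : (d <= delta i)%N ->
  `|assign_class d x i m l - hit x k m l| <= `|2 * sampling_err i| +
  (d%:R + d%:R ^+ 2) * \sum_(U <- [:: lev x l; lev x l.+1; lev x l :&: Vcls (G N) m;
     lev x l.+1 :&: Vcls (G N) m]%SET) `|share i U - mean_share k U|.
Proof.
move=> hi; rewrite !big_cons big_nil addr0.
set A := lev x l; set B := lev x l.+1; set Am := (A :&: _)%SET; set Bm := (B :&: _)%SET.
have BA : B \subset A by apply/fintype.subsetP => j; rewrite !inE => /ltnW.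
have D0 : 0 < #|nbr i|%:R :> R by rewrite ltr0n (leq_trans hd).
have e1 := assign_classE (R := R) hd x m l hi.
have nE (U : {set 'I_N}) : #|U :&: nbr i|%:R = share i U * #|nbr i|%:R :> R.
  by rewrite /share divfK ?gt_eqF // finset.setIC.
rewrite /nlev /nlevm !nE -/A -/B -/Am -/Bm in e1.
have {}e1 : assign_class d x i m l * (share i A - share i B) =
    (share i Am - share i Bm) * (all_in d i A - all_in d i B) :> R.
  by apply: (mulIf (lt0r_neq0 D0)); rewrite -mulrA [(_ - _) * #|_|%:R]mulrBl e1; ring.
have sAm : 0 <= (share i Am - share i Bm : R) <= share i A - share i B.
  rewrite subr_ge0 -!mulrBl ler_pM2r ?invr_gt0 //.
  rewrite /share ler_pM2r ?invr_gt0 // ler_nat; apply/andP; split.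
    by rewrite subset_leq_card // finset.setIS // finset.setSI.
  have c1 (U : {set 'I_N}) : #|nbr i :&: U|%:R = #|nbr i :&: (U :&: Vcls (G N) m)|%:R
      + #|nbr i :&: (U :\: Vcls (G N) m)|%:R :> R.
    rewrite -natrD -(cardsID (Vcls (G N) m) (nbr i :&: U)); congr (_ + _)%:R.
      by congr #|pred_of_set _|; rewrite finset.setIA.
    by congr #|pred_of_set _|; rewrite finset.setIDA.
  have c2 : #|nbr i :&: (B :\: Vcls (G N) m)|%:R <= #|nbr i :&: (A :\: Vcls (G N) m)|%:R :> R.
    by rewrite ler_nat subset_leq_card // finset.setIS // finset.setSD.
  by rewrite (c1 A) (c1 B) -/Am -/Bm; lra.
have gA := all_in_dist A hi; have gB := all_in_dist B hi.
have E0 : 0 <= sampling_err i := le_trans (normr_ge0 _) gA.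
(* P is [hit] with the actual shares of dispatcher i, for sampling with
   replacement. *)
pose P : R := (share i Am - share i Bm) * divdiff d (share i A) (share i B).
have hP : `|assign_class d x i m l - P| <= 2 * sampling_err i.
  (* If no neighbour has queue length l, both sides vanish. *)
  have [s0|s0] := eqVneq (share i A : R) (share i B).
    have m0 : share i Am - share i Bm = 0 :> R by rewrite s0 in sAm; lra.
    have -> : P = 0 by rewrite /P m0 mul0r.
    suff -> : assign_class d x i m l = 0 :> R by rewrite subrr normr0; lra.
    apply: big1 => j /andP[jV /eqP xj]; apply: assign_out; apply/negP => jn.
    have : (#|nbr i :&: B| < #|nbr i :&: A|)%N.
      apply: proper_card; apply/properP; split; first by rewrite finset.setIS.
      by exists j; rewrite !inE -?xj ?leqnn ?ltnn ?andbT ?andbF // inE in jn *.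
    move: s0; rewrite /share => /(divIf (lt0r_neq0 D0))/eqP.
    by rewrite eqr_nat => /eqP ->; rewrite ltnn.
  have s1 : 0 < (share i A - share i B : R) by rewrite lt_def subr_eq0 s0 /=; lra.
  pose r : R := (share i Am - share i Bm) / (share i A - share i B).
  have r01 : 0 <= r <= 1.
    have /andP[? ?] := sAm.
    by rewrite /r divr_ge0 ?(ltW s1) //= ler_pdivrMr // mul1r.
  have -> : assign_class d x i m l = r * (all_in d i A - all_in d i B).
    by apply: (mulIf (lt0r_neq0 s1)); rewrite e1 /r mulrAC divfK // gt_eqF.
  have -> : P = r * (share i A ^+ d - share i B ^+ d).
    by rewrite -divdiffE mulrA /r divfK // gt_eqF.
  rewrite -mulrBr normrM; have /andP[r0 r1] := r01; rewrite ger0_norm //.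
  rewrite -[leRHS]mul1r ler_pM //.
  have -> : all_in d i A - all_in d i B - (share i A ^+ d - share i B ^+ d) =
    (all_in d i A - share i A ^+ d) - (all_in d i B - share i B ^+ d) :> R by ring.
  by rewrite (le_trans (ler_normB _ _)) // mulr_natl mulr2n lerD.
have hitE : hit x k m l = (mean_share k Am - mean_share k Bm) * divdiff d (mean_share k A) (mean_share k B).
  by rewrite /hit !qt_occ !mean_share_part !occE; ring.
have hQ : `|P - hit x k m l| <= (d%:R + d%:R ^+ 2) *
    (`|share i A - mean_share k A| + (`|share i B - mean_share k B| +
    (`|share i Am - mean_share k Am| + `|share i Bm - mean_share k Bm|))).
  rewrite hitE /P.
  have u1 U := @share_unit R _ _ _ (G N) i U; have u2 U := @mean_share_unit N k U.
  have -> : (share i Am - share i Bm) * divdiff d (share i A) (share i B) -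
    (mean_share k Am - mean_share k Bm) * divdiff d (mean_share k A) (mean_share k B) =
    ((share i Am - mean_share k Am) - (share i Bm - mean_share k Bm)) * divdiff d (share i A) (share i B)
    + (mean_share k Am - mean_share k Bm) * (divdiff d (share i A) (share i B) - divdiff d (mean_share k A) (mean_share k B)).
    by ring.
  have b1 : `|divdiff d (share i A) (share i B)| <= d%:R :> R.
    by rewrite ger0_norm ?divdiff_le ?divdiff_ge0 //; [case/andP: (u1 A)|case/andP: (u1 B)].
  have b2 : `|mean_share k Am - mean_share k Bm| <= 1.
    by have /andP[? ?] := u2 Am; have /andP[? ?] := u2 Bm; rewrite ler_norml; lra.
  have b3 := divdiff_lip d (u1 A) (u1 B) (u2 A) (u2 B).
  apply: le_trans (ler_normD _ _) _; rewrite !normrM.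
  have b4 := ler_normB (share i Am - mean_share k Am) (share i Bm - mean_share k Bm).
  apply: (@le_trans _ _ ((`|share i Am - mean_share k Am| + `|share i Bm - mean_share k Bm|) * d%:R
     + 1 * (d%:R ^+ 2 * (`|share i A - mean_share k A| + `|share i B - mean_share k B|)))).
    by rewrite lerD // ler_pM.
  set a := `|share i A - _|; set b := `|share i B - _|.
  set a' := `|share i Am - _|; set b' := `|share i Bm - _|.
  rewrite -subr_ge0 (_ : _ - _ = d%:R * (a + b) + d%:R ^+ 2 * (a' + b')); last by ring.
  by rewrite addr_ge0 ?mulr_ge0 ?exprn_ge0 ?addr_ge0 ?normr_ge0.
apply: le_trans (ler_distD P _ _) _; rewrite lerD //.
by rewrite (le_trans hP) // ler_norm.
Qed.

Lemma occ_sum N (x : state N) m l :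
  occ x m l = (VmN m N)^-1 * \sum_(j in Vcls (G N) m) (l <= x j)%:R.
Proof.
rewrite /occ /occupancy mulrC -natr_sum; congr (_ * _%:R).
rewrite -sum1_card big_mkcond [RHS]big_mkcond; apply: eq_bigr => j _.
by rewrite !inE; case: (_ == m); case: (l <= x j)%N.
Qed.

Lemma occ_diff N (x y : state N) j m l (c : R) :
  (forall j', j' != j -> y j' = x j') -> (l <= y j)%:R - (l <= x j)%:R = c ->
  occ y m l - occ x m l = (VmN m N)^-1 * ((vtype (G N) j == m)%:R * c).
Proof.
move=> yx <-; rewrite !occ_sum -mulrBr -sumrB; congr (_ * _).
have [jm|jm] := boolP (vtype (G N) j == m).
  rewrite (bigD1 j) ?inE //= big1 ?addr0 ?mul1r // => j' /andP[_ jj'].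
  by rewrite yx ?subrr.
rewrite mul0r big1 // => j'; rewrite inE => jm'; rewrite yx ?subrr //.
by apply: contraNneq jm => <-.
Qed.

Lemma occ_incr N (x : state N) j m l : occ (incr x j) m l.+1 - occ x m l.+1 =
  (VmN m N)^-1 * ((vtype (G N) j == m)%:R * (x j == l)%:R).
Proof.
apply: occ_diff => [j' jj'|]; first by rewrite ffunE (negbTE jj').
rewrite ffunE eqxx ltnS; case: (ltngtP l (x j)) => _; rewrite ?subrr ?subr0 //.
Qed.

Lemma occ_decr N (x : state N) j m l : occ (decr x j) m l.+1 - occ x m l.+1 =
  - ((VmN m N)^-1 * ((vtype (G N) j == m)%:R * (x j == l.+1)%:R)).
Proof.
rewrite (@occ_diff _ x (decr x j) j m l.+1 (- (x j == l.+1)%:R)) ?mulrN // => [j' jj'|].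
  by rewrite ffunE (negbTE jj').
rewrite ffunE eqxx; case: (x j) => [|n] /=; first by rewrite subrr oppr0.
rewrite ltnS eqSS; case: (ltngtP l n) => _; rewrite ?subrr ?oppr0 ?sub0r //.
Qed.

Lemma occ_jump N (x y : state N) j m l : (forall j', j' != j -> y j' = x j') ->
  `|occ y m l - occ x m l| <= (VmN m N)^-1.
Proof.
move=> yx; rewrite (occ_diff m yx (erefl _)) normrM ger0_norm ?invr_ge0 //.
rewrite -[leRHS]mulr1 ler_wpM2l ?invr_ge0 //.
by case: (_ == m); case: (l <= y j)%N; case: (l <= x j)%N;
  rewrite /= ?(mul0r, mul1r, subrr, subr0, sub0r, normrN, normr0, normr1).
Qed.

Local Notation genN N := (gen (G N) d lam u).

Lemma gen_occ N (x : state N) m l : genN N (fun x => occ x m l.+1) x =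
  lam * ((VmN m N)^-1 * \sum_(i < nW (G N)) assign_class d x i m l)
  - u m * (occ x m l.+1 - occ x m l.+2).
Proof.
rewrite /gen big_split /=; congr (_ + _).
  rewrite mulrA mulr_sumr.
  under eq_bigr do rewrite occ_incr.
  transitivity (\sum_j \sum_(i < nW (G N)) lam * (VmN m N)^-1 *
    (if (j \in Vcls (G N) m) && (x j == l) then assign d x i j else 0)).
    apply: eq_bigr => j _; rewrite /arrival_rate mulr_suml; apply: eq_bigr => i _.
    rewrite inE; case: (_ == m); case: (x j == l); rewrite /= ?(mul0r, mulr0, mulr1) //.
    by rewrite mulrAC.
  rewrite exchange_big; apply: eq_bigr => i _; rewrite -mulr_sumr; congr (_ * _).
  by rewrite -big_mkcond.
under eq_bigr do rewrite occ_decr mulrN.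
rewrite sumrN; congr (- _).
rewrite /occ /occupancy -mulrBl.
have -> : #|[set j in Vcls (G N) m | (l < x j)%N]%SET|%:R -
    #|[set j in Vcls (G N) m | (l.+1 < x j)%N]%SET|%:R =
    #|[set j in Vcls (G N) m | x j == l.+1]%SET|%:R :> R.
  rewrite lev_step; congr (_%:R - _%:R); apply: eq_card => j; by rewrite !inE andbC.
rewrite -[#|[set j in _ | x j == _]%SET|]sum1_card natr_sum mulr_suml mulr_sumr.
rewrite [RHS]big_mkcond; apply: eq_bigr => j _.
rewrite /service_rate !inE; case: eqP => [->|_] /=; last by rewrite mul0r !mulr0.
by case: eqP => [->|_] /=; rewrite ?mulr0 // ?mul1r ?mulr1 // mulrC.
Qed.

(** The service terms of both sides are the same. The arrival term is an average
    over the dispatchers of assignment probabilities, whose limits [hit] add up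
    to the intake. *)
Lemma drift_unull m l : unull (fun N (x : state N) =>
  genN N (fun x => occ x m l.+1) x - ode_rhs d lam xi u v w p (occ x) m l.+1).
Proof.
have hit_bd N (x : state N) k : `|hit x k m l| <= d%:R.
  have qu := qt_unit hv hp hdk (occ_unit x).
  have /andP[s0 s1] : 0 <= v m * p k m / dk v p k <= 1.
    by rewrite (share_ge0 hv hp hdk) (share_le1 hv hp hdk).
  have /andP[? ?] := occ_unit x m l; have /andP[? ?] := occ_unit x m l.+1.
  have dm := occ_nonincr x m l.
  have [q1 q2] := (qu k l, qu k l.+1).
  have D0 : 0 <= divdiff d (qt (occ x) k l) (qt (occ x) k l.+1).
    by apply: divdiff_ge0; [case/andP: q1|case/andP: q2].
  have DI := divdiff_le d q1 q2.
  rewrite /hit; move: (v m * p k m / dk v p k) s0 s1 => s s0 s1.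
  rewrite ger0_norm ?mulr_ge0 ?subr_ge0 //.
  rewrite -[leRHS]mul1r ler_pM ?mulr_ge0 ?subr_ge0 //.
  by apply: mulr_ile1; rewrite ?subr_ge0 //; lra.
have h1 : unull (fun N (x : state N) => N%:R^-1 * (\sum_(i < nW (G N)) assign_class d x i m l)
    - \sum_(k < K) w k * xi * hit x k m l).
  apply: (class_average (C := d%:R) (t := fun N x k => hit x k m l)) => [//|k].
  pose Us (b : bool * bool) N (x : state N) : {set 'I_N} :=
    let U := lev x (if b.1 then l else l.+1) in
    if b.2 then U else (U :&: Vcls (G N) m)%SET.
  apply: (@avg_unull _ k _ (fun N i => 2 * sampling_err i) (bool * bool)%type
    [:: (true, true); (false, true); (true, false); (false, false)]
    (d%:R + d%:R ^+ 2) Us).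
  - by rewrite addr_ge0 ?exprn_ge0.
  - apply: filterS near_deg => N hN x i; apply: le_trans (assign_class_dist x k m l (hN i)) _.
    by rewrite !big_cons !big_nil.
  - exact: (unullZ 2 sampling_err_unull).
have h2 : unull (fun N (x : state N) => (N%:R^-1 * (\sum_(i < nW (G N)) assign_class d x i m l)) *
    (N%:R / VmN m N) - (\sum_(k < K) w k * xi * hit x k m l) * (v m)^-1).
  apply: unull_mul => //.
  - exact: ubdd_cvg (@NVm_cvg m).
  - apply: (@ubdd_le _ _ _ (\sum_(k < K) w k * xi * d%:R)) => N x.
    apply: le_trans (ler_norm_sum _ _ _) _; apply: ler_sum => k _.
    by rewrite normrM ger0_norm ?mulr_ge0 ?(ltW (hw k)) ?(ltW hxi) // ler_wpM2l ?mulr_ge0 ?(ltW (hw k)) ?(ltW hxi).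
  - exact: unull_cvg (@NVm_cvg m).
apply: unull_eq (unullZ lam h2).
apply: filterS2 (near_Vm_gt0 m) (nbhs_infty_gt 0) => N V0 N0 x.
have N1 : N%:R != 0 :> R by rewrite pnatr_eq0 -lt0n.
have V1 : VmN m N != 0 by rewrite pnatr_eq0 -lt0n.
have eA (S : R) : lam * (N%:R^-1 * S * (N%:R / VmN m N)) = lam * ((VmN m N)^-1 * S).
  by field; rewrite V1 N1.
have eB : lam * ((\sum_(k < K) w k * xi * hit x k m l) * (v m)^-1) =
    lam * xi * (occ x m l - occ x m l.+1) * intake d v w p (occ x) m l.+1.
  rewrite /intake mulr_suml !mulr_sumr; apply: eq_bigr => k _; rewrite /hit /=.
  have v1 : v m != 0 by rewrite gt_eqF.
  have d1 : dk v p k != 0 by rewrite gt_eqF.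
  by field; rewrite v1 d1.
by rewrite gen_occ rhsE /= [RHS]mulrBr eA eB; ring.
Qed.

(** * The subcritical regime in the limit *)

Lemma exists_subset_card (T : finType) (A : {set T}) n : (n <= #|A|)%N ->
  exists B : {set T}, (B \subset A) && (#|B| == n).
Proof.
rewrite -bin_gt0 -cards_draws => /card_gt0P[B]; rewrite inE => h; by exists B.
Qed.

Lemma Vinv_cvg m : (VmN m N)^-1 @[N --> \oo] --> (0 : R).
Proof.
have h : N%:R / VmN m N * N%:R^-1 @[N --> \oo] --> (v m)^-1 * 0.
  by apply: cvgM; [exact: NVm_cvg|exact: inv_nat_cvg].
rewrite mulr0 in h; apply: cvg_trans h; apply: near_eq_cvg.
apply: filterS (nbhs_infty_gt 0) => N N0.
by rewrite mulrAC divff ?mul1r // pnatr_eq0 -lt0n.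
Qed.

(** Any floor (a m * |V_m|) servers of each type m will do: the rounding error of the
    proportion is at most 1 / |V_m|. *)
Lemma exists_profile (a : 'I_M -> R) : (forall m, 0 <= a m <= 1) ->
  exists U : forall N, {set 'I_N}, forall m,
    prof (G N) (U N) m @[N --> \oo] --> a m.
Proof.
move=> a01; pose c N m := Num.truncn (a m * VmN m N).
have aV N m : 0 <= a m * VmN m N by have /andP[? _] := a01 m; rewrite mulr_ge0.
have cV N m : (c N m <= #|Vcls (G N) m|)%N.
  rewrite -(ler_nat R); have /andP[c0 _] := truncn_itv (aV N m).
  rewrite (le_trans c0) // -[leRHS]mul1r ler_wpM2r //.
  by have /andP[_ ?] := a01 m.
pose B N m : {set 'I_N} :=
  odflt finset.set0 [pick B : {set 'I_N} | (B \subset Vcls (G N) m) && (#|B| == c N m)].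
have BP N m : B N m \subset Vcls (G N) m /\ #|B N m| = c N m.
  rewrite /B; case: pickP => [A /andP[? /eqP ?] //|hn].
  by have [A hA] := exists_subset_card (cV N m); rewrite hn in hA.
exists (fun N => [set j | j \in B N (vtype (G N) j)]%SET) => m.
set U := fun N => [set j | j \in B N (vtype (G N) j)]%SET.
have UB N : (U N :&: Vcls (G N) m)%SET = B N m.
  apply/setP => j; rewrite !inE; apply/andP/idP => [[h /eqP <-//]|h].
  have [/fintype.subsetP /(_ _ h)] := BP N m; rewrite inE => /eqP vj _.
  by rewrite vj.
apply/cvgrPdist_le => e e0.
have /cvgrPdist_le/(_ e e0) := @Vinv_cvg m.
apply: filter_app; apply: filterS (near_Vm_gt0 m) => N V0.
rewrite sub0r normrN ger0_norm ?invr_ge0 // => he; apply: le_trans he.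
rewrite /prof UB; have [_ ->] := BP N m.
have V0' : 0 < VmN m N by rewrite ltr0n.
have /andP[c0 c1] := truncn_itv (aV N m).
rewrite -[a m](mulfK (lt0r_neq0 V0')) -mulrBl normrM [`|_^-1|]ger0_norm ?invr_ge0 //.
rewrite -[leRHS]mul1r ler_wpM2r ?invr_ge0 // ger0_norm ?subr_ge0 //.
by rewrite lerBlDl -natr1 in c1 *; exact: ltW.
Qed.

Lemma rho_arr_le N (U : {set 'I_N}) :
  rho_arr (G N) d lam U <= rhoN (G N) d lam u * \sum_(m < M) u m * #|U :&: Vcls (G N) m|%:R.
Proof.
have [->|U0] := eqVneq U finset.set0.
  rewrite /rho_arr !big1 ?mulr0 // => [m _|i _]; first by rewrite finset.set0I cards0 mulr0.
  by rewrite finset.set0I cards0; case: ifP => _; rewrite ?bin0n ?gtn_eqF // mul0r mulr0.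
have S0 : 0 < \sum_(m < M) u m * #|U :&: Vcls (G N) m|%:R.
  case/finset.set0Pn: U0 => j jU; rewrite (bigD1 (vtype (G N) j)) //= ltr_pwDl //.
    rewrite mulr_gt0 // ltr0n; apply/card_gt0P; exists j.
    by rewrite !inE jU eqxx.
  by apply: sumr_ge0 => m _; rewrite mulr_ge0 // ltW.
rewrite -ler_pdivrMr // mulrC.
exact: (le_bigmax_cond _ (fun U : {set 'I_N} => (\sum_(m < M) u m * #|U :&: Vcls (G N) m|%:R)^-1 *
  rho_arr (G N) d lam U)).
Qed.

Variable rho : R.
Hypothesis hrho : rhoN (G N) d lam u @[N --> \oo] --> rho.

(** The maximum that defines rho^N is bounded below by its value at sets of
    servers whose proportions of the types tend to a. *)
Lemma subcritical_limit (a : 'I_M -> R) : (forall m, 0 <= a m <= 1) ->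
  lam * xi * (\sum_(k < K) w k * (\sum_(m < M) v m * p k m / dk v p k * a m) ^+ d)
  <= rho * \sum_(m < M) u m * v m * a m.
Proof.
move=> a01; have [U hU] := exists_profile a01.
have lhs : N%:R^-1 * rho_arr (G N) d lam (U N) @[N --> \oo] -->
    lam * xi * (\sum_(k < K) w k * (\sum_(m < M) v m * p k m / dk v p k * a m) ^+ d).
  have h1 := cvg_unull U rho_arr_unull.
  have h2 : lam * xi * (\sum_(k < K) w k * mean_share k (U N) ^+ d) @[N --> \oo] -->
    lam * xi * (\sum_(k < K) w k * (\sum_(m < M) v m * p k m / dk v p k * a m) ^+ d).
    apply: cvgM; first exact: cvg_cst.
    apply: cvg_sumr => k _; apply: cvgM; first exact: cvg_cst.
    apply: cvg_powr; apply: cvg_sumr => m _; apply: cvgM; first exact: cvg_cst.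
    exact: hU.
  have -> : (fun N => N%:R^-1 * rho_arr (G N) d lam (U N)) = (fun N =>
      (N%:R^-1 * rho_arr (G N) d lam (U N) - lam * xi * (\sum_(k < K) w k * mean_share k (U N) ^+ d))
      + lam * xi * (\sum_(k < K) w k * mean_share k (U N) ^+ d)).
    by apply/funext => N; rewrite subrK.
  by rewrite -[X in _ --> X]add0r; exact: cvgD.
have rhs : rhoN (G N) d lam u * (\sum_(m < M) u m * (VmN m N / N%:R) * prof (G N) (U N) m)
    @[N --> \oo] --> rho * \sum_(m < M) u m * v m * a m.
  apply: cvgM => //; apply: cvg_sumr => m _; apply: cvgM; last exact: hU.
  by apply: cvgM; [exact: cvg_cst|exact: hVm].
apply: (ler_cvg_to lhs rhs); apply: nearW => N.
apply: le_trans (_ : _ <= (rhoN (G N) d lam u *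
   \sum_(m < M) u m * #|U N :&: Vcls (G N) m|%:R) / N%:R) _.
  by rewrite mulrC ler_wpM2r ?invr_ge0 // rho_arr_le.
rewrite -mulrA mulr_suml; rewrite le_eqVlt; apply/orP; left; apply/eqP.
by congr (_ * _); apply: eq_bigr => m _; rewrite card_prof; ring.
Qed.

(** * Stationary laws *)

Variable pi : forall N, probability (state N) R.
Hypothesis hpi : \forall N \near \oo, stationary (Qmatrix (G N) d lam u) (pi N).

Local Notation EX N := (Ex (pi N)).

(** The properties of the N-th system that hold for all large N. *)
Definition regular N := [/\ stationary (Qmatrix (G N) d lam u) (pi N),
  forall i : 'I_(nW (G N)), (d <= delta i)%N, (0 < N)%N
  & forall m, (0 < #|Vcls (G N) m|)%N].

Lemma near_regular : \forall N \near \oo, regular N.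
Proof.
have V0 : \forall N \near \oo, forall m, (0 < #|Vcls (G N) m|)%N.
  by apply: filter_forall => m; exact: near_Vm_gt0.
by apply: filter_app hpi; apply: filterS3 near_deg (nbhs_infty_gt 0) V0 => N; split.
Qed.

Definition cap N (L : nat) (x : state N) : state N := [ffun j => minn (x j) L].

(** A function that does not see queue lengths beyond L has finitely many
    values. *)
Lemma stationary_cap N L (f : state N -> R) : regular N ->
  (forall x, f (cap L x) = f x) -> EX N (genN N f) = 0.
Proof.
move=> [st hdeg _ _] fL.
pose h (x : state N) : {ffun 'I_N -> 'I_L.+1} := [ffun j => inord (minn (x j) L)].
pose F (t : {ffun 'I_N -> 'I_L.+1}) : R := f [ffun j => val (t j)].
have <- : F \o h = f.
  apply/funext => x; rewrite /F /= -[RHS]fL; congr f; apply/ffunP => j.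
  by rewrite !ffunE inordK // ltnS geq_minr.
exact: (stationary_gen (ltW hlam) (fun m => ltW (hu m)) hd hdeg st).
Qed.

Lemma occ_cap N L (x : state N) m l : (l <= L)%N -> occ (cap L x) m l = occ x m l.
Proof.
move=> lL; rewrite /occ /occupancy; congr (_%:R / _); apply: eq_card => j.
by rewrite !inE ffunE leq_min lL andbT.
Qed.

Lemma bounded_occ N m l : bounded (fun x : state N => occ x m l).
Proof. by exists 1 => x; have /andP[? ?] := occ_unit x m l; rewrite ger0_norm. Qed.

Lemma bounded_genN N (f : state N -> R) : regular N -> bounded f -> bounded (genN N f).
Proof.
by move=> [_ hdeg _ _]; exact: (gen_bounded (ltW hlam) (fun m => ltW (hu m)) hd hdeg).
Qed.

Lemma stationary_occ N m l : regular N -> EX N (genN N (fun x => occ x m l)) = 0.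
Proof. by move=> rN; apply: (@stationary_cap N l) => // x; rewrite occ_cap. Qed.

(** * Mass balance between consecutive levels *)

Lemma sum_assign_class N (x : state N) (i : 'I_(nW (G N))) l : (d <= delta i)%N ->
  \sum_(m < M) assign_class d x i m l = all_in d i (lev x l) - all_in d i (lev x l.+1) :> R.
Proof.
move=> hi; rewrite -!(sum_assign_lev hd x _ hi).
transitivity (\sum_(j | x j == l) assign d x i j : R).
  rewrite (partition_big (vtype (G N)) predT) //=; apply: eq_bigr => m _.
  by apply: eq_bigl => j; rewrite !inE andbC.
rewrite [X in X - _](bigID (mem (lev x l.+1))) /=.
rewrite [X in X + _ - _](_ : _ = \sum_(j in lev x l.+1) assign d x i j); last first.
  by apply: eq_bigl => j; rewrite !inE andbC; case: ltnP => //= /ltnW ->.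
rewrite addrAC subrr add0r; apply: eq_bigl => j.
by rewrite !inE -leqNgt -eqn_leq eq_sym.
Qed.

(** The total service rate of the servers with at least l tasks. *)
Definition load N (x : state N) l : R := \sum_(m < M) u m * VmN m N * occ x m l.

Lemma loadE N (x : state N) l :
  load x l = \sum_(m < M) u m * #|lev x l :&: Vcls (G N) m|%:R.
Proof. by apply: eq_bigr => m _; rewrite card_prof occE; ring. Qed.

(** Tasks that join a queue of length l have their sample in level l but not
    in level l + 1, so that the arrival term is a difference of consecutive values
    of rho_arr. *)
Lemma gen_level_balance N (x : state N) l : regular N ->
  \sum_(m < M) VmN m N * genN N (fun x => occ x m l.+1) x =
  rho_arr (G N) d lam (lev x l) - rho_arr (G N) d lam (lev x l.+1)
  - (load x l.+1 - load x l.+2).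
Proof.
move=> [_ hdeg _ V0].
have rE l' : rho_arr (G N) d lam (lev x l') = \sum_(i < nW (G N)) lam * all_in d i (lev x l').
  by apply: eq_bigr => i _; rewrite hdeg.
rewrite !rE /load -!sumrB.
transitivity (\sum_(m < M) (lam * (\sum_(i < nW (G N)) assign_class d x i m l)
   - (u m * VmN m N * occ x m l.+1 - u m * VmN m N * occ x m l.+2))).
  apply: eq_bigr => m _; rewrite gen_occ.
  have V1 : VmN m N != 0 by rewrite pnatr_eq0 -lt0n.
  by rewrite mulrBr mulrCA mulVKf //; ring.
rewrite [LHS]sumrB; congr (_ - _); rewrite -mulr_sumr exchange_big mulr_sumr.
by apply: eq_bigr => i _; rewrite sum_assign_class // mulrBr.
Qed.

Lemma bounded_load N l : bounded (fun x : state N => load x l).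
Proof. by apply: bounded_sum => m _; apply: boundedZ; exact: bounded_occ. Qed.

Lemma rho_arr_ge0 N (U : {set 'I_N}) : 0 <= rho_arr (G N) d lam U.
Proof.
by apply: sumr_ge0 => i _; case: ifP => _; rewrite mulr_ge0 ?divr_ge0 // ltW.
Qed.

Lemma rho_arr_lev_le N (x : state N) l :
  rho_arr (G N) d lam (lev x l) <= rhoN (G N) d lam u * load x l.
Proof. by rewrite loadE; exact: rho_arr_le. Qed.

Lemma load_ge0 N (x : state N) l : 0 <= load x l.
Proof.
apply: sumr_ge0 => m _; have /andP[? _] := occ_unit x m l.
by rewrite !mulr_ge0 ?(ltW (hu m)).
Qed.

Lemma occ_ge0 N (x : state N) m l : 0 <= occ x m l.
Proof. by have /andP[] := occ_unit x m l. Qed.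

Lemma occ_le1 N (x : state N) m l : occ x m l <= 1.
Proof. by have /andP[] := occ_unit x m l. Qed.

Lemma load_le N (x : state N) l : load x l <= \sum_(m < M) u m * VmN m N.
Proof.
by apply: ler_sum => m _; rewrite -[leRHS]mulr1 ler_wpM2l ?occ_le1 ?mulr_ge0 ?(ltW (hu m)).
Qed.

Lemma rhoN_ge0 N : 0 <= rhoN (G N) d lam u.
Proof. exact: bigmax_ge_id. Qed.

Lemma bounded_rho_arr N l : bounded (fun x : state N => rho_arr (G N) d lam (lev x l)).
Proof.
exists (rhoN (G N) d lam u * \sum_(m < M) u m * VmN m N) => x.
rewrite ger0_norm ?rho_arr_ge0 // (le_trans (rho_arr_lev_le x l)) //.
by rewrite ler_wpM2l ?rhoN_ge0 ?load_le.
Qed.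

Lemma occ_eventually0 N (x : state N) m :
  \forall l \near \oo, occ x m l = 0.
Proof.
apply: filterS (nbhs_infty_gt (\max_j x j)) => l hl.
rewrite /occ /occupancy (_ : [set j in _ | _]%SET = finset.set0) ?cards0 ?mul0r //.
apply/setP => j; rewrite !inE; apply/negbTE; rewrite negb_and -ltnNge.
by rewrite (leq_ltn_trans _ hl) ?orbT // leq_bigmax.
Qed.

Lemma Eload_cvg0 N : EX N (fun x => load x l) @[l --> \oo] --> (0 : R).
Proof.
rewrite -(Ex_cst (pi N) 0).
apply: (@Ex_dominated _ _ (pi N) (fun l x => load x l) (fun=> 0) (\sum_(m < M) u m * VmN m N)).
  by move=> l x; rewrite ger0_norm ?load_ge0 ?load_le.
move=> x; apply: cvg_near_cst.
have : \forall l \near \oo, forall m, occ x m l = 0.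
  by apply: filter_forall => m; exact: occ_eventually0.
by apply: filterS => l hl; rewrite /load big1 // => m _; rewrite hl mulr0.
Qed.

(** By stationarity of the occupancies, the difference between the inflow and the
    outflow of a level is the same for all levels, and it vanishes in the limit
    of large l. *)
Lemma level_flow N l : regular N ->
  EX N (fun x => rho_arr (G N) d lam (lev x l)) = EX N (fun x => load x l.+1).
Proof.
move=> rN; pose D l' := EX N (fun x => rho_arr (G N) d lam (lev x l')) - EX N (fun x => load x l'.+1).
have DS l' : D l' = D l'.+1.
  have : EX N (fun x => \sum_(m < M) VmN m N * genN N (fun x => occ x m l'.+1) x) = 0.
    rewrite Ex_sum => [|m _]; last by apply: boundedZ; apply: bounded_genN rN _; exact: bounded_occ.
    apply: big1 => m _; rewrite ExZ ?stationary_occ ?mulr0 //.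
    by apply: bounded_genN rN _; exact: bounded_occ.
  rewrite (_ : (fun x => \sum_(m < M) _) = fun x =>
      (rho_arr (G N) d lam (lev x l') - rho_arr (G N) d lam (lev x l'.+1))
      - (load x l'.+1 - load x l'.+2)); last first.
    by apply/funext => x; rewrite gen_level_balance.
  have br := @bounded_rho_arr N; have bl := @bounded_load N.
  rewrite ExB ?ExB //; [|exact: boundedB|exact: boundedB].
  by rewrite /D; lra.
have DE l' : D l' = D 0%N by elim: l' => [//|l' IH]; rewrite -DS.
suff D0 : D 0%N = 0 by apply/eqP; rewrite -subr_eq0 -/(D l) DE D0.
have E1 : EX N (fun x => load x l'.+1) @[l' --> \oo] --> (0 : R).
  by rewrite (cvg_shiftS (fun l => EX N (fun x => load x l))); exact: Eload_cvg0.
have E2 : EX N (fun x => rho_arr (G N) d lam (lev x l')) @[l' --> \oo] --> (0 : R).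
  have E3 : rhoN (G N) d lam u * EX N (fun x => load x l') @[l' --> \oo] --> (0 : R).
    rewrite -(mulr0 (rhoN (G N) d lam u)); apply: cvgM; [exact: cvg_cst|exact: Eload_cvg0].
  apply: squeeze_cvgr (cvg_cst 0) E3; apply: nearW => l'; apply/andP; split.
    by apply: Ex_ge0 => x; exact: rho_arr_ge0.
  rewrite -ExZ; last exact: bounded_load.
  apply: le_Ex => [||x]; [exact: bounded_rho_arr|apply: boundedZ; exact: bounded_load|].
  exact: rho_arr_lev_le.
have Dc : D l' @[l' --> \oo] --> (0 : R) by rewrite -(subr0 0); exact: cvgB.
have Dc' : D l' @[l' --> \oo] --> D 0%N by under eq_cvg do rewrite DE; exact: cvg_cst.
exact: (cvg_unique _ Dc' Dc).
Qed.

(** The definition of rho^N bounds the inflow into level l + 1 by rho^N times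
    the load of level l. *)
Lemma Eload_decay N l : regular N ->
  EX N (fun x => load x l) <= rhoN (G N) d lam u ^+ l * \sum_(m < M) u m * VmN m N.
Proof.
move=> rN; elim: l => [|l IH].
  rewrite mul1r -[leRHS](Ex_cst (pi N)).
  by apply: le_Ex => [||x]; [exact: bounded_load|exact: bounded_cst|exact: load_le].
rewrite -level_flow // exprS -mulrA; apply: le_trans (ler_wpM2l (rhoN_ge0 N) IH).
rewrite -ExZ; last exact: bounded_load.
apply: le_Ex => [||x]; [exact: bounded_rho_arr|apply: boundedZ; exact: bounded_load|].
exact: rho_arr_lev_le.
Qed.

Lemma Eload1 N : regular N -> EX N (fun x => load x 1) = lam * WN N.
Proof.
move=> rN; rewrite -level_flow // -[RHS](Ex_cst (pi N)); congr Ex; apply/funext => x.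
have [_ hdeg _ _] := rN.
rewrite /rho_arr (eq_bigr (fun=> lam)) => [|i _]; first by rewrite sumr_const card_ord mulr_natr.
rewrite hdeg; have -> : lev x 0 = [set: 'I_N]%SET by apply/setP => j; rewrite !inE.
by rewrite finset.setTI divff ?mulr1 // pnatr_eq0 -lt0n bin_gt0 hdeg.
Qed.

Lemma EX_occ N m l : regular N -> EX N (fun x => occ x m l) <=
  rhoN (G N) d lam u ^+ l * ((\sum_(m < M) u m * VmN m N) / (u m * VmN m N)).
Proof.
move=> rN; have [_ _ _ V0] := rN.
have uV : 0 < u m * VmN m N by rewrite mulr_gt0 // ltr0n.
rewrite mulrA ler_pdivlMr //; apply: le_trans (Eload_decay l rN).
rewrite mulrC -ExZ; last exact: bounded_occ.
apply: le_Ex => [||x]; [by apply: boundedZ; exact: bounded_occ|exact: bounded_load|].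
rewrite /load (bigD1 m) //= lerDl sumr_ge0 // => m' _.
by rewrite !mulr_ge0 ?occ_ge0 // ltW.
Qed.

(** * The stationary occupancy asymptotically dominates the fixed point *)

Local Notation it := (euler_iter d lam xi u v w p).
Local Notation qs := (eqm d lam xi u v w p).
Local Notation rhs := (ode_rhs d lam xi u v w p).

Definition pos (z : R) : R := Order.max 0 z.

Lemma pos_ge0 z : 0 <= pos z.
Proof. by rewrite /pos le_max lexx. Qed.

Lemma pos_ge z : z <= pos z.
Proof. by rewrite /pos le_max lexx orbT. Qed.

Lemma pos_le z c : 0 <= c -> z <= c -> pos z <= c.
Proof. by move=> c0 zc; rewrite /pos ge_max c0. Qed.

Lemma pos_id z : 0 <= z -> pos z = z.
Proof. by move=> z0; rewrite /pos max_r. Qed.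

Lemma pos_0 z : z <= 0 -> pos z = 0.
Proof. by move=> z0; rewrite /pos max_l. Qed.

(** The squared positive part is differentiable, with derivative of Lipschitz
    constant 2. *)
Lemma pos_sq_step z t : pos (z - t) ^+ 2 <= pos z ^+ 2 - 2 * pos z * t + t ^+ 2.
Proof.
have [z0|z0] := leP 0 z.
  rewrite (pos_id z0) [leRHS](_ : _ = (z - t) ^+ 2); last by ring.
  have [h|h] := leP 0 (z - t); first by rewrite pos_id.
  by rewrite pos_0 ?(ltW h) // expr0n sqr_ge0.
rewrite [pos z]pos_0 ?(ltW z0) // expr0n mulr0 mul0r subr0 add0r.
have [h|h] := leP 0 (z - t); last by rewrite pos_0 ?(ltW h) // expr0n sqr_ge0.
by rewrite pos_id // -[leRHS]sqrrN lerXn2r // ?nnegrE //; lra.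
Qed.

Lemma gen_le N (f h : state N -> R) (x : state N) (c e : R) : regular N -> 0 <= e ->
  (forall (y : state N) (j : 'I_N), (forall j', j' != j -> y j' = x j') -> f y - f x <= c * (h y - h x) + e) ->
  genN N f x <= c * genN N h x + rate_bound (G N) lam u * e.
Proof.
move=> [_ hdeg _ _] e0 H.
have hs := sum_rates (ltW hlam) (fun m => ltW (hu m)) hd hdeg x.
apply: le_trans (_ : _ <= c * genN N h x +
  \sum_j (arrival_rate (G N) d lam x j + service_rate (G N) u x j) * e) _; last first.
  by rewrite lerD2l -mulr_suml ler_wpM2r.
rewrite /gen mulr_sumr -big_split /=; apply: ler_sum => j _.
apply: (@le_trans _ _ (arrival_rate (G N) d lam x j * (c * (h (incr x j) - h x) + e)
  + service_rate (G N) u x j * (c * (h (decr x j) - h x) + e))); last first.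
  by rewrite le_eqVlt; apply/orP; left; apply/eqP; ring.
apply: lerD; apply: ler_wpM2l; rewrite ?(arr_ge0 _ _ (ltW hlam)) ?(srv_ge0 _ (fun m => ltW (hu m))) //.
  by apply: (H _ j) => j' jj'; rewrite ffunE (negbTE jj').
by apply: (H _ j) => j' jj'; rewrite ffunE (negbTE jj').
Qed.

(** The second-order error of the generator on squares of occupancies: a jump
    moves an occupancy by at most 1 / |V_m|, and [rate_bound] bounds the total
    rate of jumps, which is of order N. *)
Definition kink N m : R := rate_bound (G N) lam u * (VmN m N)^-1 ^+ 2.

Lemma kink_cvg m : kink N m @[N --> \oo] --> (0 : R).
Proof.
have h : (lam * (WN N / N%:R) + \sum_(m < M) u m) * (N%:R / VmN m N) * (VmN m N)^-1
    @[N --> \oo] --> (lam * xi + \sum_(m < M) u m) * (v m)^-1 * 0.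
  apply: cvgM; last exact: Vinv_cvg.
  apply: cvgM; last exact: NVm_cvg.
  apply: cvgD; last exact: cvg_cst.
  by apply: cvgM; [exact: cvg_cst|exact: hW].
rewrite mulr0 in h; apply: cvg_trans h; apply: near_eq_cvg.
apply: filterS (nbhs_infty_gt 0) => N N0.
have N1 : N%:R != 0 :> R by rewrite pnatr_eq0 -lt0n.
rewrite /kink /rate_bound expr2 [RHS]mulrA; congr (_ * _).
by move: (VmN m N)^-1 => V; field.
Qed.

Lemma gen_sq N (x : state N) m l c : regular N ->
  genN N (fun x => pos (c - occ x m l.+1) ^+ 2) x <=
  - 2 * pos (c - occ x m l.+1) * genN N (fun x => occ x m l.+1) x + kink N m.
Proof.
move=> rN; apply: gen_le => // y j yx.
have h1 := pos_sq_step (c - occ x m l.+1) (occ y m l.+1 - occ x m l.+1).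
have -> : c - occ y m l.+1 = c - occ x m l.+1 - (occ y m l.+1 - occ x m l.+1) by ring.
have h2 : (occ y m l.+1 - occ x m l.+1) ^+ 2 <= (VmN m N)^-1 ^+ 2.
  rewrite -[leLHS]real_normK ?num_real // lerXn2r ?nnegrE ?invr_ge0 //.
  exact: occ_jump yx.
by apply: le_trans (lerB h1 (lexx _)) _; lra.
Qed.

Lemma EX_unull (f : forall N, state N -> R) : unull f ->
  EX N (fun x => `|f N x|) @[N --> \oo] --> (0 : R).
Proof.
move=> fn; apply/cvgrPdist_le => e e0; apply: filterS (fn e e0) => N h.
rewrite sub0r normrN; have /andP[h1 h2] : 0 <= EX N (fun x => `|f N x|) <= e.
  by apply: Ex_bounds => x; rewrite normr_ge0 h.
by rewrite ger0_norm.
Qed.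

(** For numbers z >= 0, the bound z <= a + z ^ 2 / a holds for every a > 0. *)
Lemma EX_null_of_sq (Z : forall N, state N -> R) : (forall N x, 0 <= Z N x <= 1) ->
  EX N (fun x => Z N x ^+ 2) @[N --> \oo] --> (0 : R) ->
  EX N (fun x => Z N x) @[N --> \oo] --> (0 : R).
Proof.
move=> Z01 Z2; apply/cvgrPdist_le => e e0; pose a := e / 2.
have a0 : 0 < a by rewrite divr_gt0.
have a2 : 0 < a ^+ 2 by rewrite exprn_gt0.
move/cvgrPdist_le/(_ _ a2): Z2; apply: filterS => N.
have Zb : bounded (Z N) by exists 1 => x; have /andP[? ?] := Z01 N x; rewrite ger0_norm.
have Z2b : bounded (fun x => Z N x ^+ 2) by exact: boundedM.
rewrite !sub0r !normrN !ger0_norm; first last.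
- by apply: Ex_ge0 => x; rewrite sqr_ge0.
- by apply: Ex_ge0 => x; case/andP: (Z01 N x).
move=> h; apply: le_trans (_ : _ <= a + a^-1 * EX N (fun x => Z N x ^+ 2)) _.
  rewrite -ExZ // -[X in X + _](Ex_cst (pi N)) -ExD; [|exact: bounded_cst|exact: boundedZ].
  apply: le_Ex => // [|x]; first by apply: boundedD; [exact: bounded_cst|exact: boundedZ].
  rewrite -(ler_pM2l a0) mulrDr mulVKf ?gt_eqF //.
  have := sqr_ge0 (Z N x - a); have := sqr_ge0 (Z N x + a); nra.
have : a^-1 * EX N (fun x => Z N x ^+ 2) <= a.
  by rewrite ler_pdivrMl // -expr2.
rewrite /a; lra.
Qed.

Lemma occ0 N (x : state N) m : regular N -> occ x m 0 = 1.
Proof.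
move=> [_ _ _ V0]; rewrite occE /lev.
have -> : [set j | (0 <= x j)%N]%SET = [set: 'I_N]%SET by apply/setP => j; rewrite !inE.
exact: prof_setT.
Qed.

Lemma drift_bounded N m l : regular N -> bounded (fun x : state N =>
  genN N (fun x => occ x m l.+1) x - rhs (occ x) m l.+1).
Proof.
move=> rN; apply: boundedB; first by apply: bounded_genN => //; exact: bounded_occ.
have r0 := rhs_const_ge0 d hlam hxi hu hw hp hdk m.
have zu : unit_valued (fun (_ : 'I_M) (_ : nat) => 0 : R) by move=> ? ?; rewrite lexx ler01.
have rz : rhs (fun _ _ => 0) m l.+1 = 0 by rewrite rhsE !subrr !(mulr0, mul0r, addr0).
exists (rhs_const d lam xi u v w p m * (M%:R + M%:R) + u m) => x.
have := rhs_lip d hlam hxi hu hw hv hp hdk m l.+1 (occ_unit x) zu.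
have dM l' : dist_at (occ x) (fun _ _ => 0) l' <= M%:R.
  rewrite -[M in leRHS]card_ord -sum1_card natr_sum; apply: ler_sum => m' _.
  by rewrite subr0 ger0_norm ?occ_ge0 ?occ_le1.
rewrite rz !subr0 /= => h1; have h2 : `|u m * occ x m l.+2| <= u m.
  by rewrite ger0_norm ?mulr_ge0 ?(ltW (hu m)) ?occ_ge0 // -[leRHS]mulr1 ler_wpM2l ?(ltW (hu m)) ?occ_le1.
rewrite -[rhs _ _ _](subrK (u m * occ x m l.+2)) (le_trans (ler_normD _ _)) // lerD //.
by rewrite (le_trans h1) // ler_wpM2l ?lerD.
Qed.

Lemma bounded_pos N c m l : bounded (fun x : state N => pos (c - occ x m l)).
Proof.
exists `|c| => x; rewrite ger0_norm ?pos_ge0 // pos_le //.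
by have := occ_ge0 x m l; have := ler_norm c; lra.
Qed.

(** Where the occupancy is below the iterate n + 1, its drift points upwards at a
    rate proportional to the deficit, up to the deficits below the iterate n
    ([euler_rhs_ge]). The squared deficit has mean drift zero, so its mean is at
    most of the order of the mean deficits below the iterate n, which vanish by
    induction, and of the errors of the approximate drift. *)
Lemma EX_below_iter n m l : EX N (fun x => pos (it n m l - occ x m l)) @[N --> \oo] --> (0 : R).
Proof.
elim: n m l => [|n IH] m l.
  apply: cvg_near_cst; apply: filterS near_regular => N rN.
  rewrite -[RHS](Ex_cst (pi N)); congr Ex; apply/funext => x.
  case: l => [|l] /=; first by rewrite occ0 // subrr pos_0.
  by rewrite pos_0 // sub0r oppr_le0 occ_ge0.
case: l => [|l].
  apply: cvg_near_cst; apply: filterS near_regular => N rN.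
  rewrite -[RHS](Ex_cst (pi N)); congr Ex; apply/funext => x.
  by rewrite /= occ0 // subrr pos_0.
set c := it n.+1 m l.+1.
have [q1 q2 q3 q4] := euler_iter_spec d hlam hxi hu hw hv hp hdk n.
have [c1 _ _ _] := euler_iter_spec d hlam hxi hu hw hv hp hdk n.+1.
have /andP[c0 {}c1] := c1 m l.+1; rewrite -/c in c0 c1.
have Z01 N (x : state N) : 0 <= pos (c - occ x m l.+1) <= 1.
  by rewrite pos_ge0 pos_le //; have := occ_ge0 x m l.+1; lra.
apply: EX_null_of_sq => //.
set h := euler_step d lam xi u v w p.
have h0 : 0 < h := euler_step_gt0 d hlam hxi hu hw hp hdk.
pose C := rhs_const d lam xi u v w p m + u m + h^-1.
have C0 : 0 <= C.
  have r0 := rhs_const_ge0 d hlam hxi hu hw hp hdk m.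
  by apply: addr_ge0; [apply: addr_ge0 => //; exact: ltW|rewrite invr_ge0; exact: ltW].
pose S N (x : state N) := \sum_(m' < M) (pos (it n m' l - occ x m' l) +
  pos (it n m' l.+1 - occ x m' l.+1) + pos (it n m' l.+2 - occ x m' l.+2)).
have S0 N (x : state N) : 0 <= S N x.
  by apply: sumr_ge0 => m' _; rewrite !addr_ge0 ?pos_ge0.
pose D N (x : state N) := genN N (fun x => occ x m l.+1) x - rhs (occ x) m l.+1.
have D_cvg : EX N (fun x => `|D N x|) @[N --> \oo] --> (0 : R).
  by apply: EX_unull; exact: drift_unull.
have Sb N : bounded (S N).
  by apply: bounded_sum => m' _; apply: boundedD; [apply: boundedD|]; exact: bounded_pos.
have S_cvg : EX N (S N) @[N --> \oo] --> (0 : R).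
  have -> : (fun N => EX N (S N)) = fun N => \sum_(m' < M)
     (EX N (fun x => pos (it n m' l - occ x m' l)) +
      EX N (fun x => pos (it n m' l.+1 - occ x m' l.+1)) +
      EX N (fun x => pos (it n m' l.+2 - occ x m' l.+2))).
    apply/funext => N; rewrite Ex_sum => [|m' _]; last by apply: boundedD; [apply: boundedD|]; exact: bounded_pos.
    by apply: eq_bigr => m' _; rewrite !ExD //; try (exact: bounded_pos); apply: boundedD; exact: bounded_pos.
  rewrite -[X in _ --> X](_ : \sum_(m' < M) (0 + 0 + 0) = 0); last by rewrite big1 // => ? _; rewrite !addr0.
  by apply: cvg_sumr => m' _; apply: cvgD; [apply: cvgD|]; exact: IH.
have Db N : regular N -> bounded (fun x => `|D N x|).
  by move=> rN; apply: bounded_norm; exact: drift_bounded.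
have key N : regular N -> EX N (fun x => pos (c - occ x m l.+1) ^+ 2) <=
    h * (C * EX N (S N) + EX N (fun x => `|D N x|) + kink N m / 2).
  move=> rN; have Zb : bounded (fun x : state N => pos (c - occ x m l.+1)) by exact: bounded_pos.
  have Z2b : bounded (fun x : state N => pos (c - occ x m l.+1) ^+ 2) by exact: boundedM.
  have st : EX N (genN N (fun x => pos (c - occ x m l.+1) ^+ 2)) = 0.
    by apply: (@stationary_cap N l.+1) => // x; rewrite occ_cap.
  have pw (x : state N) : genN N (fun x => pos (c - occ x m l.+1) ^+ 2) x <=
      - (2 * h^-1) * pos (c - occ x m l.+1) ^+ 2 + (2 * (C * S N x) + 2 * `|D N x| + kink N m).
    apply: le_trans (gen_sq x m l c rN) _.
    have /andP[Z0 Z1] := Z01 N x.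
    have hg : genN N (fun x => occ x m l.+1) x = D N x + rhs (occ x) m l.+1 by rewrite subrK.
    (* The deficit is at most 1, so that it may be dropped in front of the error
       term. *)
    have hr : h^-1 * pos (c - occ x m l.+1) ^+ 2 - C * S N x <=
        pos (c - occ x m l.+1) * rhs (occ x) m l.+1.
      have := euler_rhs_ge d hlam hxi hu hw hv hp hdk m l (occ_unit x) (@occ_nonincr N x) q1 q2.
      rewrite -/h -/C -/(pos _) -/(S N x) (_ : euler _ _ _ _ _ _ _ _ _ _ = c) // => hr.
      have CS : 0 <= C * S N x by rewrite mulr_ge0.
      have [h1|h1] := leP 0 (c - occ x m l.+1); last first.
        by rewrite pos_0 ?(ltW h1) // expr0n mulr0 mul0r; lra.
      rewrite (pos_id h1) in Z1 *.
      have h2 := ler_wpM2l h1 hr; apply: le_trans h2.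
      have : (c - occ x m l.+1) * (C * S N x) <= C * S N x.
        by rewrite -[leRHS]mul1r ler_wpM2r.
      rewrite expr2; lra.
    have hD : - (pos (c - occ x m l.+1) * D N x) <= `|D N x|.
      rewrite -mulrN (le_trans (ler_norm _)) // normrM normrN ger0_norm //.
      by rewrite -[leRHS]mul1r ler_wpM2r.
    by rewrite hg; lra.
  have Db' := Db N rN.
  have : EX N (genN N (fun x => pos (c - occ x m l.+1) ^+ 2)) <=
     - (2 * h^-1) * EX N (fun x => pos (c - occ x m l.+1) ^+ 2)
     + (2 * (C * EX N (S N)) + 2 * EX N (fun x => `|D N x|) + kink N m).
    have b1 : bounded (fun x : state N => - (2 * h^-1) * pos (c - occ x m l.+1) ^+ 2) by exact: boundedZ.
    have b2 : bounded (fun x : state N => 2 * (C * S N x)) by apply: boundedZ; exact: boundedZ.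
    have b3 : bounded (fun x : state N => 2 * `|D N x|) by exact: boundedZ.
    have b4 : bounded (fun x : state N => 2 * (C * S N x) + 2 * `|D N x|) by exact: boundedD.
    have b5 : bounded (fun x : state N => kink N m) by exact: bounded_cst.
    have b6 := boundedD b4 b5; have b7 := boundedD b1 b6.
    rewrite -!ExZ //; last exact: boundedZ.
    rewrite -[kink N m in leRHS](Ex_cst (pi N)) -!ExD //.
    by apply: le_Ex => //; apply: bounded_genN.
  rewrite st => h1.
  have h2 : h^-1 * EX N (fun x => pos (c - occ x m l.+1) ^+ 2) <=
      C * EX N (S N) + EX N (fun x => `|D N x|) + kink N m / 2 by lra.
  by rewrite -ler_pdivrMl.
have up : h * (C * EX N (S N) + EX N (fun x => `|D N x|) + kink N m / 2) @[N --> \oo] --> (0 : R).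
  rewrite -[X in _ --> X](_ : h * (C * 0 + 0 + 0 / 2) = 0); last by rewrite mul0r mulr0 !addr0 mulr0.
  apply: cvgM; first exact: cvg_cst.
  apply: cvgD; last by apply: cvgM; [exact: kink_cvg|exact: cvg_cst].
  by apply: cvgD => //; apply: cvgM => //; exact: cvg_cst.
apply: squeeze_cvgr (cvg_cst 0) up; apply: filterS near_regular => N rN.
by rewrite key // andbT; apply: Ex_ge0 => x; rewrite sqr_ge0.
Qed.

Lemma EX_below_eqm m l : EX N (fun x => pos (qs m l - occ x m l)) @[N --> \oo] --> (0 : R).
Proof.
apply/cvgrPdist_le => e e0; have e2 : 0 < e / 2 by rewrite divr_gt0.
have [n hn] : exists n, qs m l - it n m l <= e / 2.
  have /cvgrPdist_le/(_ _ e2) := @euler_iter_cvg R K M d lam xi u v w p hlam hxi hu hw hv hp hdk m l.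
  by case=> n _ /(_ n (leqnn n)) /= h; exists n; apply: le_trans h; exact: ler_norm.
have /cvgrPdist_le/(_ _ e2) := EX_below_iter n m l; apply: filterS => N.
have E0 c : 0 <= EX N (fun x => pos (c - occ x m l)) by apply: Ex_ge0 => x; exact: pos_ge0.
rewrite !sub0r !normrN !ger0_norm // => h.
apply: le_trans (_ : _ <= e / 2 + EX N (fun x => pos (it n m l - occ x m l))) _; last by lra.
rewrite -[X in X + _](Ex_cst (pi N)) -ExD; [|exact: bounded_cst|exact: bounded_pos].
apply: le_Ex => [||x]; [exact: bounded_pos|apply: boundedD; [exact: bounded_cst|exact: bounded_pos]|].
apply: pos_le; first by rewrite addr_ge0 ?pos_ge0 // ltW.
by have := pos_ge (it n m l - occ x m l); lra.
Qed.

(** * Convergence of every level *)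

Hypothesis hw1 : \sum_(k < K) w k = 1.
Hypothesis hrho1 : rho < 1.
Hypothesis hM : (0 < M)%N.

Lemma qsS : inS qs.
Proof. exact: (eqm_inS hd hlam hxi hu hw hv hp hdk hw1 hrho1 subcritical_limit hM). Qed.

Lemma qs_fixed : fixed_point d lam xi u v w p qs.
Proof. exact: (eqm_fixed d hlam hxi hu hw hv hp hdk). Qed.

Lemma qs_throughput : \sum_(m < M) u m * v m * qs m 1%N = lam * xi.
Proof. exact: (fixed_throughput hd hdk hw1 qsS qs_fixed). Qed.

Lemma qs_unit : unit_valued qs.
Proof. exact: (eqm_unit d hlam hxi hu hw hv hp hdk). Qed.

Definition err N m l : R := EX N (fun x => `|qs m l - occ x m l|).

Lemma err_ge0 N m l : 0 <= err N m l.
Proof. by apply: Ex_ge0 => x; exact: normr_ge0. Qed.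

Lemma bounded_gap N m l : bounded (fun x : state N => qs m l - occ x m l).
Proof. by apply: boundedB; [exact: bounded_cst|exact: bounded_occ]. Qed.

(** The absolute value of z is - z + 2 * pos z. Since the deficits vanish,
    only an upper bound of the mean occupancy remains to be found. *)
Lemma errE N m l : err N m l =
  EX N (fun x => occ x m l) - qs m l + 2 * EX N (fun x => pos (qs m l - occ x m l)).
Proof.
rewrite -[qs m l in X in X + _](Ex_cst (pi N)) -ExB; [|exact: bounded_occ|exact: bounded_cst].
rewrite -ExZ; last exact: bounded_pos.
rewrite -ExD; [|by apply: boundedB; [exact: bounded_occ|exact: bounded_cst]|by apply: boundedZ; exact: bounded_pos].
congr Ex; apply/funext => x; have [h|h] := leP 0 (qs m l - occ x m l).
  by rewrite pos_id // ger0_norm //; ring.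
by rewrite pos_0 ?(ltW h) // ltr0_norm //; ring.
Qed.

Lemma EX_occ_unit N m l : 0 <= EX N (fun x => occ x m l) <= 1.
Proof. by apply: Ex_bounds => x; exact: occ_unit. Qed.

(** In the stationary state the departure rate equals the arrival rate
    ([Eload1]). *)
Lemma EX_occ1_cvg : \sum_(m < M) u m * v m * EX N (fun x => occ x m 1) @[N --> \oo] --> lam * xi.
Proof.
have h1 m : u m * ((VmN m N / N%:R - v m) * EX N (fun x => occ x m 1)) @[N --> \oo] --> (0 : R).
  have hn : unull (fun N (_ : unit) => EX N (fun x => occ x m 1) * (VmN m N / N%:R - v m)).
    apply: unull_bddM; last by apply: unull_cvg; exact: hVm.
    apply: (@ubdd_le _ _ _ 1) => N _; have /andP[? ?] := EX_occ_unit N m 1.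
    by rewrite ger0_norm.
  have h := cvg_unull (fun=> tt) hn; rewrite -(mulr0 (u m)).
  apply: cvgM; first exact: cvg_cst.
  by under eq_cvg do rewrite mulrC.
have h2 : lam * (WN N / N%:R) @[N --> \oo] --> lam * xi by apply: cvgM => //; exact: cvg_cst.
have h3 : lam * (WN N / N%:R) - \sum_(m < M) u m * ((VmN m N / N%:R - v m) * EX N (fun x => occ x m 1))
    @[N --> \oo] --> lam * xi.
  rewrite -[X in _ --> X]subr0; apply: cvgB => //.
  rewrite -[X in _ --> X](_ : \sum_(m < M) 0 = 0); last by rewrite big1.
  by apply: cvg_sumr => m _; exact: h1.
apply: cvg_trans h3; apply: near_eq_cvg; apply: filterS near_regular => N rN.
have [_ _ N0 _] := rN; have N1 : N%:R != 0 :> R by rewrite pnatr_eq0 -lt0n.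
rewrite mulrA -(Eload1 rN) /load Ex_sum => [|m _]; last by apply: boundedZ; exact: bounded_occ.
rewrite mulr_suml -sumrB; apply: eq_bigr => m _.
by rewrite ExZ; [field|exact: bounded_occ].
Qed.

(** The weighted sum of the errors over the classes converges to 0, because
    the fixed point has the same throughput as the stationary state. *)
Lemma err1_cvg m : err N m 1 @[N --> \oo] --> (0 : R).
Proof.
have hS : \sum_(m' < M) u m' * v m' * err N m' 1 @[N --> \oo] --> (0 : R).
  have -> : (fun N => \sum_(m' < M) u m' * v m' * err N m' 1) = fun N =>
      (\sum_(m' < M) u m' * v m' * EX N (fun x => occ x m' 1) - lam * xi)
      + \sum_(m' < M) u m' * v m' * (2 * EX N (fun x => pos (qs m' 1 - occ x m' 1))).
    apply/funext => N; rewrite -qs_throughput -sumrB -big_split.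
    by apply: eq_bigr => m' _ /=; rewrite errE; ring.
  rewrite -[X in _ --> X](_ : (lam * xi - lam * xi) + \sum_(m' < M) u m' * v m' * (2 * 0) = 0); last first.
    by rewrite subrr add0r big1 // => m' _; rewrite !mulr0.
  apply: cvgD; first by apply: cvgB; [exact: EX_occ1_cvg|exact: cvg_cst].
  apply: cvg_sumr => m' _; apply: cvgM; first exact: cvg_cst.
  by apply: cvgM; [exact: cvg_cst|exact: EX_below_eqm].
have uv : 0 < u m * v m by rewrite mulr_gt0.
have h0 : (u m * v m)^-1 * (\sum_(m' < M) u m' * v m' * err N m' 1) @[N --> \oo] --> (0 : R).
  by rewrite -[X in _ --> X](mulr0 (u m * v m)^-1); apply: cvgM => //; exact: cvg_cst.
apply: squeeze_cvgr (cvg_cst 0) h0; apply: nearW => N; rewrite err_ge0 /=.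
rewrite -(ler_pM2l uv) mulVKf ?gt_eqF // (bigD1 m) //= lerDl sumr_ge0 // => m' _.
by rewrite mulr_ge0 ?err_ge0 // ltW // mulr_gt0.
Qed.

(** The mean drift of level l + 1 is 0. Up to errors at levels l and l + 1, this
    drift is that of the fixed point plus u m times the deviation at level
    l + 2, so the mean deviation at level l + 2 is asymptotically at most 0. *)
Lemma err_cvg m l : err N m l @[N --> \oo] --> (0 : R).
Proof.
suff h : forall l, (forall m, err N m l @[N --> \oo] --> (0 : R)) /\
    (forall m, err N m l.+1 @[N --> \oo] --> (0 : R)) by have [] := h l.
elim=> [|{}l [IH0 IH1]].
  split=> {}m; last exact: err1_cvg.
  apply: cvg_near_cst; apply: filterS near_regular => N rN.
  rewrite -[RHS](Ex_cst (pi N)); congr Ex; apply/funext => x.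
  have [_ q0 _ _] := qsS.
  by rewrite occ0 // q0 subrr normr0.
split=> [|{}m]; first exact: IH1.
pose D N (x : state N) := genN N (fun x => occ x m l.+1) x - rhs (occ x) m l.+1.
have D_cvg : EX N (fun x => `|D N x|) @[N --> \oo] --> (0 : R).
  by apply: EX_unull; exact: drift_unull.
set c := rhs_const d lam xi u v w p m.
have dsum N l' : EX N (fun x => dist_at (occ x) qs l') = \sum_(m' < M) err N m' l'.
  rewrite /dist_at Ex_sum => [|m' _].
    by apply: eq_bigr => m' _; congr Ex; apply/funext => x; rewrite distrC.
  by apply: bounded_norm; apply: boundedB; [exact: bounded_occ|exact: bounded_cst].
have dbd N l' : bounded (fun x : state N => dist_at (occ x) qs l').
  apply: bounded_sum => m' _; apply: bounded_norm.
  by apply: boundedB; [exact: bounded_occ|exact: bounded_cst].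
have key N : regular N -> err N m l.+2 <= (u m)^-1 * (EX N (fun x => `|D N x|) +
    c * (\sum_(m' < M) err N m' l + \sum_(m' < M) err N m' l.+1))
    + 2 * EX N (fun x => pos (qs m l.+2 - occ x m l.+2)).
  move=> rN; rewrite errE lerD2r -(ler_pM2l (hu m)) mulVKf ?gt_eqF //.
  have bg : bounded (genN N (fun x => occ x m l.+1)) by apply: bounded_genN => //; exact: bounded_occ.
  have bD : bounded (fun x => `|D N x|) by exact: (bounded_norm (drift_bounded m l rN)).
  have b1 : bounded (fun x : state N => occ x m l.+2 - qs m l.+2).
    by apply: boundedB; [exact: bounded_occ|exact: bounded_cst].
  have b2 : bounded (fun x : state N => c * (dist_at (occ x) qs l + dist_at (occ x) qs l.+1)).
    by apply: boundedZ; exact: boundedD.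
  have e1 : u m * (EX N (fun x => occ x m l.+2) - qs m l.+2) =
      EX N (fun x => u m * (occ x m l.+2 - qs m l.+2)).
    by rewrite ExZ // ExB ?Ex_cst //; [exact: bounded_occ|exact: bounded_cst].
  have e2 : EX N (fun x => genN N (fun x => occ x m l.+1) x + (`|D N x| +
      c * (dist_at (occ x) qs l + dist_at (occ x) qs l.+1))) =
      EX N (fun x => `|D N x|) + c * (\sum_(m' < M) err N m' l + \sum_(m' < M) err N m' l.+1).
    rewrite ExD //; last exact: boundedD.
    by rewrite stationary_occ // add0r ExD // ExZ ?ExD ?dsum //; exact: boundedD.
  rewrite e1 -e2; apply: le_Ex => [||x].
  - exact: boundedZ.
  - by apply: boundedD => //; exact: boundedD.
  have := rhs_lip d hlam hxi hu hw hv hp hdk m l.+1 (occ_unit x) qs_unit.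
  rewrite (eqm_rhs d hlam hxi hu hw hv hp hdk) subr0 -/c /= => h1.
  have h2 := ler_norm (- (rhs (occ x) m l.+1 - u m * (occ x m l.+2 - qs m l.+2))).
  have h3 := ler_norm (- D N x); rewrite !normrN in h2 h3.
  have h4 : genN N (fun x => occ x m l.+1) x = D N x + rhs (occ x) m l.+1 by rewrite subrK.
  by rewrite h4; lra.
have up : (u m)^-1 * (EX N (fun x => `|D N x|) +
    c * (\sum_(m' < M) err N m' l + \sum_(m' < M) err N m' l.+1))
    + 2 * EX N (fun x => pos (qs m l.+2 - occ x m l.+2)) @[N --> \oo] --> (0 : R).
  rewrite -[X in _ --> X](_ : (u m)^-1 * (0 + c * (\sum_(m' < M) 0 + \sum_(m' < M) 0)) + 2 * 0 = 0);
    last by rewrite !big1 // !(mulr0, addr0).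
  apply: cvgD; last by apply: cvgM; [exact: cvg_cst|exact: EX_below_eqm].
  apply: cvgM; first exact: cvg_cst.
  apply: cvgD => //; apply: cvgM; first exact: cvg_cst.
  by apply: cvgD; apply: cvg_sumr => m' _; [exact: IH0|exact: IH1].
apply: squeeze_cvgr (cvg_cst 0) up; apply: filterS near_regular => N rN.
by rewrite key // err_ge0.
Qed.

(** * Uniform tails and weak convergence *)

(** Any ratio strictly between rho and 1 will do. *)
Let r : R := (1 + rho) / 2.

Lemma r_bounds : [/\ 0 < r, r < 1 & rho < r].
Proof.
have := rho_gt0 hlam hxi hu hv hdk hw1 subcritical_limit hM.
by have := hrho1; rewrite /r => rho1 rho0; split; lra.
Qed.

(** Both the stationary mean occupancies and the fixed point decay
    geometrically, for large N with ratios at most r. *)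
Lemma err_tail m : exists2 C, 0 <= C & \forall N \near \oo, forall l, err N m l <= C * r ^+ l.
Proof.
have [r0 r1 rr] := r_bounds.
have um := hu m; have vm := hv m.
have rho0 := rho_gt0 hlam hxi hu hv hdk hw1 subcritical_limit hM.
have h : (\sum_(m' < M) u m' * (VmN m' N / N%:R)) * (N%:R / VmN m N) * (u m)^-1 @[N --> \oo] -->
    (\sum_(m' < M) u m' * v m') * (v m)^-1 * (u m)^-1.
  apply: cvgM; last exact: cvg_cst.
  apply: cvgM; last exact: NVm_cvg.
  by apply: cvg_sumr => m' _; apply: cvgM; [exact: cvg_cst|exact: hVm].
set a := _ * (u m)^-1 in h; pose C1 := a + 1; pose C2 := capacity u v / (u m * v m).
have a0 : 0 <= a.
  rewrite /a !mulr_ge0 ?invr_ge0 ?(ltW um) ?(ltW vm) //.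
  by apply: sumr_ge0 => m' _; rewrite mulr_ge0 ?(ltW (hu m')) ?(ltW (hv m')).
have C20 : 0 <= C2.
  by rewrite divr_ge0 ?(capacity_ge0 hu hv) // mulr_ge0 ?(ltW um) ?(ltW vm).
exists (C1 + C2); first by rewrite /C1; lra.
have aC : a < C1 by rewrite ltrDl.
apply: filterS3 near_regular (cvgr_le _ h _ aC) (cvgr_le _ hrho _ rr) => N rN hC1 hr l.
have [_ _ N0 V0] := rN; have N1 : N%:R != 0 :> R by rewrite pnatr_eq0 -lt0n.
have V1 : VmN m N != 0 by rewrite pnatr_eq0 -lt0n.
apply: (@le_trans _ _ (EX N (fun x => occ x m l) + qs m l)).
  rewrite -[X in _ + X](Ex_cst (pi N)) -ExD; [|exact: bounded_occ|exact: bounded_cst].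
  apply: le_Ex => [||x]; first by apply: bounded_norm; exact: bounded_gap.
    by apply: boundedD; [exact: bounded_occ|exact: bounded_cst].
  have /andP[? ?] := qs_unit m l; have := occ_ge0 x m l.
  by rewrite ler_norml; lra.
rewrite mulrDl lerD //; last first.
  apply: le_trans (eqm_geo hd hlam hxi hu hw hv hp hdk hw1 subcritical_limit hM m l) _.
  by rewrite ler_wpM2l // lerXn2r ?nnegrE // ltW.
apply: le_trans (EX_occ m l rN) _; rewrite mulrC ler_pM ?exprn_ge0 ?rhoN_ge0 //.
- rewrite divr_ge0 ?mulr_ge0 ?(ltW um) //.
  by apply: sumr_ge0 => m' _; rewrite mulr_ge0 // ltW.
- apply: le_trans hC1; rewrite le_eqVlt; apply/orP; left; apply/eqP.
  rewrite (_ : \sum_(m' < M) u m' * (VmN m' N / N%:R) = (\sum_(m' < M) u m' * VmN m' N) / N%:R).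
    by field; rewrite N1 V1 gt_eqF.
  by rewrite mulr_suml; apply: eq_bigr => m' _; ring.
- by rewrite lerXn2r ?nnegrE ?rhoN_ge0 // ltW.
Qed.

Lemma err_sum m (e : R) : 0 < e ->
  \forall N \near \oo, forall n, \sum_(0 <= l < n) err N m l <= e.
Proof.
move=> e0; have e2 : 0 < e / 2 by rewrite divr_gt0.
have [r0 r1 rr] := r_bounds; have [C C0 hC'] := err_tail m.
have r1' : 0 < 1 - r by rewrite subr_gt0.
have [L hL] : exists L, C * r ^+ L / (1 - r) <= e / 2.
  have rn : `|r| < 1 by rewrite gtr0_norm.
  have h : C * r ^+ n / (1 - r) @[n --> \oo] --> C * 0 / (1 - r).
    apply: cvgM; last exact: cvg_cst.
    by apply: cvgM; [exact: cvg_cst|exact: cvg_expr].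
  rewrite mulr0 mul0r in h.
  have [n _ /(_ n (leqnn n)) /= hn] := cvgr_le _ h _ e2.
  by exists n.
have hS : \sum_(0 <= l < L) err N m l @[N --> \oo] --> (0 : R).
  rewrite -[X in _ --> X](_ : \sum_(0 <= l < L) 0 = 0); last by rewrite big1.
  by apply: cvg_sumr => l _; exact: err_cvg.
apply: filterS2 hC' (cvgr_le _ hS _ e2) => N hN hNS n.
have tail k : \sum_(0 <= l < L + k) err N m l <=
    \sum_(0 <= l < L) err N m l + C * (r ^+ L - r ^+ (L + k)) / (1 - r).
  elim: k => [|k IHk]; first by rewrite addn0 subrr mulr0 mul0r addr0.
  rewrite addnS big_nat_recr //=.
  apply: le_trans (lerD IHk (hN (L + k)%N)) _; rewrite -addrA lerD2l.
  rewrite le_eqVlt; apply/orP; left; apply/eqP; rewrite exprS.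
  by field; rewrite gt_eqF.
apply: le_trans (_ : _ <= \sum_(0 <= l < L + n) err N m l) _.
  rewrite addnC (big_cat_nat (leq0n n) (leq_addr L n)) /= lerDl.
  by apply: sumr_ge0 => l _; exact: err_ge0.
apply: le_trans (tail n) _; rewrite (splitr e) lerD //.
apply: le_trans hL; rewrite ler_wpM2r ?invr_ge0 ?(ltW r1') // ler_wpM2l //.
by rewrite lerBlDr lerDl exprn_ge0 // ltW.
Qed.

Lemma EX_l1dist_le (e : R) : 0 < e -> \forall N \near \oo,
  (\int[pi N]_x l1dist qs (occ x) <= e%:E)%E.
Proof.
move=> e0; have eM : 0 < e / M%:R by rewrite divr_gt0 // ltr0n.
have h : \forall N \near \oo, forall m n, \sum_(0 <= l < n) err N m l <= e / M%:R.
  by apply: filter_forall => m; exact: err_sum.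
apply: filterS h => N h.
rewrite /l1dist ge0_integral_sum //; last first.
  by move=> m x _; apply: nneseries_ge0 => l _ _; rewrite lee_fin.
apply: (@le_trans _ _ (\sum_(m < M) (e / M%:R)%:E)%E); last first.
  rewrite sumEFin lee_fin sumr_const card_ord -[(e / _) *+ _]mulr_natr divfK //.
  by rewrite pnatr_eq0 -lt0n.
apply: lee_sum => m _.
rewrite integral_nneseries //.
apply: lime_le; first by apply: is_cvg_nneseries => l _ _; apply: integral_ge0 => x _; rewrite lee_fin.
apply: nearW => n.
rewrite (_ : (\sum_(0 <= l < n) _)%E = (\sum_(0 <= l < n) err N m l)%:E); first by rewrite lee_fin.
rewrite -sumEFin; apply: eq_bigr => l _.
rewrite /err /Ex /Rintegral fineK //; apply: integrable_fin_num => //.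
by apply: bounded_integrable; apply: bounded_norm; exact: bounded_gap.
Qed.

Lemma occ_inS N (x : state N) : regular N -> inS (occ x).
Proof.
move=> rN; split; [exact: occ_unit|by move=> m; exact: occ0|exact: occ_nonincr|move=> m].
have [L _ hL] := occ_eventually0 x m.
apply/cvg_ex; exists (series (occ x m) L); apply: cvg_near_cst.
apply: filterS (nbhs_infty_ge L) => n Ln.
rewrite !seriesEnat /= (big_cat_nat (leq0n L) Ln) /= [X in _ + X]big_nat_cond [X in _ + X]big1 ?addr0 //.
by move=> l /andP[/andP[Ll _] _]; exact: hL.
Qed.

(** Near the fixed point the test function differs from its value there by at
    most e / 2; elsewhere the difference is at most 2 * B, which a multiple of the
    l1 distance dominates. *)
Lemma weak_convergence : weak_cvg_S pi (fun N => occupancy (G N)) qs.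
Proof.
move=> f fcont [B fB].
have B0 : 0 <= B by exact: le_trans (normr_ge0 _) (fB qs qsS).
pose F N (x : state N) := f (occ x).
have Fb N : regular N -> bounded (F N).
  by move=> rN; exists B => x; apply: fB; exact: occ_inS.
have F_cvg : EX N (F N) @[N --> \oo] --> f qs.
  apply/cvgrPdist_le => e e0; have e2 : 0 < e / 2 by rewrite divr_gt0.
  have [eta eta0 feta] := fcont qs qsS _ e2.
  (* The slope 2 * (B + 1) / eta exceeds 2 * B at distance eta; adding 1 to B
     keeps it positive. *)
  have c0 : 0 < 2 * (B + 1) / eta by rewrite divr_gt0 // mulr_gt0 // ltr_wpDl.
  set c := 2 * (B + 1) / eta in c0.
  have ec : 0 < e / 2 / c by rewrite divr_gt0.
  apply: filterS2 near_regular (EX_l1dist_le ec) => N rN hN.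
  have Fbd := Fb N rN; have Fqb : bounded (fun x => `|f qs - F N x|).
    by apply: bounded_norm; apply: boundedB => //; exact: bounded_cst.
  have l0 (x : state N) : (0 <= l1dist qs (occ x))%E.
    by apply: sume_ge0 => m _; apply: nneseries_ge0 => l _ _; rewrite lee_fin.
  have pw (x : state N) : (`|f qs - F N x|%:E <= (e / 2)%:E + c%:E * l1dist qs (occ x))%E.
    have [lt_eta|ge_eta] := ltP (l1dist qs (occ x)) eta%:E.
      apply: (@le_trans _ _ (e / 2)%:E).
        by rewrite lee_fin ltW // feta //; exact: occ_inS.
      by rewrite leeDl // mule_ge0 // lee_fin ltW.
    apply: (@le_trans _ _ (c%:E * eta%:E)%E).
      rewrite -EFinM lee_fin /c divfK ?gt_eqF //.
      have h1 := fB _ qsS; have h2 := fB _ (occ_inS x rN).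
      by apply: le_trans (ler_normB _ _) _; rewrite /F; lra.
    apply: (@le_trans _ _ (c%:E * l1dist qs (occ x))%E).
      by rewrite lee_pmul2l // lte_fin.
    by rewrite leeDr // lee_fin ltW.
  have : (\int[pi N]_x `|f qs - F N x|%:E <= e%:E)%E.
    apply: (@le_trans _ _ (\int[pi N]_x ((e / 2)%:E + c%:E * l1dist qs (occ x)))%E).
      by apply: ge0_le_integral.
    rewrite ge0_integralD //; first last.
    - by move=> x _; rewrite mule_ge0 // lee_fin ltW.
    - by move=> x _; rewrite lee_fin ltW.
    rewrite integral_cst // ge0_integralZl_EFin //; last by rewrite ltW.
    set mass := (X in (_ * X + _ <= _)%E).
    have -> : mass = 1%E by exact: probability_setT.
    rewrite mule1 [in leRHS](splitr e) EFinD leeD2l //.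
    have -> : (e / 2)%:E = (c%:E * (e / 2 / c)%:E)%E by rewrite -EFinM [c * _]mulrC divfK ?gt_eqF.
    by rewrite lee_pmul2l // lte_fin.
  move=> h; have EN : EX N (fun x => `|f qs - F N x|) <= e.
    rewrite -lee_fin /Ex /Rintegral fineK //; apply: integrable_fin_num => //.
    exact: bounded_integrable.
  have eB : f qs - EX N (F N) = EX N (fun x => f qs - F N x).
    by rewrite ExB ?Ex_cst //; exact: bounded_cst.
  rewrite eB; apply: le_trans EN; apply: le_normr_Rintegral => //.
  by apply: bounded_integrable; apply: boundedB => //; exact: bounded_cst.
apply: cvg_EFin.
  apply: filterS near_regular => N rN; rewrite unlock; apply: integrable_fin_num => //.
  by apply: bounded_integrable; exact: Fb.
by rewrite unlock; exact: F_cvg.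
Qed.

End Asymptotics.

Theorem theorem3p13 (R : realType) (K M d : nat)
  (hK : (1 <= K)%N) (hM : (1 <= M)%N) (hd : (2 <= d)%N)
  (lam xi : R) (u v : 'I_M -> R) (w : 'I_K -> R)
  (hlam : 0 < lam) (hxi : 0 < xi) (hu : forall m, 0 < u m)
  (hw : forall k, 0 < w k) (hw1 : \sum_(k < K) w k = 1)
  (hv : forall m, 0 < v m) (hv1 : \sum_(m < M) v m = 1)
  (hcap : lam * xi < \sum_(m < M) u m * v m)
  (G : forall N, bigraph K M N)
  (hW : (nW (G N))%:R / N%:R @[N --> \oo] --> xi)
  (hWk : forall k, #|Wcls (G N) k|%:R / (nW (G N))%:R @[N --> \oo] --> w k)
  (hVm : forall m, #|Vcls (G N) m|%:R / N%:R @[N --> \oo] --> v m)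
  (p : 'I_K -> 'I_M -> R) (hp : forall k m, 0 <= p k m <= 1)
  (hdk : forall k, 0 < dk v p k)
  (rho : R) (hrho : rhoN (G N) d lam u @[N --> \oo] --> rho) (hrho1 : rho < 1)
  (hcps : @clustered_prop_sparse R K M G)
  (hC : conditionC G p) :
  exists qs : 'I_M -> nat -> R,
    [/\ inS qs,
        fixed_point d lam xi u v w p qs,
        forall q, inS q -> fixed_point d lam xi u v w p q -> q = qs
      & forall pi : forall N, probability (state N) R,
          (\forall N \near \oo, stationary (Qmatrix (G N) d lam u) (pi N)) ->
          weak_cvg_S pi (fun N => occupancy (G N)) qs].
Proof.
have d0 : (0 < d)%N by exact: leq_trans hd.
have sub := subcritical_limit d0 hlam hxi hu hw hv hp hdk hW hWk hVm hcps hC hrho.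
exists (eqm d lam xi u v w p); split.
- exact: (eqm_inS d0 hlam hxi hu hw hv hp hdk hw1 hrho1 sub hM).
- exact: (eqm_fixed d hlam hxi hu hw hv hp hdk).
- by move=> q qS qf; exact: (fixed_unique d0 hlam hxi hu hw hv hp hdk hw1 hrho1 sub hM).
- move=> pi hpi.
  exact: (weak_convergence d0 hlam hxi hu hw hv hp hdk hW hWk hVm hcps hC hrho hpi hw1 hrho1 hM).
Qed.
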